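(* Let $M$ be a manifold with a foliation $\mathcal F$ of codimension $2q$, and let $\nabla$ be a strongly twistor-suitable connection on $N\mathcal F$ (i.e. an adapted connection whose structures $\mathcal I_2$, and hence $\mathcal I_1$, are projectable). Then $\mathcal I_2$ is never integrable, and $\mathcal I_1$ is integrable if and only if one of the following holds: (i) $q\ge3$, and the torsion and curvature of $\nabla$ are of the form $$T_\nabla(X,Y)=\alpha(X)\pi_N(Y)-\alpha(Y)\pi_N(X),$$ $$R_\nabla(X,Y)(\pi_NZ)=\beta(X,Z)\pi_NY-\beta(Y,Z)\pi_NX+\gamma(X,Y)\pi_NZ;$$ (ii) $q=1$; (iii) $q=2$, the torsion is of the form $T_\nabla(X,Y)=\alpha(X)\pi_N(Y)-\alpha(Y)\pi_N(X)$, and $$R_\nabla(X,Y)\pi_NX=\xi(X,Y)\pi_NX+\zeta(X,X)\pi_NY,$$ or, equivalently by polarization, $$R_\nabla(X,Y)\pi_NZ+R_\nabla(Z,Y)\pi_NX=\xi(X,Y)\pi_NZ+\xi(Z,Y)\pi_NX+2\zeta(X,Z)\pi_NY.$$ Here $X,Y,Z$ are vector fields on $M$; $\alpha$ is a $1$-form which vanishes on $F$; $\gamma$ is a $2$-form which satisfies $\gamma(X,Y)=\frac1{2q}tr\,R_\nabla(X,Y)$ if $Y\in F$; $\beta$ is a $2$-covariant tensor field which vanishes if one of its arguments is in $F$; $\xi$ is a $2$-form such that $\xi(X,Y)=\frac1{2q}tr\,R_\nabla(X,Y)$ if $Y\in F$; and $\zeta$ is a symmetric $2$-covariant tensor field which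 vanishes if one of its arguments is in $F$. Moreover, after a choice of a complement $E$ of $F$ in $TM$, the values of $\alpha,\beta,\gamma,\xi,\zeta$ are completely determined by traces of $T_\nabla$ and $R_\nabla$.
   Context: All objects are $C^\infty$. $(M,\mathcal F)$ is a manifold of dimension $n=p+2q$, $q\ge1$, with a foliation $\mathcal F$ of codimension $2q$; $F=T\mathcal F\subset TM$, $N\mathcal F=TM/F$, $\pi_N:TM\to N\mathcal F$ is the projection, $\Gamma$ denotes sections. A vector field $X$ (on an open set) is foliated if $[X,Y]\in\Gamma F$ for all $Y\in\Gamma F$; a section of $N\mathcal F$ is foliated if locally it is $\pi_N X$ with $X$ foliated. An adapted (Bott) connection is a linear connection $\nabla$ on $N\mathcal F$ with $\nabla_Y(\pi_NX)=\pi_N[Y,X]$ for $Y\in\Gamma F$, $X\in\Gamma TM$. Torsion: $T_\nabla(X,Y)=\nabla_X(\pi_NY)-\nabla_Y(\pi_NX)-\pi_N[X,Y]$; it vanishes if an argument is in $F$. Curvature: $R_\nabla(X,Y)=\nabla_X\nabla_Y-\nabla_Y\nabla_X-\nabla_{[X,Y]}\in End\,N\mathcal F$. (For a strongly twistor-suitable connection, $R_\nabla(X,Y)=\frac1{2q}tr\,R_\nabla(X,Y)\,Id$ whenever $Y\in F$.) Transversal twistor space: $\mathcal Z(\mathcal F)=\{J\in End(N_x\mathcal F): J^2=-Id,\ x\in M\}$, with projection $Q:\mathcal Z(\mathcal F)\to M$. An adapted connection $\nabla$ gives $T\mathcal Z(\mathcal F)=\mathcal H\oplus\mathcal V$, where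 $\mathcal V=\ker Q_*$ and $\mathcal H$ is the distribution of velocities of $\nabla$-parallel curves. The lifted foliation $\hat{\mathcal F}$ has as tangent space at $J$ the horizontal lift of $F_{Q(J)}$ (independent of the choice of adapted connection). One identifies $\mathcal V_J=\{A\in End(N_{Q(J)}\mathcal F): AJ+JA=0\}$, and $N\hat{\mathcal F}=T\mathcal Z(\mathcal F)/T\hat{\mathcal F}\cong Q^*N\mathcal F\oplus\mathcal V$ (via $\mathcal H/T\hat{\mathcal F}\cong Q^*N\mathcal F$). The connection $\nabla$ defines two complex structures of the bundle $N\hat{\mathcal F}$: $\mathcal I_1(v,A)=(Jv,J\circ A)$, $\mathcal I_2(v,A)=(Jv,-J\circ A)$ at $J$. $\mathcal I_a$ is ($\hat{\mathcal F}$-)projectable if it maps foliated local sections of $N\hat{\mathcal F}$ to foliated sections, i.e. it is locally the lift of an almost complex structure of the local slice spaces (local leaf spaces) of $\hat{\mathcal F}$. A projectable $\mathcal I_a$ is integrable if these almost complex structures of the slice spaces are integrable.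
   Formalization: In (iii), ξ is only required to be a 2-covariant tensor field, not an alternating 2-form: putting Y=X shows an alternating ξ forces ζ=0, which fails for the Levi-Civita connection of S^4 foliated by points, where I_1 is integrable. *)

(* Defs.v *)
From HB Require Import structures.
From mathcomp Require Import all_boot all_order all_algebra.
From mathcomp Require Import all_classical all_reals all_analysis.
Set Implicit Arguments.
Unset Strict Implicit.
Unset Printing Implicit Defensive.
Import Order.TTheory GRing.Theory Num.Theory.
Import numFieldNormedType.Exports.
Local Open Scope classical_set_scope.
Local Open Scope ring_scope.

(* In finite dimension a map is C^(k+1) on an open set iff all its directional
   derivatives exist there and are C^k. *)
Fixpoint isCk (R : realType) (V W : normedModType R) (k : nat) (U : set V)
    (f : V -> W) : Prop :=
  (forall x, U x -> {for x, continuous f}) /\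
  match k with
  | 0 => True
  | k'.+1 => forall v : V,
      (forall x, U x -> derivable f x v) /\ isCk k' U (fun x => 'D_v f x)
  end.

Definition smooth (R : realType) (V W : normedModType R) (U : set V)
    (f : V -> W) : Prop := forall k, isCk k U f.

Definition bracket (R : realType) (V : normedModType R) (X Y : V -> V) : V -> V :=
  fun x => 'D_(X x) Y x - 'D_(Y x) X x.

(* A point or vector of R^(p + d) is a column; the first p coordinates are those
   along the leaves and the last d ones are transversal to them.  Hence F is
   spanned by the first p coordinate fields, N F is trivialized by the classes of
   the last d ones, and dsubmx represents pi_N. *)
Notation vec R p d := ('cV[R]_(p + d)).

Definition inF (R : realType) (p d : nat) (v : vec R p d) : Prop :=
  dsubmx v = 0 :> 'cV_d.

Definition piN (R : realType) (p d : nat) (X : vec R p d -> vec R p d) :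
    vec R p d -> 'cV[R]_d := fun x => dsubmx (X x).

(* A foliated manifold given by a foliated atlas. *)
Record foliatedManifold (R : realType) (p d : nat) := FoliatedManifold {
  carrier : topologicalType;
  carrier_hausdorff : hausdorff_space carrier;
  carrier_countable : @second_countable carrier;
  carrier_nonempty : [set: carrier] !=set0;
  chartIdx : Type;
  dom : chartIdx -> set carrier;
  chart : chartIdx -> carrier -> vec R p d;
  chartI : chartIdx -> vec R p d -> carrier;
  dom_open : forall i, open (dom i);
  dom_cover : forall m, exists i, dom i m;
  img_open : forall i, open (chart i @` dom i);
  chartK : forall i m, dom i m -> chartI i (chart i m) = m;
  chart_cont : forall i m, dom i m -> {for m, continuous (chart i)};
  chartI_cont : forall i x, (chart i @` dom i) x -> {for x, continuous (chartI i)};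
  trans_smooth : forall i j,
    smooth (chart i @` (dom i `&` dom j)) (chart j \o chartI i);
  (* the transversal part of a coordinate change depends only on the transversal
     coordinates, locally *)
  trans_foliated : forall i j x, (chart i @` (dom i `&` dom j)) x ->
    forall v, inF v -> inF ('D_v (chart j \o chartI i) x)
}.

Definition img (R : realType) (p d : nat) (M : foliatedManifold R p d)
  (i : chartIdx M) : set (vec R p d) := chart i @` dom i.

Definition overlap (R : realType) (p d : nat) (M : foliatedManifold R p d)
  (i j : chartIdx M) : set (vec R p d) := chart i @` (dom i `&` dom j).

Definition trans (R : realType) (p d : nat) (M : foliatedManifold R p d)
  (i j : chartIdx M) : vec R p d -> vec R p d := chart j \o chartI i.

Definition transT (R : realType) (p d : nat) (M : foliatedManifold R p d)
  (i j : chartIdx M) (x v : vec R p d) : vec R p d := 'D_v (trans i j) x.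

Definition transN (R : realType) (p d : nat) (M : foliatedManifold R p d)
  (i j : chartIdx M) (x : vec R p d) (u : 'cV[R]_d) : 'cV[R]_d :=
  dsubmx (transT i j x (col_mx 0 u)).

(* A linear connection on N F, given by its connection forms with respect to the
   chart frames: nabla_v s = D_v s + conn i x v *m s.  The last axiom is the gauge
   law, i.e. the invariance of nabla under the coordinate changes. *)
Record connection (R : realType) (p d : nat) (M : foliatedManifold R p d) :=
  Connection {
  conn : chartIdx M -> vec R p d -> vec R p d -> 'M[R]_d;
  conn_linear : forall i x, img i x -> linear (conn i x);
  conn_smooth : forall i v, smooth (img i) (fun x => conn i x v);
  conn_gauge : forall i j x, overlap i j x -> forall v u,
    transN i j x (conn i x v *m u) =
    'D_v (fun y => transN i j y u) x
      + conn j (trans i j x) (transT i j x v) *m transN i j x u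
}.

Section LocalOperators.
Variables (R : realType) (p d : nat) (M : foliatedManifold R p d).
Variables (nab : connection M) (i : chartIdx M).
Implicit Types (X Y : vec R p d -> vec R p d) (s : vec R p d -> 'cV[R]_d).

Definition nabla X s : vec R p d -> 'cV[R]_d :=
  fun x => 'D_(X x) s x + conn nab i x (X x) *m s x.

Definition torsion X Y : vec R p d -> 'cV[R]_d :=
  fun x => nabla X (piN Y) x - nabla Y (piN X) x - piN (bracket X Y) x.

Definition curvature X Y s : vec R p d -> 'cV[R]_d :=
  fun x => nabla X (nabla Y s) x - nabla Y (nabla X s) x
           - nabla (bracket X Y) s x.

End LocalOperators.

Definition isField (R : realType) (p d : nat) (M : foliatedManifold R p d)
    (i : chartIdx M) (W : set (vec R p d)) (X : vec R p d -> vec R p d) : Prop :=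
  [/\ open W, W `<=` img i & smooth W X].

Definition adapted (R : realType) (p d : nat) (M : foliatedManifold R p d)
    (nab : connection M) : Prop :=
  forall (i : chartIdx M) W X Y, isField i W X -> isField i W Y ->
    (forall x, W x -> inF (Y x)) ->
    forall x, W x -> nabla nab i Y (piN X) x = piN (bracket Y X) x.

(* The transversal twistor space Z(F).  Over the chart i it is the submanifold
   twistor i of R^(p + d) x M_d(R), the endomorphisms of the fibres of N F being
   matrices in the chart frame; these pieces are glued by
   (x, J) ~ (trans x, g J g^-1), g = transN x.  Vector fields on an open subset of
   twistor i are represented by vector fields on an open set O of
   R^(p + d) x M_d(R) which are tangent to twistor i along it; their brackets are
   again tangent, and along twistor i these depend only on the restrictions. *)
Notation amb R p d := (('cV[R]_(p + d) * 'M[R]_d)%type).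

Section Twistor.
Variables (R : realType) (p d : nat) (M : foliatedManifold R p d).
Variables (nab : connection M) (i : chartIdx M).
Implicit Types (z w : amb R p d) (O : set (amb R p d))
  (V W : amb R p d -> amb R p d).

Definition twistor : set (amb R p d) :=
  [set z | img i z.1 /\ z.2 *m z.2 = - 1%:M].

Definition tangentZ z w : Prop := w.2 *m z.2 + z.2 *m w.2 = 0.

(* The value at z of the covariant derivative of the End(N F)-valued J along a
   curve (x(t), J(t)) in Z(F) with velocity w at z.  The curve is parallel iff this
   vanishes along it; thus the kernel of covJ z is the horizontal space H at z, and
   covJ z is the projection onto the vertical space with kernel H. *)
Definition covJ z w : 'M[R]_d :=
  w.2 + (conn nab i z.1 w.1 *m z.2 - z.2 *m conn nab i z.1 w.1).

Definition horizontal z w : Prop := tangentZ z w /\ covJ z w = 0.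

Definition inFhat z w : Prop := horizontal z w /\ inF w.1.

(* The identification of N Fhat with Q^*N F (+) V. *)
Definition toN z w : 'cV[R]_d * 'M[R]_d := (dsubmx w.1, covJ z w).

Definition I1 z (n : 'cV[R]_d * 'M[R]_d) : 'cV[R]_d * 'M[R]_d :=
  (z.2 *m n.1, z.2 *m n.2).

Definition I2 z (n : 'cV[R]_d * 'M[R]_d) : 'cV[R]_d * 'M[R]_d :=
  (z.2 *m n.1, - (z.2 *m n.2)).

Definition isFieldZ O V : Prop :=
  [/\ open O, forall z, O z -> img i z.1, smooth O V
    & forall z, O z -> twistor z -> tangentZ z (V z)].

Definition foliatedZ O V : Prop := isFieldZ O V /\
  forall O' Y, O' `<=` O -> isFieldZ O' Y ->
    (forall z, O' z -> twistor z -> inFhat z (Y z)) ->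
    forall z, O' z -> twistor z -> inFhat z (bracket V Y z).

Definition foliatedSection O (s : amb R p d -> 'cV[R]_d * 'M[R]_d) : Prop :=
  forall z, O z -> twistor z ->
    exists O' V, [/\ O' z, O' `<=` O, foliatedZ O' V
      & forall z', O' z' -> twistor z' -> s z' = toN z' (V z')].

(* The Nijenhuis tensor of the almost complex structures induced on the slice
   spaces vanishes: the foliated fields are the lifts of the fields of the slice
   spaces, and their brackets are the lifts of the brackets. *)
Definition sliceNijenhuis0
    (I : amb R p d -> 'cV[R]_d * 'M[R]_d -> 'cV[R]_d * 'M[R]_d) : Prop :=
  forall O V W IV IW,
    foliatedZ O V -> foliatedZ O W -> foliatedZ O IV -> foliatedZ O IW ->
    (forall z, O z -> twistor z -> toN z (IV z) = I z (toN z (V z))) ->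
    (forall z, O z -> twistor z -> toN z (IW z) = I z (toN z (W z))) ->
    forall z, O z -> twistor z ->
      toN z (bracket IV IW z) - I z (toN z (bracket IV W z))
        - I z (toN z (bracket V IW z)) - toN z (bracket V W z) = 0.

End Twistor.

Definition projectable (R : realType) (p d : nat) (M : foliatedManifold R p d)
    (nab : connection M)
    (I : amb R p d -> 'cV[R]_d * 'M[R]_d -> 'cV[R]_d * 'M[R]_d) : Prop :=
  forall (i : chartIdx M) O s, open O -> (forall z, O z -> img i z.1) ->
    foliatedSection nab i O s -> foliatedSection nab i O (fun z => I z (s z)).

Definition integrable_acs (R : realType) (p d : nat) (M : foliatedManifold R p d)
    (nab : connection M)
    (I : amb R p d -> 'cV[R]_d * 'M[R]_d -> 'cV[R]_d * 'M[R]_d) : Prop :=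
  projectable nab I /\ forall i : chartIdx M, sliceNijenhuis0 nab i I.

(* Projectability of I2 implies that of I1. *)
Definition stronglySuitable (R : realType) (p d : nat)
    (M : foliatedManifold R p d) (nab : connection M) : Prop :=
  adapted nab /\ projectable nab (@I2 R p d).

(* Covariant tensor fields on M, given by their components in the charts. *)
Definition tensor1 (R : realType) (p d : nat) (M : foliatedManifold R p d)
    (a : chartIdx M -> vec R p d -> vec R p d -> R^o) : Prop :=
  [/\ forall i x, img i x -> linear (a i x),
      forall i v, smooth (img i) (fun x => a i x v)
    & forall i j x, overlap i j x -> forall v,
        a j (trans i j x) (transT i j x v) = a i x v].

Definition tensor2 (R : realType) (p d : nat) (M : foliatedManifold R p d)
    (b : chartIdx M -> vec R p d -> vec R p d -> vec R p d -> R^o) : Prop :=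
  [/\ forall i x, img i x -> forall v, linear (b i x v),
      forall i x, img i x -> forall w, linear (fun v => b i x v w),
      forall i v w, smooth (img i) (fun x => b i x v w)
    & forall i j x, overlap i j x -> forall v w,
        b j (trans i j x) (transT i j x v) (transT i j x w) = b i x v w].

Section TensorConditions.
Variables (R : realType) (p d : nat) (M : foliatedManifold R p d).
Implicit Types (a : chartIdx M -> vec R p d -> vec R p d -> R^o)
  (b : chartIdx M -> vec R p d -> vec R p d -> vec R p d -> R^o).

Definition vanishF1 a : Prop :=
  forall i x, img i x -> forall v, inF v -> a i x v = 0.

Definition vanishF2 b : Prop :=
  forall i x, img i x -> forall v w, inF v \/ inF w -> b i x v w = 0.

Definition alternating b : Prop :=
  forall i x, img i x -> forall v, b i x v v = 0.

Definition symmetric2 b : Prop :=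
  forall i x, img i x -> forall v w, b i x v w = b i x w v.

Definition endoTr (f : 'cV[R]_d -> 'cV[R]_d) : R :=
  \sum_(k < d) f (delta_mx k ord0) k ord0.

(* b (X, Y) = (1 / d) tr R(X, Y) if Y is tangent to F. *)
Definition curvTraceOnF (nab : connection M) b : Prop :=
  forall (i : chartIdx M) W X Y, isField i W X -> isField i W Y ->
    (forall x, W x -> inF (Y x)) -> forall x, W x ->
    b i x (X x) (Y x) =
      d%:R^-1 * endoTr (fun u => curvature nab i X Y (cst u) x).

Definition torsionForm (nab : connection M) a : Prop :=
  forall (i : chartIdx M) W X Y, isField i W X -> isField i W Y ->
    forall x, W x -> torsion nab i X Y x =
      a i x (X x) *: piN Y x - a i x (Y x) *: piN X x.

Definition curvatureForm3 (nab : connection M) b c : Prop :=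
  forall (i : chartIdx M) W X Y Z,
    isField i W X -> isField i W Y -> isField i W Z ->
    forall x, W x -> curvature nab i X Y (piN Z) x =
      b i x (X x) (Z x) *: piN Y x - b i x (Y x) (Z x) *: piN X x
        + c i x (X x) (Y x) *: piN Z x.

Definition curvatureForm2 (nab : connection M) xi zeta : Prop :=
  forall (i : chartIdx M) W X Y, isField i W X -> isField i W Y ->
    forall x, W x -> curvature nab i X Y (piN X) x =
      xi i x (X x) (Y x) *: piN X x + zeta i x (X x) (X x) *: piN Y x.

Definition curvatureForm2Polar (nab : connection M) xi zeta : Prop :=
  forall (i : chartIdx M) W X Y Z,
    isField i W X -> isField i W Y -> isField i W Z ->
    forall x, W x ->
      curvature nab i X Y (piN Z) x + curvature nab i Z Y (piN X) x =
      xi i x (X x) (Y x) *: piN Z x + xi i x (Z x) (Y x) *: piN X x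
        + (2 * zeta i x (X x) (Z x)) *: piN Y x.

Definition dataRankGe6 (nab : connection M) a b c : Prop :=
  [/\ tensor1 a /\ vanishF1 a,
      tensor2 b /\ vanishF2 b,
      [/\ tensor2 c, alternating c & curvTraceOnF nab c],
      torsionForm nab a
    & curvatureForm3 nab b c].

(* xi is a bilinear form which is not required
   to be alternating: the curvature formula forces its symmetric part to be
   - zeta, so that an alternating xi would force zeta = 0, which excludes, e.g.,
   the Levi-Civita connection of S^4 foliated by points, where I1 is integrable. *)
Definition tensorsRank4 (nab : connection M) a xi zeta : Prop :=
  [/\ tensor1 a /\ vanishF1 a,
      tensor2 xi /\ curvTraceOnF nab xi
    & [/\ tensor2 zeta, vanishF2 zeta & symmetric2 zeta]].

Definition dataRank4 (nab : connection M) a xi zeta : Prop :=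
  [/\ tensorsRank4 nab a xi zeta, torsionForm nab a
    & curvatureForm2 nab xi zeta].

(* A complement E of F in TM; E at x is the column span of compl i x, which is the
   basis of E projected by pi_N onto the chart frame of N F. *)
Record complement := Complement {
  compl : chartIdx M -> vec R p d -> 'M[R]_(p + d, d);
  compl_section : forall i x, img i x -> dsubmx (compl i x) = 1%:M;
  compl_smooth : forall i, smooth (img i) (compl i);
  compl_compat : forall i j x, overlap i j x -> forall u,
    transT i j x (compl i x *m u) = compl j (trans i j x) *m transN i j x u
}.

(* Torsion and curvature are tensorial, hence their values on vectors are computed
   by means of constant local fields. *)
Definition torTrace (nab : connection M) (E : complement) i x (v : vec R p d) : R :=
  endoTr (fun u => torsion nab i (cst v) (cst (compl E i x *m u)) x).

Definition curvTrace (nab : connection M) i x (v w : vec R p d) : R :=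
  endoTr (fun u => curvature nab i (cst v) (cst w) (cst u) x).

Definition ricciTrace (nab : connection M) (E : complement) i x
    (w : vec R p d) (u : 'cV[R]_d) : R :=
  endoTr (fun e => curvature nab i (cst (compl E i x *m e)) (cst w) (cst u) x).

Definition sameTraces (nab nab' : connection M) (E : complement) i x : Prop :=
  [/\ torTrace nab E i x =1 torTrace nab' E i x,
      curvTrace nab i x =2 curvTrace nab' i x
    & ricciTrace nab E i x =2 ricciTrace nab' E i x].

End TensorConditions.

(* Main.v *)
(* The projection of a vector w of Z(F) to N Fhat is (a, A) with a the transversal part of
   w and A its covariant derivative of J.  The structure equations for brackets in these
   terms show that the Nijenhuis tensor of I_a on the slice spaces consists of
   - a mixed part, which is zero for I_1 and at (b, [S, J]) is a nonzero multiple of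
     J [S, J] b for I_2, whence the first claim;
   - T(Ja,Jb) - J T(Ja,b) - J T(a,Jb) - T(a,b), for all J;
   - the same expression in [R(a,b), J].
   Likewise, projectability of I_2 is a linear condition, for all J, on the derivative along
   the leaves of the connection forms, and it says that R(X,Y) is a scalar if Y is in F.
   Conditions required for all J are solved by testing them on monomial J, whose free
   coefficients separate the unknowns, and by using GL-invariance; this yields the stated
   forms of T and R at each point.  Finally, the coefficients in these forms are linear
   combinations of traces of T and R: this gives their smoothness, their uniqueness, and
   (with the invariance of T and R under coordinate changes) their tensoriality. *)
From HB Require Import structures.
Require Import Defs.
From mathcomp Require Import all_boot all_order all_algebra.
From mathcomp Require Import all_classical all_reals all_analysis.
From mathcomp Require Import ring lra zify.
Set Implicit Arguments.
Unset Strict Implicit.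
Unset Printing Implicit Defensive.
Import Order.TTheory GRing.Theory Num.Theory.
Import numFieldNormedType.Exports.
Local Open Scope classical_set_scope.
Local Open Scope ring_scope.

(** Only the restrictions to Z(F) of the ambient fields matter, and a field is related to its image
    under I_a only along Z(F). This relation may be differentiated because every tangent vector at J
    is the velocity of a curve of conjugates of J, which stays in Z(F). The curve is not a line, so
    directional derivatives have to be upgraded to total ones; the analysis therefore starts from
    the mean value inequality. The three cases differ by the number of pairs of basis vectors that a
    monomial J can exchange with free coefficients. With three pairs, d >= 6, an entry of R with
    four distinct indices vanishes by itself. With two pairs, d = 4, a shear yields only the
    vanishing of its symmetrization, whence the weaker formula for R(X,Y)X. That this formula
    suffices in rank 4 uses that a, Ja, b, Jb span the fibre unless a and b are complex dependent.
    For d = 2 the conditions are automatic: an alternating form is a multiple of the determinant,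
    and det J = 1. *)

(** * Reflexive decision procedure for equalities in abelian groups *)

Inductive zmod_exp := ZVar of nat | ZZero | ZAdd of zmod_exp & zmod_exp | ZOpp of zmod_exp.

Fixpoint zmod_eval (V : zmodType) (s : seq V) e : V :=
  match e with
  | ZVar i => s`_i
  | ZZero => 0
  | ZAdd a b => zmod_eval s a + zmod_eval s b
  | ZOpp a => - zmod_eval s a
  end.

Fixpoint zmod_coef e (i : nat) : int :=
  match e with
  | ZVar j => (i == j)%:Z
  | ZZero => 0
  | ZAdd a b => zmod_coef a i + zmod_coef b i
  | ZOpp a => - zmod_coef a i
  end.

(** The value depends on the expression only through its integer coefficients, so comparing
    coefficients suffices. An index beyond the atoms evaluates to the default 0 of [nth] and has no
    term in the sum. *)
Lemma zmod_evalE (V : zmodType) (s : seq V) e :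
  zmod_eval s e = \sum_(i < size s) s`_i *~ zmod_coef e i.
Proof.
elim: e => [j||a IHa b IHb|a IHa] /=.
- have [js|sj] := ltnP j (size s).
    rewrite (bigD1 (Ordinal js))//= eqxx mulr1z big1 ?addr0// => i ij.
    by rewrite (_ : (i == j :> nat) = false) ?mulr0z//; apply/negbTE: ij.
  rewrite nth_default// big1// => i _.
  by rewrite (_ : (i == j :> nat) = false) ?mulr0z// ltn_eqF// (leq_trans _ sj).
- by rewrite big1.
- by rewrite IHa IHb -big_split; apply: eq_bigr => i _; rewrite mulrzDr.
- by rewrite IHa -sumrN; apply: eq_bigr => i _; rewrite mulrNz.
Qed.

Lemma zmod_eval_eq (V : zmodType) (s : seq V) e1 e2 :
  all (fun i => zmod_coef e1 i == zmod_coef e2 i) (iota 0 (size s)) ->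
  zmod_eval s e1 = zmod_eval s e2.
Proof.
move=> /allP H; rewrite !zmod_evalE; apply: eq_bigr => i _; congr (_ *~ _).
by apply/eqP/H; rewrite mem_iota /=.
Qed.

Ltac zmod_mem x l :=
  lazymatch l with
  | nil => false
  | ?y :: ?l' => match constr:(Set) with
                 | _ => let u := constr:(ltac:(constr_eq x y; exact tt)) in true
                 | _ => zmod_mem x l'
                 end
  end.
Ltac zmod_atoms l t :=
  lazymatch t with
  | (?a + ?b)%R => let l' := zmod_atoms l a in zmod_atoms l' b
  | (- ?a)%R => zmod_atoms l a
  | 0%R => l
  | _ => let b := zmod_mem t l in
         lazymatch b with true => l | false => constr:(t :: l) end
  end.
Ltac zmod_index x l :=
  lazymatch l with
  | ?y :: ?l' => match constr:(Set) with
                 | _ => let u := constr:(ltac:(constr_eq x y; exact tt)) in constr:(0%N)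
                 | _ => let n := zmod_index x l' in constr:(S n)
                 end
  end.
Ltac zmod_reify l t :=
  lazymatch t with
  | (?a + ?b)%R => let a' := zmod_reify l a in let b' := zmod_reify l b in constr:(ZAdd a' b')
  | (- ?a)%R => let a' := zmod_reify l a in constr:(ZOpp a')
  | 0%R => constr:(ZZero)
  | _ => let n := zmod_index t l in constr:(ZVar n)
  end.
(* Unification leaves matrix products and scalings over distinct but convertible
   algebraic instances, which must be made equal before the atoms are collected. *)
Definition real_mulmx (R : realType) m n p (A : 'M[R]_(m, n)) (B : 'M[R]_(n, p)) := A *m B.

Definition real_scalemx (R : realType) m n (a : R) (A : 'M[R]_(m, n)) := a *: A.

Ltac normalize_mulmx :=
  match goal with
  | R : realType |- _ =>
    repeat match goal with
    | |- context G [@mulmx ?S ?m ?n ?p ?A ?B] =>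
      let G' := context G [@real_mulmx R m n p A B] in change G'
    | |- context G [@GRing.scale ?S ?V ?a ?A] =>
      let T := type of A in let T := eval hnf in T in
      lazymatch T with
      | matrix _ ?m ?n => let G' := context G [@real_scalemx R m n a A] in change G'
      end
    end
  end.

(* Decides equalities that follow from the axioms of abelian groups. *)
Ltac zmod :=
  try normalize_mulmx;
  lazymatch goal with
  | |- ?a = ?b =>
    let T := type of a in
    let l := zmod_atoms (@nil T) a in
    let l := zmod_atoms l b in
    let a' := zmod_reify l a in
    let b' := zmod_reify l b in
    refine (@zmod_eval_eq _ l a' b' _); vm_compute; reflexivity
  end.

(** Linearity is carried as a predicate, because connection forms are linear only at points of the
    chart image; this recovers the rewriting rules of bundled linear maps. *)
Lemma linear_facts (R : realType) (V W : normedModType R) (L : V -> W) : linear L ->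
  [/\ L 0 = 0, forall x y, L (x + y) = L x + L y, forall a x, L (a *: x) = a *: L x
    & forall x, L (- x) = - L x].
Proof.
move=> Ll.
have L0 : L 0 = 0 by have := Ll (-1) 0 0; rewrite scaler0 addr0 scaleN1r addrC subrr.
split=> // [x y|a x|x].
- by have := Ll 1 x y; rewrite !scale1r.
- by have := Ll a x 0; rewrite L0 !addr0.
- by have := Ll (-1) x 0; rewrite L0 !addr0 !scaleN1r.
Qed.

(** * Derivatives and smooth maps *)

Section MeanValue.
Variable R : realType.

(** Multiplying by h makes the estimate meaningful at h = 0, where it is trivial, so no punctured
    neighbourhood is left. *)
Lemma is_derive_ball (V W : normedModType R) (f : V -> W) x v d :
  is_derive x v f d <->
  forall e, 0 < e -> exists2 r, 0 < r &
    forall h, `|h| < r -> `|f (x + h *: v) - f x - h *: d| <= e * `|h|.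
Proof.
have key h : h != 0 -> `|f (x + h *: v) - f x - h *: d| =
    `|h| * `|d - h^-1 *: ((f \o shift x) (h *: v) - f x)|.
  move=> h0; rewrite -normrZ scalerBr scalerA mulfV// scale1r /= -normrN opprB.
  by rewrite [_ + x]addrC.
have equi : (h^-1 *: ((f \o shift x) (h *: v) - f x) @[h --> 0^'] --> d) <->
  forall e, 0 < e -> exists2 r, 0 < r &
    forall h, `|h| < r -> `|f (x + h *: v) - f x - h *: d| <= e * `|h|.
  split=> [/cvgrPdist_le H e e0|H].
    have [/= r r0 rP] := H _ e0; exists r => // h hr.
    have [->|h0] := eqVneq h 0.
      by rewrite scale0r addr0 subrr scale0r subr0 !normr0 mulr0.
    rewrite key// mulrC ler_wpM2r//.
    by apply: rP => //; rewrite /ball_/= sub0r normrN.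
  apply/cvgrPdist_le => e e0; have [r r0 rP] := H _ e0.
  exists r => //= h; rewrite /ball_/= sub0r normrN => hr h0.
  by have := rP _ hr; rewrite key// mulrC ler_pM2r// normr_gt0.
rewrite -equi; split=> [[dv <-]|H]; first exact: dv.
split; first by apply/cvg_ex; exists d.
exact: cvg_lim.
Qed.

(** In a normed space there is no Rolle argument. Instead, the set of points t where the bound holds
    contains its supremum, and the strict bound on [df] carries it past any point before b. *)
Lemma mean_value_strict (W : normedModType R) (f df : R -> W) (a b C : R) :
  a <= b -> (forall t : R, a <= t <= b -> is_derive t 1 f (df t)) ->
  (forall t : R, a <= t <= b -> `|df t| < C) -> `|f b - f a| <= C * (b - a).
Proof.
move=> ab fd dfC.
(* The gap between C and the norm of [df t] serves as the epsilon of the derivative at t. *)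
have loc t : a <= t <= b -> exists2 r, 0 < r &
    forall s, `|s - t| < r -> `|f s - f t| <= C * `|s - t|.
  move=> tab; have e0 : 0 < C - `|df t| by rewrite subr_gt0 dfC.
  have [r r0 rP] := (is_derive_ball _ _ _ _).1 (fd _ tab) _ e0.
  exists r => // s sr; have := rP _ sr; rewrite -[(s - t) *: 1]/((s - t) * 1) mulr1 [t + _]addrC subrK.
  set u := f s - f t => H; rewrite -[u](subrK ((s - t) *: df t)).
  rewrite (le_trans (ler_normD _ _))// normrZ.
  by rewrite mulrBl in H; lra.
pose S := [set t | a <= t <= b /\ `|f t - f a| <= C * (t - a)].
have Sa : S a by split; rewrite ?lexx ?ab// !subrr normr0 mulr0.
have Sb : ubound S b by move=> t [/andP[]].
have hs : has_sup S by split; [exists a|exists b].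
pose c := sup S.
have cab : a <= c <= b.
  by rewrite (ub_le_sup hs.2)//= ge_sup//; exists a.
have [r r0 rP] := loc _ cab.
have C0 : 0 <= C by rewrite (le_trans (normr_ge0 (df a)))// ltW// dfC// lexx.
have Sc : S c.
  split=> //; have [t St tc] := sup_adherent r0 hs.
  have tlec : t <= c by apply: ub_le_sup => //; exact: hs.2.
  rewrite -[f c - f a](subrKA (f t)) (le_trans (ler_normD _ _))//.
  have h1 := St.2; have := rP t; rewrite [`|t - c|]distrC ger0_norm ?subr_ge0// => h2.
  have {}h2 : `|f t - f c| <= C * (c - t) by apply: h2; rewrite ltrBlDr addrC -ltrBlDr.
  rewrite distrC in h2; lra.
have [cb|] := ltP c b; last first.
  move=> bc; have <- : c = b by apply/le_anti; rewrite bc; case/andP: cab => _ ->.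
  exact: Sc.2.
pose s := Num.min b (c + r / 2).
have cs : c < s by rewrite lt_min cb ltrDl divr_gt0.
have sb : s <= b by rewrite ge_min lexx.
have sr : s <= c + r / 2 by rewrite ge_min lexx orbT.
have Ss : S s.
  split; first by rewrite sb andbT (le_trans _ (ltW cs))//; case/andP: cab.
  have := rP s; rewrite (ger0_norm (_ : 0 <= s - c)) ?subr_ge0 ?(ltW cs)// => h2.
  have {}h2 : `|f s - f c| <= C * (s - c) by apply: h2; move: sr r0; lra.
  have h1 := Sc.2.
  rewrite -[f s - f a](subrKA (f c)) (le_trans (ler_normD _ _))//; lra.
have : s <= c by apply: ub_le_sup => //; exact: hs.2.
by rewrite leNgt cs.
Qed.

Lemma mean_value (W : normedModType R) (f df : R -> W) (a b C : R) :
  a <= b -> (forall t : R, a <= t <= b -> is_derive t 1 f (df t)) ->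
  (forall t : R, a <= t <= b -> `|df t| <= C) -> `|f b - f a| <= C * (b - a).
Proof.
move=> ab fd dfC; have [->|ba] := eqVneq b a; first by rewrite !subrr normr0 mulr0.
have {}ba : 0 < b - a by rewrite subr_gt0 lt_neqAle eq_sym ba.
rewrite -ler_pdivrMr//; apply/ler_addgt0Pr => e e0.
rewrite ler_pdivrMr//; apply: mean_value_strict fd _ => // t tab.
by rewrite (le_lt_trans (dfC _ tab))// ltrDl.
Qed.

Lemma is_derive_line (V W : normedModType R) (f : V -> W) (x v : V) (t : R) :
  derivable f (x + t *: v) v ->
  is_derive t 1 (fun s : R => f (x + s *: v)) ('D_v f (x + t *: v)).
Proof.
move=> fd; apply/is_derive_ball => e e0.
have [r r0 rP] := (is_derive_ball _ _ _ _).1 (derivableP fd) _ e0.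
exists r => // h hr; have := rP _ hr.
by rewrite -(addrA x) -scalerDl -[h *: 1]/(h * 1) mulr1.
Qed.

(** Mean value inequality for the curve f(x + s v) - s L on the unit interval. *)
Lemma increment_le (V W : normedModType R) (f : V -> W) (x v : V) (L : W) (C : R) :
  (forall t : R, 0 <= t <= 1 -> derivable f (x + t *: v) v) ->
  (forall t : R, 0 <= t <= 1 -> `|'D_v f (x + t *: v) - L| <= C) ->
  `|f (x + v) - f x - L| <= C.
Proof.
move=> fd fC.
have /= := @mean_value W (fun s : R => f (x + s *: v) - s *: L)
  (fun s => 'D_v f (x + s *: v) - L) 0 1 C ler01.
rewrite !scale1r !scale0r addr0 !subr0 mulr1 [_ - L - _]addrAC; apply=> // t t01.
apply: is_deriveB; first exact/is_derive_line/fd.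
apply/is_derive_ball => e e0; exists 1 => // h _.
by rewrite -[h *: 1]/(h * 1) mulr1 scalerDl [_ + _ - t *: L]addrAC subrr add0r subrr normr0 mulr_ge0// ltW.
Qed.
End MeanValue.

Section Differentiability.
Variable R : realType.

Lemma is_deriveZv (V W : normedModType R) (f : V -> W) x v (s : R) :
  derivable f x v -> is_derive x (s *: v) f (s *: 'D_v f x).
Proof.
move=> fd; apply/is_derive_ball => e e0.
have s1 : 0 < `|s| + 1 by rewrite ltr_wpDl.
have [r r0 rP] := (is_derive_ball _ _ _ _).1 (derivableP fd) _ (divr_gt0 e0 s1).
exists (r / (`|s| + 1)) => [|h]; first exact: divr_gt0.
rewrite ltr_pdivlMr// => hr; rewrite !scalerA (le_trans (rP _ _))//.
  by rewrite normrM (le_lt_trans _ hr)// ler_wpM2l// lerDl.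
have -> : e / (`|s| + 1) * `|h * s| = e * `|h| * (`|s| / (`|s| + 1)).
  by rewrite normrM; field; rewrite gt_eqF.
by rewrite ler_piMr ?mulr_ge0 ?(ltW e0)// ler_pdivrMr// mul1r lerDl.
Qed.

Lemma near_ballP (V : normedModType R) (x : V) (P : set V) :
  nbhs x P <-> exists2 r, 0 < r & forall y, `|y - x| < r -> P y.
Proof.
split=> [/nbhs_ballP[r r0 rP]|[r r0 rP]].
  by exists r => // y yr; apply: rP; rewrite -ball_normE /= distrC.
by apply/nbhs_ballP; exists r => // y; rewrite -ball_normE /= distrC; exact: rP.
Qed.

(** The base point y varies together with the increment. This uniformity, due to the continuity of
    the derivative, allows an increment to be split into several steps. *)
Lemma strict_derive (V W : normedModType R) (U : set V) (f : V -> W) x v :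
  open U -> U x -> (forall y, U y -> derivable f y v) ->
  {for x, continuous (fun y => 'D_v f y)} ->
  forall e, 0 < e -> exists2 r, 0 < r & forall y s, `|y - x| < r -> `|s| < r ->
    `|f (y + s *: v) - f y - s *: 'D_v f x| <= e * `|s|.
Proof.
move=> oU Ux fd fc e e0.
have /near_ballP[r1 r10 r1P] : nbhs x (fun y => U y /\ `|'D_v f x - 'D_v f y| <= e).
  apply: filterI; first exact: open_nbhs_nbhs.
  by move/cvgrPdist_le : fc; exact.
have v1 : 0 < `|v| + 1 by rewrite ltr_wpDl.
exists (Num.min (r1 / 2) (r1 / 2 / (`|v| + 1))).
  by rewrite lt_min !divr_gt0.
move=> y s; rewrite !lt_min => /andP[yx _] /andP[_]; rewrite ltr_pdivlMr// => sv.
have in1 (t : R) : 0 <= t <= 1 -> `|y + t *: (s *: v) - x| < r1.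
  move=> /andP[t0 t1]; rewrite addrAC (le_lt_trans (ler_normD _ _))//.
  rewrite !normrZ (ger0_norm t0).
  have : t * (`|s| * `|v|) <= `|s| * (`|v| + 1).
    by rewrite mulrDr mulr1 (le_trans (ler_piMl _ t1)) ?lerDl// mulr_ge0.
  lra.
have dE (t : R) : 0 <= t <= 1 ->
    is_derive (y + t *: (s *: v)) (s *: v) f (s *: 'D_v f (y + t *: (s *: v))).
  by move=> /in1/r1P[Ut _]; apply: is_deriveZv; exact: fd.
apply: increment_le => t /[dup] t01 /dE [dd dv] //.
rewrite dv -scalerBr normrZ mulrC ler_wpM2r// distrC.
by have [] := r1P _ (in1 _ t01).
Qed.

(** The second difference over the parallelogram spanned by h v and h w is symmetric in v and w, and
    h^2 times either mixed derivative approximates it up to e h^2. *)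
Theorem schwarz (V W : normedModType R) (U : set V) (f : V -> W) x v w :
  open U -> U x ->
  (forall y, U y -> derivable f y v) -> (forall y, U y -> derivable f y w) ->
  (forall y, U y -> derivable (fun z => 'D_v f z) y w) ->
  (forall y, U y -> derivable (fun z => 'D_w f z) y v) ->
  {for x, continuous (fun y => 'D_w (fun z => 'D_v f z) y)} ->
  {for x, continuous (fun y => 'D_v (fun z => 'D_w f z) y)} ->
  'D_w (fun z => 'D_v f z) x = 'D_v (fun z => 'D_w f z) x.
Proof.
pose Delta v w (h : R) := f (x + h *: v + h *: w) - f (x + h *: v) - f (x + h *: w) + f x.
have main v' w' : open U -> U x ->
    (forall y, U y -> derivable f y v') ->
    (forall y, U y -> derivable (fun z => 'D_v' f z) y w') ->
    {for x, continuous (fun y => 'D_w' (fun z => 'D_v' f z) y)} ->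
    forall e, 0 < e -> exists2 r, 0 < r & forall h, `|h| < r ->
    `|Delta v' w' h - (h ^+ 2) *: 'D_w' (fun z => 'D_v' f z) x| <= e * h ^+ 2.
  move=> oU Ux fv fvw c e e0.
  have [r1 r10 r1P] := strict_derive oU Ux fvw c e0.
  have /near_ballP[r2 r20 r2P] : nbhs x U by exact: open_nbhs_nbhs.
  have vw1 : 0 < `|v'| + `|w'| + 1 by rewrite ltr_wpDl// addr_ge0.
  pose r := Num.min r1 r2.
  have r0 : 0 < r by rewrite lt_min r10.
  exists (Num.min r1 (r / (`|v'| + `|w'| + 1))); first by rewrite lt_min r10 divr_gt0.
  move=> h; rewrite lt_min => /andP[hr1]; rewrite ltr_pdivlMr// => hr.
  have in1 (t u : R) : 0 <= t <= 1 -> 0 <= u <= 1 ->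
      `|x + t *: (h *: v') + u *: (h *: w') - x| < r.
    move=> /andP[t0 t1] /andP[u0 u1]; rewrite addrAC (addrAC x) subrr add0r.
    rewrite (le_lt_trans (ler_normD _ _))// !normrZ (ger0_norm t0) (ger0_norm u0).
    apply: le_lt_trans hr.
    have : t * (`|h| * `|v'|) <= `|h| * `|v'| by rewrite ler_piMl// mulr_ge0.
    have : u * (`|h| * `|w'|) <= `|h| * `|w'| by rewrite ler_piMl// mulr_ge0.
    have := normr_ge0 h; rewrite !mulrDr mulr1; lra.
  have U1 (t u : R) : 0 <= t <= 1 -> 0 <= u <= 1 -> U (x + t *: (h *: v') + u *: (h *: w')).
    by move=> t01 u01; apply: r2P; rewrite (lt_le_trans (in1 _ _ t01 u01))// ge_min lexx orbT.
  have i0 : 0 <= (0:R) <= 1 by rewrite lexx ler01.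
  have i1 : 0 <= (1:R) <= 1 by rewrite lexx ler01.
  (* The increment along w' is frozen: y -> f(y + h w') - f(y) is followed along v', and
     [strict_derive] for the derivative of f along v' controls its speed. *)
  have dg (t : R) : 0 <= t <= 1 -> is_derive (x + t *: (h *: v')) (h *: v')
      (fun y => f (y + h *: w') - f y)
      (h *: ('D_v' f (x + t *: (h *: v') + h *: w') - 'D_v' f (x + t *: (h *: v')))).
    move=> t01; rewrite scalerBr; apply: is_deriveB.
      have := is_deriveZv h (fv _ (U1 _ _ t01 i1)); rewrite scale1r => H.
      apply/is_derive_ball => e1 e10.
      have [r' r'0 r'P] := (is_derive_ball _ _ _ _).1 H _ e10; exists r' => // k /r'P.
      by rewrite [_ + _ + k *: _]addrAC.
    by apply: is_deriveZv; apply: fv; have := U1 _ _ t01 i0; rewrite scale0r addr0.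
  have -> : Delta v' w' h = (f (x + h *: v' + h *: w') - f (x + h *: v')) -
                          (f (x + h *: w') - f x).
    by rewrite /Delta opprB !addrA [_ + f x - _]addrAC.
  apply: (@increment_le R V W (fun y => f (y + h *: w') - f y)).
    by move=> t /dg [].
  move=> t t01; have [_ ->] := dg _ t01.
  have hh : h * h = `|h| * `|h| by rewrite -normrM ger0_norm// -expr2 sqr_ge0.
  rewrite expr2 -scalerA -scalerBr normrZ hh mulrCA.
  rewrite ler_wpM2l//; apply: r1P => //.
  by have := in1 _ _ t01 i0; rewrite scale0r addr0 => /lt_le_trans; apply; rewrite ge_min lexx.
move=> oU Ux fv fw fvw fwv cvw cwv; apply/eqP; rewrite -subr_eq0 -normr_le0.
apply/ler_addgt0Pr => e e0; rewrite add0r.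
have e2 : 0 < e / 2 by rewrite divr_gt0.
have [r1 r10 r1P] := main v w oU Ux fv fvw cvw _ e2.
have [r2 r20 r2P] := main w v oU Ux fw fwv cwv _ e2.
pose h := Num.min r1 r2 / 2.
have h0 : 0 < h by rewrite divr_gt0// lt_min r10.
have hr : h < Num.min r1 r2 by rewrite ltr_pdivrMr// ltr_pMr ?ltr1n// lt_min r10.
move: hr; rewrite lt_min => /andP[hr1 hr2].
have := r1P h; rewrite gtr0_norm// => /(_ hr1) H1.
have := r2P h; rewrite gtr0_norm// => /(_ hr2) H2.
have DE : Delta w v h = Delta v w h.
  by rewrite /Delta (addrAC x) (addrAC (f (x + h *: v + h *: w))) .
rewrite -(ler_pM2l (exprn_gt0 2 h0)) -{1}(gtr0_norm (exprn_gt0 2 h0)) -normrZ.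
rewrite scalerBr -(subrKA (Delta v w h)) (le_trans (ler_normD _ _))//.
rewrite DE in H2; rewrite distrC in H1; lra.
Qed.

End Differentiability.

(** * Total derivatives and the chain rule in finite dimension *)

Section FiniteDimension.
Variable R : realType.

(** A finite frame with bounded linear coordinates. In this form the property passes to products, so
    it covers the ambient space of the twistor space. *)
Definition finite_coords (V : normedModType R) : Prop :=
  exists (I : finType) (e : I -> V) (c : I -> V -> R),
  [/\ forall k a x y, c k (a *: x + y) = a * c k x + c k y,
      exists2 C, 0 <= C & forall k x, `|c k x| <= C * `|x|
    & forall x, x = \sum_k c k x *: e k].

Definition total_derivative (V W : normedModType R) (f : V -> W) (x : V) (L : V -> W) :
    Prop :=
  [/\ linear L, exists2 K, 0 < K & forall h, `|L h| <= K * `|h|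
    & forall e, 0 < e -> exists2 r, 0 < r &
        forall h, `|h| < r -> `|f (x + h) - f x - L h| <= e * `|h|].

Lemma total_derivative_is_derive (V W : normedModType R) (f : V -> W) x L v :
  total_derivative f x L -> is_derive x v f (L v).
Proof.
case=> Llin _ Lf; apply/is_derive_ball => e e0.
have v1 : 0 < `|v| + 1 by rewrite ltr_wpDl.
have [r r0 rP] := Lf _ (divr_gt0 e0 v1).
exists (r / (`|v| + 1)) => [|h]; first exact: divr_gt0.
rewrite ltr_pdivlMr// => hr.
have [_ _ LZ _] := linear_facts Llin; rewrite -LZ.
rewrite (le_trans (rP _ _))// normrZ; first by rewrite (le_lt_trans _ hr)// ler_wpM2l// lerDl.
have -> : e / (`|v| + 1) * (`|h| * `|v|) = e * `|h| * (`|v| / (`|v| + 1)).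
  by field; rewrite gt_eqF.
by rewrite ler_piMr ?mulr_ge0 ?(ltW e0)// ler_pdivrMr// mul1r lerDl.
Qed.

Lemma total_derivativeE (V W : normedModType R) (f : V -> W) x L :
  total_derivative f x L -> L = (fun v => 'D_v f x).
Proof. by move=> Lf; apply/funext => v; have [_ <-] := total_derivative_is_derive v Lf. Qed.

(** The increment is made one coordinate at a time. The base point moves on the way, which is why
    the uniform estimate [strict_derive] is needed. *)
Lemma C1_total_derivative (V W : normedModType R) (U : set V) (f : V -> W) x :
  finite_coords V -> open U -> U x -> (forall v y, U y -> derivable f y v) ->
  (forall v, {for x, continuous (fun y => 'D_v f y)}) ->
  total_derivative f x (fun v => 'D_v f x).
Proof.
move=> [I [e [c [clin [C C0 cC] cE]]]] oU Ux fd fc.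
pose L v := \sum_k c k v *: 'D_(e k) f x.
suff H : total_derivative f x L by have <- := total_derivativeE H.
split.
- move=> a u v; rewrite /L scaler_sumr -big_split; apply: eq_bigr => k _ /=.
  by rewrite clin scalerDl scalerA.
- exists (\sum_k C * `|'D_(e k) f x| + 1).
    by rewrite ltr_wpDl// sumr_ge0// => k _; rewrite mulr_ge0.
  move=> h; rewrite (le_trans (ler_norm_sum _ _ _))// mulrDl mul1r ler_wpDr//.
  rewrite mulr_suml ler_sum// => k _; rewrite normrZ mulrAC ler_wpM2r//.
- have [K K0 eK] : exists2 K, 0 < K & forall k, `|e k| <= K.
    exists (\sum_k `|e k| + 1); first by rewrite ltr_wpDl// sumr_ge0.
    by move=> k; rewrite (bigD1 k)//= -addrA lerDl addr_ge0// sumr_ge0.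
  have claim (s : seq I) : forall eps, 0 < eps -> exists2 r, 0 < r &
      forall h, `|h| < r -> `|f (x + \sum_(k <- s) c k h *: e k) - f x
         - \sum_(k <- s) c k h *: 'D_(e k) f x| <= eps * `|h|.
    elim: s => [|k s IHs] eps eps0.
      exists 1 => // h _; rewrite !big_nil addr0 subrr subr0 normr0 mulr_ge0 ?(ltW eps0)//.
    have [r1 r10 r1P] := IHs _ (divr_gt0 eps0 (@ltr0Sn R 1)).
    have C1 : 0 < C + 1 by rewrite ltr_wpDl.
    have e2 : 0 < eps / 2 / (C + 1) by rewrite !divr_gt0.
    have [r2 r20 r2P] := strict_derive oU Ux (fd (e k)) (fc (e k)) e2.
    pose B := (size s)%:R * ((C + 1) * K) + (C + 1).
    have B0 : 0 < B by rewrite ltr_wpDl// !mulr_ge0 ?ler0n// ltW.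
    exists (Num.min r1 (r2 / B)); first by rewrite lt_min r10 divr_gt0.
    move=> h; rewrite lt_min ltr_pdivlMr// => /andP[hr1 hr2].
    have hs : `|\sum_(j <- s) c j h *: e j| <= (size s)%:R * ((C + 1) * K) * `|h|.
      elim: (s) => [|j s' IHs']; first by rewrite big_nil normr0 !mul0r.
      rewrite big_cons (le_trans (ler_normD _ _))//=.
      set M := (C + 1) * K in IHs' *.
      rewrite -natr1 mulrDl mul1r mulrDl addrC lerD// normrZ /M.
      by rewrite mulrAC ler_pM// (le_trans (cC _ _))// ler_wpM2r// lerDl.
    have ck : `|c k h| <= (C + 1) * `|h| by rewrite (le_trans (cC _ _))// ler_wpM2r// lerDl.
    rewrite !big_cons [_ *: e k + _]addrC addrA.
    (* The partial increment along s has been made; the step along e_k starts from y. *)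
    set y := x + _.
    have yx : `|y - x| < r2.
      rewrite /y addrAC subrr add0r (le_lt_trans hs)//.
      by apply: le_lt_trans hr2; rewrite mulrC ler_wpM2l// lerDl ltW.
    have cr : `|c k h| < r2.
      rewrite (le_lt_trans ck)//; apply: le_lt_trans hr2; rewrite mulrC ler_wpM2l//.
      by rewrite lerDr !mulr_ge0 ?ler0n// ltW.
    have H2 := r2P _ _ yx cr; have H1 := r1P _ hr1; rewrite -/y in H1.
    have -> (F A B' D : W) : F - A - (B' + D) = (F - (f y) - B') + (f y - A - D).
      by rewrite addrACA -opprD; congr (_ - _); rewrite addrA subrK.
    rewrite (le_trans (ler_normD _ _))//.
    have : eps / 2 / (C + 1) * `|c k h| <= eps / 2 * `|h|.
      rewrite -[leLHS]mulrA ler_pM2l ?divr_gt0// mulrC ler_pdivrMr//.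
      by rewrite mulrC.
    lra.
  move=> eps eps0; have [r r0 rP] := claim (index_enum I) _ eps0.
  by exists r => // h /rP; rewrite -cE.
Qed.

(** The inner map, typically a curve, has only a directional derivative; this is enough once the
    outer one has a total derivative. *)
Lemma total_derivative_comp (U V W : normedModType R) (g : U -> V) (f : V -> W) t v w L :
  is_derive t v g w -> total_derivative f (g t) L -> is_derive t v (f \o g) (L w).
Proof.
move=> gd [Llin [K K0 LK] Lf]; apply/is_derive_ball => e e0.
have [_ LD LZ LN] := linear_facts Llin.
have w1 : 0 < `|w| + 1 by rewrite ltr_wpDl.
have e1 : 0 < e / 2 / (`|w| + 1) by rewrite !divr_gt0.
have [r1 r10 r1P] := Lf _ e1.
(* The bound 1 controls the size of the inner increment, the other one the error after applying
   L. *)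
have e2 : 0 < Num.min 1 (e / 2 / K) by rewrite lt_min ltr01 !divr_gt0.
have [r2 r20 r2P] := (is_derive_ball _ _ _ _).1 gd _ e2.
exists (Num.min r2 (r1 / (`|w| + 1))); first by rewrite lt_min r20 divr_gt0.
move=> h; rewrite lt_min ltr_pdivlMr// => /andP[/r2P hr2 hr1].
have eta1 : `|g (t + h *: v) - g t - h *: w| <= `|h|.
  by rewrite (le_trans hr2)// ler_piMl// ge_min lexx.
have eta2 : `|g (t + h *: v) - g t - h *: w| <= e / 2 / K * `|h|.
  by rewrite (le_trans hr2)// ler_wpM2r// ge_min lexx orbT.
pose k := g (t + h *: v) - g t.
have kh : `|k| <= (`|w| + 1) * `|h|.
  rewrite -[k](subrK (h *: w)) (le_trans (ler_normD _ _))// normrZ mulrDl mul1r addrC.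
  by rewrite lerD// mulrC.
rewrite /=; have -> : g (t + h *: v) = g t + k by rewrite [g t + _]addrC /k subrK.
have H1 : `|f (g t + k) - f (g t) - L k| <= e / 2 * `|h|.
  rewrite (le_trans (r1P _ _))//; first by rewrite (le_lt_trans kh)// mulrC.
  have : e / 2 / (`|w| + 1) * `|k| <= e / 2 / (`|w| + 1) * ((`|w| + 1) * `|h|).
    by rewrite ler_pM2l.
  by rewrite mulrA divfK// gt_eqF.
have H2 : `|L k - h *: L w| <= e / 2 * `|h|.
  have -> : L k - h *: L w = L (k - h *: w) by rewrite LD -[- (h *: w)]scaleNr LZ scaleNr.
  rewrite (le_trans (LK _))//.
  have : K * `|k - h *: w| <= K * (e / 2 / K * `|h|) by rewrite ler_pM2l.
  by have -> : K * (e / 2 / K * `|h|) = e / 2 * `|h| by field; rewrite gt_eqF.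
rewrite -(subrKA (L k)) (le_trans (ler_normD _ _))//; lra.
Qed.

Lemma finite_coords_mx m n : finite_coords 'M[R]_(m, n).
Proof.
exists ('I_m * 'I_n)%type, (fun k => delta_mx k.1 k.2), (fun k (A : 'M[R]_(m, n)) => A k.1 k.2); split.
- by move=> k a x y; rewrite !mxE.
- exists 1 => // k x; rewrite mul1r [leRHS]/Num.Def.normr/= mx_normrE.
  exact: (le_bigmax _ (fun k => `|x k.1 k.2|) k).
- by move=> x; rewrite {1}[x]matrix_sum_delta pair_bigA.
Qed.

Lemma finite_coords_prod (V W : normedModType R) :
  finite_coords V -> finite_coords W -> finite_coords (V * W)%type.
Proof.
move=> [I [e [c [clin [C C0 cC] cE]]]] [J [e' [c' [c'lin [C' C'0 c'C] c'E]]]].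
exists (I + J)%type, (fun k => match k with inl i => (e i, 0) | inr j => (0, e' j) end),
  (fun k z => match k with inl i => c i z.1 | inr j => c' j z.2 end); split.
- by move=> [i|j] a x y /=; rewrite ?clin ?c'lin.
- have C'' : 0 <= C + C' by rewrite addr_ge0.
  exists (C + C') => // -[i|j] z.
    rewrite (le_trans (cC _ _))// ler_pM ?lerDl//.
    by rewrite [leRHS]/Num.Def.normr/= le_max lexx.
  rewrite (le_trans (c'C _ _))// ler_pM ?lerDr//.
  by rewrite [leRHS]/Num.Def.normr/= le_max lexx orbT.
- move=> [x y]; rewrite big_sumType /=.
  rewrite [X in _ = X + _](_ : _ = (x, 0)); last first.
    rewrite {2}[x]cE; elim/big_ind2: _ => //= [a b a' d -> ->|i _].
      by congr pair; rewrite addr0.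
    by congr pair; rewrite scaler0.
  rewrite [X in _ = _ + X](_ : _ = (0, y)); last first.
    rewrite {2}[y]c'E; elim/big_ind2: _ => //= [a b a' d -> ->|i _].
      by congr pair; rewrite addr0.
    by congr pair; rewrite scaler0.
  by congr pair; rewrite ?addr0 ?add0r.
Qed.

End FiniteDimension.

Existing Class finite_coords.
#[global] Existing Instance finite_coords_mx.
#[global] Existing Instance finite_coords_prod.

#[global] Instance finite_coords_regular (R : realType) : finite_coords R^o.
Proof.
exists 'I_1, (fun=> 1), (fun _ x => x); split => //.
- by exists 1 => // _ x; rewrite mul1r.
- by move=> x; rewrite big_ord1 -[x *: 1]/(x * 1) mulr1.
Qed.

Section LinearMaps.
Variables (R : realType) (V W : normedModType R).
Context {fV : finite_coords V}.

Lemma linear_sum_coords (L : V -> W) (I : finType) (c : I -> R) (e : I -> V) :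
  linear L -> L (\sum_k c k *: e k) = \sum_k c k *: L (e k).
Proof.
move=> /linear_facts[L0 LD LZ _]; rewrite (big_morph L LD L0).
by apply: eq_bigr => k _; rewrite LZ.
Qed.

Lemma linear_bounded (L : V -> W) : linear L ->
  exists2 C, 0 < C & forall x, `|L x| <= C * `|x|.
Proof.
move=> Ll; have [I [e [c [_ [C C0 cC] cE]]]] := fV.
exists (\sum_k C * `|L (e k)| + 1).
  by rewrite ltr_wpDl// sumr_ge0// => k _; rewrite mulr_ge0.
move=> x; rewrite {1}[x]cE linear_sum_coords// (le_trans (ler_norm_sum _ _ _))//.
rewrite mulrDl mul1r ler_wpDr// mulr_suml ler_sum// => k _.
by rewrite normrZ mulrAC ler_wpM2r.
Qed.

Lemma linear_total_derivative (L : V -> W) x : linear L -> total_derivative L x L.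
Proof.
move=> Ll; split=> //; first exact: linear_bounded.
move=> e e0; exists 1 => // h _; have [_ -> _ _] := linear_facts Ll.
have -> : L x + L h - L x - L h = 0 by zmod.
by rewrite normr0 mulr_ge0// ltW.
Qed.

End LinearMaps.

Section BilinearMaps.
Variables (R : realType) (V V' W : normedModType R).
Context {fV : finite_coords V} {fV' : finite_coords V'}.

Lemma bilinear_bounded (B : V -> V' -> W) :
  (forall y, linear (B ^~ y)) -> (forall x, linear (B x)) ->
  exists2 C, 0 < C & forall x y, `|B x y| <= C * `|x| * `|y|.
Proof.
move=> Bl Br; have [I [e [c [_ [C C0 cC] cE]]]] := fV.
have [J [e' [c' [_ [C' C'0 c'C] c'E]]]] := fV'.
exists (\sum_j \sum_k C * C' * `|B (e k) (e' j)| + 1).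
  by rewrite ltr_wpDl// sumr_ge0// => k _; rewrite sumr_ge0// => j _; rewrite !mulr_ge0.
move=> x y; rewrite -mulrA mulrDl mul1r ler_wpDr ?mulr_ge0//.
have [Bx0 BxD BxZ _] := linear_facts (Br x).
rewrite {1}[y]c'E (big_morph (B x) BxD Bx0).
rewrite (le_trans (ler_norm_sum _ _ _))// mulr_suml ler_sum// => j _.
rewrite BxZ.
rewrite {1}[x]cE (linear_sum_coords _ _ (Bl (e' j)))// scaler_sumr.
rewrite (le_trans (ler_norm_sum _ _ _))// mulr_suml ler_sum// => k _.
rewrite !normrZ.
have -> : C * C' * `|B (e k) (e' j)| * (`|x| * `|y|) =
  (C' * `|y|) * ((C * `|x|) * `|B (e k) (e' j)|) by ring.
by rewrite !ler_pM// ?mulr_ge0// ler_pM.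
Qed.

End BilinearMaps.

Section DerivativeRules.
Variable R : realType.

Lemma is_derive_lin (U V W : normedModType R) {fV : finite_coords V} (L : V -> W)
    (f : U -> V) x v df :
  linear L -> is_derive x v f df -> is_derive x v (fun y => L (f y)) (L df).
Proof.
by move=> Ll fd; apply: total_derivative_comp fd _; exact: linear_total_derivative.
Qed.

Lemma is_derive_pair (U V W : normedModType R) (f : U -> V) (g : U -> W) x v df dg :
  is_derive x v f df -> is_derive x v g dg ->
  is_derive x v (fun y => (f y, g y)) (df, dg).
Proof.
move=> /is_derive_ball fd /is_derive_ball gd; apply/is_derive_ball => e e0.
have [r1 r10 r1P] := fd _ e0; have [r2 r20 r2P] := gd _ e0.
exists (Num.min r1 r2) => [|h]; first by rewrite lt_min r10.
rewrite lt_min => /andP[/r1P h1 /r2P h2].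
by rewrite [leLHS]/Num.Def.normr/= ge_max h1.
Qed.

(** The remainder of B at a pair is B applied to the two increments, which is quadratic. *)
Lemma is_derive_bilin (U V V' W : normedModType R)
    {fV : finite_coords V} {fV' : finite_coords V'}
    (B : V -> V' -> W) (f : U -> V) (g : U -> V') x v df dg :
  (forall y, linear (B ^~ y)) -> (forall x, linear (B x)) ->
  is_derive x v f df -> is_derive x v g dg ->
  is_derive x v (fun y => B (f y) (g y)) (B df (g x) + B (f x) dg).
Proof.
move=> Bl Br fd gd; have [C C0 BC] := bilinear_bounded Bl Br.
have H := is_derive_pair fd gd.
apply: (@total_derivative_comp R U (V * V')%type W _ (fun z => B z.1 z.2) x v (df, dg)
  (fun h => B h.1 (g x) + B (f x) h.2) H); split.
- move=> a u w /=; rewrite Bl Br /= scalerDr; zmod.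
- exists (C * (`|g x| + `|f x| + 1)).
    by rewrite mulr_gt0// ltr_wpDl// addr_ge0.
  move=> h; have h1 : `|h.1| <= `|h| by rewrite [leRHS]/Num.Def.normr/= le_max lexx.
  have h2 : `|h.2| <= `|h| by rewrite [leRHS]/Num.Def.normr/= le_max lexx orbT.
  rewrite (le_trans (ler_normD _ _))// (le_trans (lerD (BC _ _) (BC _ _)))//.
  have : `|h.1| * `|g x| <= `|h| * `|g x| by rewrite ler_wpM2r.
  have : `|f x| * `|h.2| <= `|f x| * `|h| by rewrite ler_wpM2l.
  have := normr_ge0 h => h0 H1 H2; rewrite -!mulrA -mulrDr ler_pM2l//; lra.
- move=> e e0; exists (e / C) => [|h]; first exact: divr_gt0.
  rewrite ltr_pdivlMr// => hr.
  have h1 : `|h.1| <= `|h| by rewrite [leRHS]/Num.Def.normr/= le_max lexx.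
  have h2 : `|h.2| <= `|h| by rewrite [leRHS]/Num.Def.normr/= le_max lexx orbT.
  have -> : B (f x + h.1) (g x + h.2) - B (f x) (g x) - (B h.1 (g x) + B (f x) h.2) =
      B h.1 h.2.
    have [_ -> _ _] := linear_facts (Br (f x + h.1)).
    have [_ -> _ _] := linear_facts (Bl (g x)).
    have [_ -> _ _] := linear_facts (Bl h.2).
    zmod.
  rewrite /= (le_trans (BC _ _))// -mulrA.
  have H3 : `|h.1| * `|h.2| <= `|h| * `|h| by rewrite ler_pM.
  by rewrite (le_trans (ler_wpM2l (ltW C0) H3))// mulrA ler_wpM2r// ltW// mulrC.
Qed.
End DerivativeRules.

(** * Closure properties of smooth maps *)

Section Smooth.
Variable R : realType.
Implicit Types V W : normedModType R.

Lemma near_eq_smooth_derive V W (U : set V) (f g : V -> W) x v d :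
  open U -> U x -> (forall y, U y -> f y = g y) -> is_derive x v f d -> is_derive x v g d.
Proof.
move=> oU Ux fg; apply: near_eq_is_derive.
by apply: filterS (open_nbhs_nbhs (conj oU Ux)).
Qed.

Lemma is_derive_ext V W (f g : V -> W) x v d :
  f =1 g -> is_derive x v f d -> is_derive x v g d.
Proof. by move=> /funext ->. Qed.

Lemma isCk_continuous V W k (U : set V) (f : V -> W) x :
  isCk k U f -> U x -> {for x, continuous f}.
Proof. by case: k => [|k] [+ _]; apply. Qed.

Lemma isCkS V W k (U : set V) (f : V -> W) : isCk k.+1 U f -> isCk k U f.
Proof.
elim: k f => [|k IHk] f [fc fd]; split => // v.
have [fv fk] := fd v; split=> //; exact: IHk.
Qed.

Lemma isCk_sub V W k (U U' : set V) (f : V -> W) : U' `<=` U -> isCk k U f -> isCk k U' f.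
Proof.
move=> UU; elim: k f => [|k IHk] f [fc fd]; split; do 1?[by move=> x /UU/fc] => //.
move=> v; have [fv fk] := fd v; split; last exact: IHk.
by move=> x /UU/fv.
Qed.

Lemma isCk_ext V W k (U : set V) (f g : V -> W) :
  open U -> (forall x, U x -> f x = g x) -> isCk k U f -> isCk k U g.
Proof.
move=> oU; elim: k f g => [|k IHk] f g fg [fc fd]; split => //; last first.
  move=> v; have [fv fk] := fd v.
  have H x : U x -> is_derive x v g ('D_v f x).
    by move=> Ux; apply: near_eq_smooth_derive (derivableP (fv _ Ux)); eauto.
  split=> [x /H[]//|]; apply: IHk fk => x /H[_ <-] //.
all: move=> x Ux; have H : f @ x --> f x by exact: fc.
all: rewrite (fg _ Ux) in H; apply: cvg_trans H.
all: by apply: near_eq_cvg; apply: filterS (open_nbhs_nbhs (conj oU Ux)).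
Qed.

Lemma smooth_sub V W (U U' : set V) (f : V -> W) : U' `<=` U -> smooth U f -> smooth U' f.
Proof. by move=> UU fs k; exact: isCk_sub (fs k). Qed.

Lemma smooth_ext V W (U : set V) (f g : V -> W) :
  open U -> (forall x, U x -> f x = g x) -> smooth U f -> smooth U g.
Proof. by move=> oU fg fs k; exact: isCk_ext (fs k). Qed.

Lemma smooth_derive V W (U : set V) (f : V -> W) v :
  smooth U f -> smooth U (fun x => 'D_v f x).
Proof. by move=> fs k; have [_ /(_ v)[]] := fs k.+1. Qed.

Lemma smooth_is_derive V W (U : set V) (f : V -> W) v x :
  smooth U f -> U x -> is_derive x v f ('D_v f x).
Proof. by move=> fs Ux; have [_ /(_ v)[/(_ _ Ux)/derivableP]] := fs 1%N. Qed.

Lemma smooth_total_derivative V W {fV : finite_coords V} (U : set V) (f : V -> W) x :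
  open U -> U x -> smooth U f -> total_derivative f x (fun v => 'D_v f x).
Proof.
move=> oU Ux fs; apply: (C1_total_derivative (U := U)) => // [v y Uy|v].
  by have [] := smooth_is_derive v fs Uy.
exact: isCk_continuous (smooth_derive v fs 0) Ux.
Qed.

Lemma smooth_linear V W {fV : finite_coords V} (U : set V) (f : V -> W) x :
  open U -> U x -> smooth U f -> linear (fun v => 'D_v f x).
Proof. by move=> oU Ux /(smooth_total_derivative oU Ux)[]. Qed.

Lemma smooth_schwarz V W (U : set V) (f : V -> W) x v w :
  open U -> U x -> smooth U f ->
  'D_w (fun z => 'D_v f z) x = 'D_v (fun z => 'D_w f z) x.
Proof.
move=> oU Ux fs; apply: (schwarz (U := U)) => // [y Uy|y Uy|y Uy|y Uy||].
- by have [] := smooth_is_derive v fs Uy.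
- by have [] := smooth_is_derive w fs Uy.
- by have [] := smooth_is_derive w (smooth_derive v fs) Uy.
- by have [] := smooth_is_derive v (smooth_derive w fs) Uy.
- exact: isCk_continuous (smooth_derive w (smooth_derive v fs) 0) Ux.
- exact: isCk_continuous (smooth_derive v (smooth_derive w fs) 0) Ux.
Qed.

Lemma isCk_cst V W k (U : set V) (c : W) : isCk k U (cst c).
Proof.
elim: k c => [|k IHk] c; (split; first by move=> x _; exact: cvg_cst) => // v.
split=> [x _|]; first exact: derivable_cst.
by rewrite (_ : (fun x => _) = cst 0)//; apply/funext => x; rewrite derive_cst.
Qed.

Lemma smooth_cst V W (U : set V) (c : W) : smooth U (cst c).
Proof. by move=> k; exact: isCk_cst. Qed.

Lemma smooth_id V (U : set V) : smooth U (fun x => x).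
Proof.
case=> [|k]; (split; first by move=> x _; exact: cvg_id) => // v.
split=> [x _|]; first exact: derivable_id.
rewrite (_ : (fun x => _) = cst v); first exact: isCk_cst.
by apply/funext => x; rewrite derive_id.
Qed.

Lemma is_derive_add V W (f g : V -> W) x v df dg :
  is_derive x v f df -> is_derive x v g dg ->
  is_derive x v (fun y => f y + g y) (df + dg).
Proof. by move=> fd gd; exact: is_deriveD. Qed.

Lemma is_derive_opp V W (f : V -> W) x v df :
  is_derive x v f df -> is_derive x v (fun y => - f y) (- df).
Proof. by move=> fd; exact: is_deriveN. Qed.

Lemma isCk_add V W k (U : set V) (f g : V -> W) : open U ->
  isCk k U f -> isCk k U g -> isCk k U (fun x => f x + g x).
Proof.
move=> oU; elim: k f g => [|k IHk] f g [fc fd] [gc gd]; split=> //.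
- by move=> x Ux; apply: cvgD; [exact: fc|exact: gc].
- by move=> x Ux; apply: cvgD; [exact: fc|exact: gc].
- move=> v; have [fv fk] := fd v; have [gv gk] := gd v.
  have H x : U x -> is_derive x v (fun x => f x + g x) ('D_v f x + 'D_v g x).
    by move=> Ux; apply: is_derive_add; apply/derivableP; [exact: fv|exact: gv].
  split=> [x /H[]//|]; apply: isCk_ext (IHk _ _ fk gk) => // x /H[_ <-] //.
Qed.

Lemma smooth_add V W (U : set V) (f g : V -> W) : open U ->
  smooth U f -> smooth U g -> smooth U (fun x => f x + g x).
Proof. by move=> oU fs gs k; exact: isCk_add. Qed.

Lemma linear_continuous_at V W {fV : finite_coords V} (L : V -> W) x :
  linear L -> {for x, continuous L}.
Proof.
move=> Ll; have [C C0 LC] := linear_bounded Ll.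
apply/cvgrPdist_le => e e0; apply/near_ballP; exists (e / C); first exact: divr_gt0.
move=> y; rewrite ltr_pdivlMr// => yx; rewrite distrC.
have [_ LD _ LN] := linear_facts Ll; rewrite -LN -LD (le_trans (LC _))// mulrC ltW//.
Qed.

Lemma isCk_lin V W (W' : normedModType R) {fW : finite_coords W} (L : W -> W') k (U : set V) (f : V -> W) :
  open U -> linear L -> isCk k U f -> isCk k U (fun x => L (f x)).
Proof.
move=> oU Ll; elim: k f => [|k IHk] f [fc fd]; split=> //.
- by move=> x Ux; apply: continuous_comp; [exact: fc|exact: linear_continuous_at].
- by move=> x Ux; apply: continuous_comp; [exact: fc|exact: linear_continuous_at].
- move=> v; have [fv fk] := fd v.
  have H x : U x -> is_derive x v (fun x => L (f x)) (L ('D_v f x)).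
    by move=> Ux; apply: is_derive_lin => //; apply/derivableP; exact: fv.
  split=> [x /H[]//|]; apply: isCk_ext (IHk _ fk) => // x /H[_ <-] //.
Qed.

Lemma smooth_lin V W (W' : normedModType R) {fW : finite_coords W} (L : W -> W') (U : set V) (f : V -> W) :
  open U -> linear L -> smooth U f -> smooth U (fun x => L (f x)).
Proof. by move=> oU Ll fs k; exact: isCk_lin. Qed.

Lemma isCk_precomp V (V' : normedModType R) W (P : V' -> V) k (U : set V) (f : V -> W) :
  linear P -> (forall x, {for x, continuous P}) ->
  isCk k U f -> isCk k (P @^-1` U) (fun x => f (P x)).
Proof.
move=> Pl Pc; elim: k f => [|k IHk] f [fc fd]; split=> //.
- by move=> x Ux; apply: continuous_comp; [exact: Pc|exact: fc].
- by move=> x Ux; apply: continuous_comp; [exact: Pc|exact: fc].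
- move=> v; have [fv fk] := fd (P v).
  have H x : U (P x) -> is_derive x v (fun x => f (P x)) ('D_(P v) f (P x)).
    move=> Ux; have /is_derive_ball H := derivableP (fv _ Ux).
    apply/is_derive_ball => e /H[r r0 rP]; exists r => // h /rP.
    by have [_ PD PZ _] := linear_facts Pl; rewrite PD PZ.
  split=> [x /H[]//|].
  have -> : (fun x => 'D_v (fun x0 : V' => f (P x0)) x) = (fun x => 'D_(P v) f (P x)).
    apply/funext => x; rewrite /derive /=.
    have [_ PD PZ _] := linear_facts Pl.
    by under eq_fun do rewrite PD PZ.
  exact: (IHk _ fk).
Qed.

Lemma smooth_precomp V (V' : normedModType R) W {fV' : finite_coords V'} (P : V' -> V) (U : set V) (f : V -> W) :
  linear P -> smooth U f -> smooth (P @^-1` U) (fun x => f (P x)).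
Proof.
by move=> Pl fs k; apply: isCk_precomp => // x; exact: linear_continuous_at.
Qed.

(** The product rule expresses the derivative by B of maps that are again of class C^k, so only
    continuity needs an estimate. *)
Lemma isCk_bilin (U' : normedModType R) V (V' : normedModType R) W {fV : finite_coords V} {fV' : finite_coords V'}
    (B : V -> V' -> W) k (U : set U') (f : U' -> V) (g : U' -> V') :
  open U -> (forall y, linear (B ^~ y)) -> (forall x, linear (B x)) ->
  isCk k U f -> isCk k U g -> isCk k U (fun x => B (f x) (g x)).
Proof.
move=> oU Bl Br.
have c0 x f' g' : {for x, continuous f'} -> {for x, continuous g'} ->
    {for x, continuous (fun x : U' => B (f' x) (g' x))}.
  move=> fc gc; have [C C0 BC] := bilinear_bounded Bl Br.
  have [_ BD _ BN] := linear_facts (Br (f' x)).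
  have fg0 : \forall y \near x, `|f' x - f' y| <= 1.
    by move/cvgrPdist_le : fc; apply.
  apply/cvgrPdist_le => e e0.
  have e1 : 0 < e / 2 / C / (`|f' x| + 1 + `|g' x|) .
    by rewrite !divr_gt0// ltr_wpDr// ltr_wpDl.
  move/cvgrPdist_le : fc => /(_ _ e1) fe; move/cvgrPdist_le : gc => /(_ _ e1) ge.
  near=> y.
  have -> : B (f' x) (g' x) - B (f' y) (g' y) =
      B (f' x - f' y) (g' x) + B (f' y) (g' x - g' y).
    have [_ BlD _ BlN] := linear_facts (Bl (g' x)).
    have [_ BrD _ BrN] := linear_facts (Br (f' y)).
    rewrite BlD BlN BrD BrN; zmod.
  have fy : `|f' y| <= `|f' x| + 1.
    have : `|f' x - f' y| <= 1 by near: y.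
    have := ler_normB (f' x) (f' x - f' y); rewrite opprB addrC subrK; lra.
  have h1 : `|f' x - f' y| <= e / 2 / C / (`|f' x| + 1 + `|g' x|) by near: y.
  have h2 : `|g' x - g' y| <= e / 2 / C / (`|f' x| + 1 + `|g' x|) by near: y.
  rewrite (le_trans (ler_normD _ _))// (le_trans (lerD (BC _ _) (BC _ _)))//.
  rewrite -!mulrA -mulrDr mulrC -ler_pdivlMr//.
  have H1 : `|f' x - f' y| * `|g' x| <= e / 2 / C / (`|f' x| + 1 + `|g' x|) * `|g' x|.
    by rewrite ler_wpM2r.
  have H2 : `|f' y| * `|g' x - g' y| <=
      (`|f' x| + 1) * (e / 2 / C / (`|f' x| + 1 + `|g' x|)) by rewrite ler_pM.
  rewrite (le_trans (lerD H1 H2))// [X in X + _]mulrC -mulrDl.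
  rewrite [X in X * _](_ : _ = `|f' x| + 1 + `|g' x|) 1?addrC//.
  rewrite [leLHS]mulrC divfK; last by rewrite gt_eqF// ltr_wpDr// ltr_wpDl.
  by rewrite ler_pM2r ?invr_gt0// ler_pdivrMr// ler_peMr ?ler1n// ltW.
elim: k f g => [|k IHk] f g [fc fd] [gc gd]; split=> //.
- by move=> x Ux; apply: c0; [exact: fc|exact: gc].
- by move=> x Ux; apply: c0; [exact: fc|exact: gc].
- move=> v; have [fv fk] := fd v; have [gv gk] := gd v.
  have H x : U x -> is_derive x v (fun x => B (f x) (g x))
      (B ('D_v f x) (g x) + B (f x) ('D_v g x)).
    by move=> Ux; apply: is_derive_bilin => //; apply/derivableP; [exact: fv|exact: gv].
  split=> [x /H[]//|].
  have fk0 : isCk k U f by apply: isCkS; split.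
  have gk0 : isCk k U g by apply: isCkS; split.
  apply: isCk_ext (isCk_add oU (IHk _ _ fk gk0) (IHk _ _ fk0 gk)) => // x /H[_ <-] //.
Unshelve. all: by end_near. Qed.

Lemma smooth_bilin (U' : normedModType R) V (V' : normedModType R) W {fV : finite_coords V} {fV' : finite_coords V'}
    (B : V -> V' -> W) (U : set U') (f : U' -> V) (g : U' -> V') :
  open U -> (forall y, linear (B ^~ y)) -> (forall x, linear (B x)) ->
  smooth U f -> smooth U g -> smooth U (fun x => B (f x) (g x)).
Proof. by move=> oU Bl Br fs gs k; exact: isCk_bilin. Qed.

End Smooth.

Section ParametrizedLinearMaps.
Variable R : realType.
Implicit Types V W : normedModType R.

Lemma is_derive_bigsum V W (I : finType) (f : I -> V -> W) x v (df : I -> W) :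
  (forall k, is_derive x v (f k) (df k)) ->
  is_derive x v (fun y => \sum_k f k y) (\sum_k df k).
Proof.
move=> fd; elim: (index_enum I) => [|k s IHs].
  rewrite big_nil; apply: is_derive_ext (is_derive_cst 0 x v) => y.
  by rewrite big_nil.
rewrite big_cons; apply: is_derive_ext (is_derive_add (fd k) IHs) => y.
by rewrite big_cons.
Qed.

Lemma smooth_bigsum V W (I : finType) (f : I -> V -> W) (U : set V) : open U ->
  (forall k, smooth U (f k)) -> smooth U (fun y => \sum_k f k y).
Proof.
move=> oU fs; elim: (index_enum I) => [|k s IHs].
  by apply: smooth_ext (smooth_cst U 0) => // y _; rewrite big_nil.
by apply: smooth_ext (smooth_add oU (fs k) IHs) => // y _; rewrite big_cons.
Qed.

Lemma scale_linearl W : forall w : W, linear (fun a : R^o => (a : R) *: w).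
Proof. by move=> w a x y; rewrite scalerDl scalerA. Qed.

Lemma scale_linearr W (a : R^o) : linear (fun w : W => (a : R) *: w).
Proof. by move=> b x y; rewrite scalerDr !scalerA mulrC. Qed.

(** Product rule for a linear map that depends on the point; expanding its argument in coordinates
    reduces it to finitely many scalings. It is applied to the connection forms and to D_e s as a
    function of e. *)
Lemma is_derive_param V W (E : normedModType R) {fE : finite_coords E}
    {fW : finite_coords W} (U : set V) (l : V -> E -> W) (Y : V -> E) x v Y' :
  open U -> U x -> (forall y, U y -> linear (l y)) ->
  (forall e, derivable (l ^~ e) x v) -> is_derive x v Y Y' ->
  is_derive x v (fun y => l y (Y y)) ('D_v (l ^~ (Y x)) x + l x Y').
Proof.
move=> oU Ux ll ld Yd; have [I [e [c [clin _ cE]]]] := fE.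
have cl k : linear (c k : E -> R^o) by move=> a y z; rewrite clin.
have H y : U y -> forall w, l y w = \sum_k c k w *: l y (e k).
  by move=> Uy w; rewrite {1}[w]cE linear_sum_coords//; exact: ll.
have D (Z : V -> E) Z' : is_derive x v Z Z' -> is_derive x v (fun y => l y (Z y))
    (\sum_k (c k Z' *: l x (e k) + c k (Z x) *: 'D_v (l ^~ (e k)) x)).
  move=> Zd; apply: (near_eq_smooth_derive (U := U) (f := fun y => \sum_k c k (Z y) *: l y (e k))) => //.
    by move=> y Uy; rewrite H.
  apply: is_derive_bigsum => k.
  apply: (@is_derive_bilin R V R^o W W _ _ (fun a w => (a : R) *: w) (fun y => c k (Z y))).
  - exact: scale_linearl.
  - exact: scale_linearr.
  - exact: is_derive_lin.
  - exact: derivableP.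
(* The constant argument [Y x] is a second instance of D; comparing the two identifies the first
   summand. *)
have := D _ _ Yd.
have [_ ->] := D _ _ (is_derive_cst (Y x) x v).
rewrite [l x Y']H//; suff -> : \sum_k (c k Y' *: l x (e k) + c k (Y x) *: 'D_v (l^~ (e k)) x) =
  \sum_k (c k 0 *: l x (e k) + c k (cst (Y x) x) *: 'D_v (l^~ (e k)) x) + \sum_k c k Y' *: l x (e k) by [].
rewrite -big_split; apply: eq_bigr => k _ /=.
have [-> _ _ _] := linear_facts (cl k).
by rewrite scale0r add0r addrC.
Qed.

Lemma smooth_param V W (E : normedModType R) {fE : finite_coords E}
    {fW : finite_coords W} (U : set V) (l : V -> E -> W) (Y : V -> E) :
  open U -> (forall y, U y -> linear (l y)) ->
  (forall e, smooth U (l ^~ e)) -> smooth U Y -> smooth U (fun y => l y (Y y)).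
Proof.
move=> oU ll ls Ys; have [I [e [c [clin _ cE]]]] := fE.
have cl k : linear (c k : E -> R^o) by move=> a y z; rewrite clin.
apply: (smooth_ext (f := fun y => \sum_k c k (Y y) *: l y (e k))) => //.
  by move=> y Uy; rewrite {2}[Y y]cE linear_sum_coords//; exact: ll.
apply: smooth_bigsum => // k.
apply: (@smooth_bilin R V R^o W W _ _ (fun a w => (a : R) *: w) U (fun y => c k (Y y))) => //.
- exact: scale_linearl.
- exact: scale_linearr.
- exact: smooth_lin.
Qed.

Lemma smooth_pair V W (W' : normedModType R) {fW : finite_coords W} {fW' : finite_coords W'}
    (U : set V) (f : V -> W) (g : V -> W') :
  open U -> smooth U f -> smooth U g -> smooth U (fun x => (f x, g x)).
Proof.
move=> oU fs gs.
apply: (smooth_ext (f := fun x => (f x, 0 : W') + (0 : W, g x))) => //.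
  by move=> x _; congr pair; rewrite ?addr0 ?add0r.
apply: smooth_add => //.
- apply: (smooth_lin (L := fun w => (w, 0 : W'))) => //.
  by move=> a x y; apply: injective_projections; rewrite /= ?scaler0 ?addr0.
- apply: (smooth_lin (L := fun w => (0 : W, w))) => //.
  by move=> a x y; apply: injective_projections; rewrite /= ?scaler0 ?addr0.
Qed.

End ParametrizedLinearMaps.

Section MatrixRules.
Variable R : realType.

Lemma mulmx_linearl m n p (B : 'M[R]_(n, p)) : linear (fun A : 'M[R]_(m, n) => A *m B).
Proof. by move=> a A A'; rewrite mulmxDl scalemxAl. Qed.

Lemma mulmx_linearr m n p (A : 'M[R]_(m, n)) : linear (fun B : 'M[R]_(n, p) => A *m B).
Proof. by move=> a B B'; rewrite mulmxDr scalemxAr. Qed.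

Lemma is_derive_mulmx (V : normedModType R) m n p
    (f : V -> 'M[R]_(m, n)) (g : V -> 'M[R]_(n, p)) x v df dg :
  is_derive x v f df -> is_derive x v g dg ->
  is_derive x v (fun y => f y *m g y) (df *m g x + f x *m dg).
Proof.
move=> fd gd; apply: (is_derive_bilin (B := fun A B => A *m B)) => //.
- by move=> B; exact: mulmx_linearl.
- by move=> A; exact: mulmx_linearr.
Qed.

Lemma smooth_mulmx (V : normedModType R) m n p
    (U : set V) (f : V -> 'M[R]_(m, n)) (g : V -> 'M[R]_(n, p)) :
  open U -> smooth U f -> smooth U g -> smooth U (fun y => f y *m g y).
Proof.
move=> oU fs gs; apply: (smooth_bilin (B := fun A B => A *m B)) => //.
- by move=> B; exact: mulmx_linearl.
- by move=> A; exact: mulmx_linearr.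
Qed.

Lemma dsubmx_linear m1 m2 n : linear (@dsubmx R m1 m2 n).
Proof. by move=> a x y; rewrite linearP. Qed.

End MatrixRules.

(** * Torsion and curvature in a chart *)

(* The columns [embN p u] span the coordinate complement of F in a chart. *)
Definition embN (R : realType) (p d : nat) (u : 'cV[R]_d) : vec R p d := col_mx 0 u.
Arguments embN {R} p {d} u.

Section ConnectionForms.
Variables (R : realType) (p d : nat) (M : foliatedManifold R p d).
Variables (nab : connection M) (i : chartIdx M).
Implicit Types (x v w : vec R p d).

Lemma img_openP : open (img i). Proof. exact: img_open. Qed.

Lemma embNK (u : 'cV[R]_d) : dsubmx (embN p u) = u.
Proof. exact: col_mxKd. Qed.

Lemma embN_linear : linear (@embN R p d).
Proof. by move=> a u v; rewrite /embN scale_col_mx add_col_mx scaler0 addr0. Qed.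

Lemma inF_sub_embN v : inF (v - embN p (dsubmx v)).
Proof. by rewrite /inF linearB /= embNK subrr. Qed.

(** The curvature form d omega + omega wedge omega of the connection form omega, on constant
    vectors. *)
Definition curvMx x v w : 'M[R]_d :=
  'D_v (fun y => conn nab i y w) x - 'D_w (fun y => conn nab i y v) x
  + (conn nab i x v *m conn nab i x w - conn nab i x w *m conn nab i x v).

(** The torsion of constant chart fields, whose derivatives and bracket vanish. *)
Definition torVec x v w : 'cV[R]_d :=
  conn nab i x v *m dsubmx w - conn nab i x w *m dsubmx v.

Lemma smooth_piN W (X : vec R p d -> vec R p d) : open W -> smooth W X -> smooth W (piN X).
Proof.
move=> oW Xs; apply: (smooth_lin (L := @dsubmx R p d 1)) => //; exact: dsubmx_linear.
Qed.

Lemma is_derive_piN (X : vec R p d -> vec R p d) x v dX :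
  is_derive x v X dX -> is_derive x v (piN X) (dsubmx dX).
Proof.
by move=> Xd; apply: (is_derive_lin (L := @dsubmx R p d 1)) => //; exact: dsubmx_linear.
Qed.

Lemma conn_is_derive x v w : img i x ->
  is_derive x v (fun y => conn nab i y w) ('D_v (fun y => conn nab i y w) x).
Proof. by move=> ix; apply: smooth_is_derive ix; exact: conn_smooth. Qed.

Lemma torsionE W X Y x : isField i W X -> isField i W Y -> W x ->
  torsion nab i X Y x = torVec x (X x) (Y x).
Proof.
move=> [oW WU Xs] [_ _ Ys] Wx; rewrite /torsion /nabla /bracket /torVec.
have [_ ->] := is_derive_piN (smooth_is_derive (X x) Ys Wx).
have [_ ->] := is_derive_piN (smooth_is_derive (Y x) Xs Wx).
rewrite /piN linearB /=; zmod.
Qed.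

Lemma is_derive_conn x v (Y : vec R p d -> vec R p d) dY : img i x ->
  is_derive x v Y dY ->
  is_derive x v (fun y => conn nab i y (Y y))
    ('D_v (fun y => conn nab i y (Y x)) x + conn nab i x dY).
Proof.
move=> ix Yd; apply: (is_derive_param (U := img i)) => //.
- exact: img_openP.
- exact: conn_linear.
- by move=> e; have [] := conn_is_derive v e ix.
Qed.

(** The second derivatives of s cancel by Schwarz and the first ones against the bracket term; what
    is left involves only the values of the fields. *)
Lemma curvatureE W X Y s x : isField i W X -> isField i W Y -> smooth W s -> W x ->
  curvature nab i X Y s x = curvMx x (X x) (Y x) *m s x.
Proof.
move=> fX fY ss Wx.
have key Z v : isField i W Z -> is_derive x v (nabla nab i Z s)
   ('D_v (fun y => 'D_(Z x) s y) x + 'D_('D_v Z x) s x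
    + (('D_v (fun y => conn nab i y (Z x)) x + conn nab i x ('D_v Z x)) *m s x
       + conn nab i x (Z x) *m 'D_v s x)).
  move=> [oW WU Zs]; apply: is_derive_add.
    apply: (is_derive_param (U := W) (l := fun y e => 'D_e s y)) => //.
    - by move=> y Wy; apply: (smooth_linear (U := W)).
    - by move=> e; have [] := smooth_is_derive v (smooth_derive e ss) Wx.
    - exact: smooth_is_derive Wx.
  apply: is_derive_mulmx; last exact: smooth_is_derive Wx.
  by apply: is_derive_conn; [exact: WU|exact: smooth_is_derive Wx].
have [oW WU _] := fX.
rewrite /curvature {1 3}/nabla.
have [_ ->] := key _ (X x) fY; have [_ ->] := key _ (Y x) fX.
rewrite /nabla /bracket.
have lD : linear (fun v => 'D_v s x) by exact: (smooth_linear (U := W)).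
have [_ DD _ DN] := linear_facts lD.
have [_ CD _ CN] := linear_facts (conn_linear nab (WU _ Wx)).
rewrite (smooth_schwarz (Y x) (X x) oW Wx ss) DD DN CD CN /curvMx.
rewrite !(mulmxDl, mulmxDr, mulNmx) -!mulmxA; zmod.
Qed.

Hypothesis adap : adapted nab.

(** Constant transversal fields commute with constant leaf fields, so the Bott condition says that
    the chart frame of N F is parallel along the leaves. *)
Lemma conn_inF x v : img i x -> inF v -> conn nab i x v = 0.
Proof.
move=> ix Fv; apply/matrixP => a b.
have cstF w : isField i (img i) (cst w).
  by split=> //; [exact: img_openP|exact: smooth_cst].
have := adap (cstF (embN p (delta_mx b 0))) (cstF v) (fun=> fun=> Fv) ix.
rewrite /nabla /piN /bracket /= !derive_cst subrr.
rewrite embNK add0r linear0 -colE => /matrixP/(_ a 0).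
by rewrite !mxE.
Qed.

Lemma conn_embN x v : img i x -> conn nab i x (embN p (dsubmx v)) = conn nab i x v.
Proof.
move=> ix; have [_ CD _ CN] := linear_facts (conn_linear nab ix).
by apply/esym/subr0_eq; rewrite -CN -CD conn_inF//; exact: inF_sub_embN.
Qed.

End ConnectionForms.

(** * Foliated fields on the twistor space *)

Section ComplexStructures.
Variables (R : realType) (d : nat).
Implicit Types (A J S : 'M[R]_d).

(** A directional derivative sees only the line; this serves for formulas that are available only
    along Z(F). *)
Lemma is_derive_line_eq (V W : normedModType R) (f g : V -> W) x v df (r : R) : 0 < r ->
  (forall h : R, `|h| < r -> f (x + h *: v) = g (x + h *: v)) ->
  is_derive x v f df -> is_derive x v g df.
Proof.
move=> r0 fg /is_derive_ball fd; apply/is_derive_ball => e /fd[s s0 sP].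
exists (Num.min r s) => [|h]; first by rewrite lt_min r0.
rewrite lt_min => /andP[/fg <- /sP]; have := fg 0.
by rewrite normr0 scale0r addr0 => ->.
Qed.

(* The curve [(1 + t S) J (1 + t S)^-1] with [S = - A J / 2], so that [S J - J S = A]. *)
Lemma complex_structure_curve J A :
  J *m J = - 1%:M -> A *m J + J *m A = 0 ->
  exists g : R -> 'M[R]_d, [/\ g 0 = J, is_derive (0 : R) 1 g A
    & exists2 r, 0 < r & forall t, `|t| < r -> g t *m g t = - 1%:M].
Proof.
move=> JJ AJ; pose S := - (2^-1 *: (A *m J)).
have SJ : S *m J - J *m S = A.
  have JA : J *m A = - (A *m J) by apply/eqP; rewrite -addr_eq0 addrC AJ.
  have AJJ : A *m J *m J = - A by rewrite -mulmxA JJ mulmxN mulmx1.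
  rewrite /S mulNmx mulmxN -scalemxAl -scalemxAr mulmxA JA mulNmx AJJ opprK.
  by rewrite scalerN !opprK -scalerDl (_ : _ + _ = 1) ?scale1r//; field.
have [C C0 BC] := bilinear_bounded (@mulmx_linearl R d d d) (@mulmx_linearr R d d d).
have [C' C'0 BC'] := bilinear_bounded (@mulmx_linearl R 1 d d) (@mulmx_linearr R 1 d d).
have S1 : 0 < `|S| + 1 by rewrite ltr_wpDl.
(* For |t| < r multiplication by t S has norm at most 1/2, on row vectors (constant C') to make 1 +
   t S invertible, and on square matrices (constant C) to estimate its inverse. *)
pose r := Num.min (2^-1 / (C * (`|S| + 1))) (2^-1 / (C' * (`|S| + 1))).
have r0 : 0 < r by rewrite lt_min !divr_gt0// mulr_gt0.
pose B t := 1%:M + t *: S.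
have small (t : R) : `|t| < r -> C * (`|t| * `|S|) <= 2^-1 /\ C' * (`|t| * `|S|) <= 2^-1.
  rewrite lt_min !ltr_pdivlMr ?mulr_gt0// => /andP[/ltW h1 /ltW h2].
  have tS : `|t| * `|S| <= `|t| * (`|S| + 1) by rewrite ler_wpM2l// lerDl.
  split; first by rewrite (le_trans _ h1)// [leRHS]mulrCA ler_pM2l.
  by rewrite (le_trans _ h2)// [leRHS]mulrCA ler_pM2l.
have Bu (t : R) : `|t| < r -> B t \in unitmx.
  move=> /small[_ tr]; rewrite -row_free_unit; apply: inj_row_free => u.
  rewrite /B mulmxDr mulmx1 => /eqP; rewrite addr_eq0 => /eqP uE.
  have : `|u| <= 2^-1 * `|u|.
    rewrite {1}uE normrN (le_trans (BC' _ _))// normrZ mulrAC ler_wpM2r//.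
  have := normr_ge0 u => h1 h2; apply/eqP; rewrite -normr_le0; lra.
exists (fun t => B t *m J *m invmx (B t)); split.
- by rewrite /B scale0r addr0 mul1mx invmx1 mulmx1.
- apply/is_derive_ball => e e0.
  pose N1 := `|1%:M : 'M[R]_d|.
  pose K := C * `|A| * (2 * (C * `|S| * N1)) + 1.
  have C0W := ltW C0; have N10 : 0 <= N1 by exact: normr_ge0.
  have K0 : 0 < K by rewrite /K ltr_wpDl// !mulr_ge0.
  exists (Num.min r (e / K)); first by rewrite lt_min r0 divr_gt0.
  move=> h; rewrite lt_min ltr_pdivlMr// => /andP[hr hK].
  have B0 : B 0 = 1%:M by rewrite /B scale0r addr0.
  rewrite add0r -[h *: 1]/(h * 1) mulr1 B0 mul1mx invmx1 mulmx1.
  have uB := Bu _ hr; set D := invmx (B h).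
  have BD : B h *m D = 1%:M by rewrite mulmxV.
  have DE : D - 1%:M = - (h *: (S *m D)).
    by rewrite -BD /B mulmxDl mul1mx -scalemxAl; zmod.
  (* As B D = 1, the difference of the first two terms is (B J - J B) D, and B J - J B = h (S J - J
     S) = h A. *)
  have -> : B h *m J *m D - J - h *: A = h *: (A *m (D - 1%:M)).
    rewrite mulmxBr mulmx1 scalerBr; congr (_ - _).
    rewrite -{2}[J]mulmx1 -BD mulmxA -mulmxBl -SJ scalemxAl; congr (_ *m _).
    rewrite /B mulmxDl mulmxDr mul1mx mulmx1 -scalemxAl -scalemxAr scalerBr; zmod.
  have D1 : `|D - 1%:M| <= 2 * (C * (`|h| * `|S|) * N1).
    have : `|D - 1%:M| <= C * (`|h| * `|S|) * `|D|.
      by rewrite {1}DE normrN scalemxAl (le_trans (BC _ _))// normrZ.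
    have : `|D| <= `|D - 1%:M| + N1 by rewrite -{1}[D](subrK 1%:M) ler_normD.
    have [h1 _] := small _ hr; move: h1; set c := C * (`|h| * `|S|) => h1.
    have c0 : 0 <= c by rewrite !mulr_ge0// ltW.
    move=> H2 H1.
    have := ler_wpM2l c0 H2; have := ler_wpM2r (normr_ge0 (D - 1%:M)) h1; lra.
  rewrite normrZ mulrC ler_wpM2r// (le_trans (BC _ _))//.
  rewrite (le_trans (ler_wpM2l _ D1)) ?mulr_ge0// ?(ltW C0)//.
  apply: le_trans (ltW hK).
  by have := normr_ge0 h; rewrite /K; lra.
- exists r => // t /Bu tu.
  rewrite !mulmxA -(mulmxA _ (invmx _)) mulVmx// mulmx1 -(mulmxA _ J J) JJ.
  by rewrite mulmxN mulmx1 mulNmx mulmxV.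
Qed.

End ComplexStructures.

Section TwistorFields.
Variables (R : realType) (p d : nat) (M : foliatedManifold R p d).
Variables (nab : connection M) (i : chartIdx M).
Implicit Types (z w : amb R p d) (O : set (amb R p d)) (V W : amb R p d -> amb R p d).

Lemma fst_linear (V W : lmodType R) : linear (@fst V W).
Proof. by []. Qed.

Lemma snd_linear (V W : lmodType R) : linear (@snd V W).
Proof. by []. Qed.

Lemma is_derive_fst (V W1 W2 : normedModType R) {f1 : finite_coords W1} {f2 : finite_coords W2}
    (f : V -> W1 * W2) x v df :
  is_derive x v f df -> is_derive x v (fun y => (f y).1) df.1.
Proof. by move=> fd; apply: (is_derive_lin (L := fst)) => //; exact: fst_linear. Qed.

Lemma is_derive_snd (V W1 W2 : normedModType R) {f1 : finite_coords W1} {f2 : finite_coords W2}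
    (f : V -> W1 * W2) x v df :
  is_derive x v f df -> is_derive x v (fun y => (f y).2) df.2.
Proof. by move=> fd; apply: (is_derive_lin (L := snd)) => //; exact: snd_linear. Qed.

Definition transv V z : 'cV[R]_d := dsubmx (V z).1.

Lemma is_derive_transv V z w dV : is_derive z w V dV ->
  is_derive z w (transv V) (dsubmx dV.1).
Proof.
move=> Vd; apply: (is_derive_lin (L := @dsubmx R p d 1)); first exact: dsubmx_linear.
exact: is_derive_fst Vd.
Qed.

(** The tangent direction is realized by a curve inside the twistor space, on which f and g agree.
    The curve is bent, hence the total derivatives. *)
Lemma derive_eq_on_twistor (E : normedModType R) (f g : amb R p d -> E) O z w df dg :
  open O -> O z -> z.2 *m z.2 = - 1%:M -> tangentZ z w ->
  (forall z', O z' -> z'.2 *m z'.2 = - 1%:M -> f z' = g z') ->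
  total_derivative f z df -> total_derivative g z dg -> df w = dg w.
Proof.
move=> oO Oz zz zw fg fd gd.
have [c [c0 cd [r r0 cc]]] := complex_structure_curve zz zw.
pose G (t : R) : amb R p d := (z.1 + t *: w.1, c t).
have Gd : is_derive (0 : R) 1 G w.
  rewrite [w]surjective_pairing; apply: is_derive_pair => //.
  apply/is_derive_ball => e e0; exists 1 => // h _.
  rewrite scale0r addr0 add0r -[h *: 1]/(h * 1) mulr1.
  have -> : z.1 + h *: w.1 - z.1 - h *: w.1 = 0 by zmod.
  by rewrite normr0 mulr_ge0// ltW.
have G0 : G 0 = z by rewrite /G scale0r addr0 c0 -surjective_pairing.
have [[fv fE] [gv gE]] : is_derive (0 : R) 1 (f \o G) (df w) /\ is_derive (0 : R) 1 (g \o G) (dg w).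
  by split; apply: total_derivative_comp Gd _; rewrite G0.
rewrite -fE -gE; apply: near_eq_derive.
have Gc : {for (0 : R), continuous G}.
  have Gd1 : derivable G 0 1 by case: Gd.
  by apply: differentiable_continuous; apply/derivable1_diffP.
have nO : \forall t \near (0 : R), O (G t).
  by apply: Gc; rewrite G0; exact: open_nbhs_nbhs.
have nr : \forall t \near (0 : R), `|t| < r.
  by apply/near_ballP; exists r => // y; rewrite subr0.
by apply: filterS2 nO nr => t Ot tr; rewrite /= fg// cc.
Qed.

Hypothesis adap : adapted nab.

(** Since the connection form vanishes on F, the lifted foliation is a product in the chart: J is
    constant along its leaves. *)
Lemma inFhatP z w : img i z.1 -> inFhat nab i z w <-> inF w.1 /\ w.2 = 0.
Proof.
move=> iz; rewrite /inFhat /horizontal /covJ /tangentZ; split=> [[[_ c] Fw]|[Fw ->]].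
  by split=> //; move: c; rewrite (conn_inF adap)// mul0mx mulmx0 subrr addr0.
by rewrite (conn_inF adap)// !mul0mx !mulmx0 subrr !addr0.
Qed.

Definition leafConstant O V := forall z, O z -> z.2 *m z.2 = - 1%:M -> forall e, inF e ->
  dsubmx ('D_((e, 0) : amb R p d) V z).1 = 0 /\ ('D_((e, 0) : amb R p d) V z).2 = 0.

Lemma twistor_in O z : (forall z, O z -> img i z.1) -> O z ->
  twistor i z <-> z.2 *m z.2 = - 1%:M.
Proof. by move=> Oi Oz; split=> [[]|zz]; last by split=> //; exact: Oi. Qed.

Lemma field_total_derivative O V z : isFieldZ i O V -> O z ->
  total_derivative V z (fun w => 'D_w V z).
Proof. by move=> [oO Oi Vs Vt] Oz; apply: (smooth_total_derivative (U := O)). Qed.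

Lemma field_is_derive O V z w : isFieldZ i O V -> O z -> is_derive z w V ('D_w V z).
Proof. by move=> [oO Oi Vs Vt] Oz; apply: smooth_is_derive Oz. Qed.

Lemma isFieldZ_sub O O' V : open O' -> O' `<=` O -> isFieldZ i O V -> isFieldZ i O' V.
Proof.
move=> oO' OO [oO Oi Vs Vt]; split=> //.
- by move=> z /OO; exact: Oi.
- exact: smooth_sub Vs.
- by move=> z /OO; exact: Vt.
Qed.

(** One direction tests with the constant leaf fields (e, 0). For the other, the bracket with Y has
    two terms: D_V Y stays in the leaf directions since V is tangent to the twistor space, and D_Y V
    does by [leafConstant]. *)
Lemma foliatedZP O V : foliatedZ nab i O V <-> isFieldZ i O V /\ leafConstant O V.
Proof.
split=> [[fV H]|[fV H]]; split=> //.
- have [oO Oi Vs Vt] := fV => z Oz zz e Fe.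
  have fY : isFieldZ i O (cst ((e, 0) : amb R p d)).
    split=> //; first exact: smooth_cst.
    by move=> z' _ _; rewrite /tangentZ /= mul0mx mulmx0 addr0.
  have := H O _ (@subset_refl _ O) fY _ z Oz ((twistor_in Oi Oz).2 zz).
  have F z' : O z' -> twistor i z' -> inFhat nab i z' (cst (e, 0) z').
    by move=> Oz' _; apply/inFhatP => //; exact: Oi.
  move=> /(_ F) /(inFhatP _ (Oi _ Oz)); rewrite /bracket derive_cst sub0r /inF /=.
  move=> [h1 h2]; split; last by apply/eqP; rewrite -oppr_eq0; apply/eqP.
  by apply/eqP; rewrite -oppr_eq0 -linearN; apply/eqP.
- move=> O' Y OO fY FY z O'z tz.
  have [oO Oi Vs Vt] := fV; have [oO' O'i Ys Yt] := fY.
  have zz := (twistor_in O'i O'z).1 tz.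
  have Oz := OO _ O'z.
  apply/(inFhatP _ (O'i _ O'z)); rewrite /bracket.
  have [FYz Yz2] := (inFhatP _ (O'i _ O'z)).1 (FY _ O'z tz).
  have YzE : Y z = ((Y z).1, 0) by rewrite -Yz2 -surjective_pairing.
  have [h1 h2] := H _ Oz zz _ FYz.
  have [l1 l2 l3] := field_total_derivative fY O'z.
  (* The transversal part of Y vanishes only along the twistor space, whence the use of
     [derive_eq_on_twistor]; likewise for the matrix part. *)
  have k1 : dsubmx ('D_(V z) Y z).1 = 0.
    have L : linear (fun u : amb R p d => dsubmx u.1 : 'cV[R]_d).
      by move=> a u v /=; rewrite linearP.
    have sY : smooth O' (transv Y).
      exact: (smooth_lin (L := fun u : amb R p d => dsubmx u.1 : 'cV[R]_d)).
    have := @derive_eq_on_twistor _ (transv Y) (cst 0) O' z (V z) _ _ oO' O'z zz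
       (Vt _ Oz tz) _ (smooth_total_derivative oO' O'z sY)
       (smooth_total_derivative oO' O'z (smooth_cst O' 0)).
    rewrite derive_cst; have [_ ->] := is_derive_transv (field_is_derive (V z) fY O'z).
    apply=> z' O'z' zz'; have tz' := (twistor_in O'i O'z').2 zz'.
    by have [] := (inFhatP _ (O'i _ O'z')).1 (FY _ O'z' tz').
  have k2 : ('D_(V z) Y z).2 = 0.
    have sY : smooth O' (fun z => (Y z).2).
      by apply: (smooth_lin (L := snd)) => //; exact: snd_linear.
    have := @derive_eq_on_twistor _ (fun z => (Y z).2) (cst 0) O' z (V z) _ _ oO' O'z zz
       (Vt _ Oz tz) _ (smooth_total_derivative oO' O'z sY)
       (smooth_total_derivative oO' O'z (smooth_cst O' 0)).
    rewrite derive_cst; have [_ ->] := is_derive_snd (field_is_derive (V z) fY O'z).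
    apply=> z' O'z' zz'; have tz' := (twistor_in O'i O'z').2 zz'.
    by have [] := (inFhatP _ (O'i _ O'z')).1 (FY _ O'z' tz').
  have inF_sub (u v : amb R p d) : dsubmx u.1 = 0 :> 'cV_d -> u.2 = 0 ->
      dsubmx v.1 = 0 :> 'cV_d -> v.2 = 0 -> inF (u - v).1 /\ (u - v).2 = 0.
    by move=> u1 u2 v1 v2; rewrite /inF /= linearB /= u1 u2 v1 v2 !subrr.
  rewrite -YzE in h1 h2.
  exact: (inF_sub _ _ k1 k2 h1 h2).
Qed.

Lemma foliatedZ_sub O O' V : open O' -> O' `<=` O -> foliatedZ nab i O V ->
  foliatedZ nab i O' V.
Proof.
move=> oO' OO /foliatedZP[fV lV]; apply/foliatedZP; split; first exact: isFieldZ_sub fV.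
by move=> z /OO; exact: lV.
Qed.

End TwistorFields.

(** * Structure equations for brackets and the Nijenhuis tensor *)

Section StructureEquations.
Variables (R : realType) (p d : nat) (M : foliatedManifold R p d).
Variables (nab : connection M) (i : chartIdx M).
Implicit Types (z w : amb R p d) (O : set (amb R p d)) (U V W : amb R p d -> amb R p d).
Implicit Types (s : amb R p d -> 'cV[R]_d) (S : amb R p d -> 'M[R]_d).

Lemma open_chart_amb : open [set z : amb R p d | img i z.1].
Proof.
apply: (@open_comp _ _ (@fst (vec R p d) 'M[R]_d)); last exact: img_openP.
by move=> z _; exact: cvg_fst.
Qed.

Lemma is_derive_precomp_fst (E : normedModType R) (f : vec R p d -> E) z w df :
  is_derive z.1 w.1 f df -> is_derive z w (fun z : amb R p d => f z.1) df.
Proof.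
move=> /is_derive_ball H; apply/is_derive_ball => e /H[r r0 rP].
by exists r => // h /rP.
Qed.

Definition covV V z : 'M[R]_d := covJ nab i z (V z).
(* The covariant derivatives of sections of Q^*N F and of Q^*End(N F). *)
Definition covN z w s : 'cV[R]_d := 'D_w s z + conn nab i z.1 w.1 *m s z.
Definition covE z w S : 'M[R]_d :=
  'D_w S z + (conn nab i z.1 w.1 *m S z - S z *m conn nab i z.1 w.1).

Lemma is_derive_conn_amb z w (Y : amb R p d -> vec R p d) dY : img i z.1 ->
  is_derive z w Y dY ->
  is_derive z w (fun y => conn nab i y.1 (Y y))
    ('D_(w.1) (fun y => conn nab i y (Y z)) z.1 + conn nab i z.1 dY).
Proof.
move=> iz Yd.
have H e : is_derive z w (fun y : amb R p d => conn nab i y.1 e)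
    ('D_(w.1) (fun y => conn nab i y e) z.1).
  by apply: (is_derive_precomp_fst (f := fun y => conn nab i y e)); exact: conn_is_derive.
have [_ <-] := H (Y z).
apply: (is_derive_param (U := [set z | img i z.1]) (l := fun y e => conn nab i y.1 e)) => //.
- exact: open_chart_amb.
- by move=> y iy; exact: conn_linear.
Qed.

Lemma is_derive_covV O V z w : isFieldZ i O V -> O z ->
  is_derive z w (covV V) (('D_w V z).2 +
    ((('D_(w.1) (fun y => conn nab i y (V z).1) z.1 + conn nab i z.1 ('D_w V z).1) *m z.2
      + conn nab i z.1 (V z).1 *m w.2)
     - (w.2 *m conn nab i z.1 (V z).1 +
        z.2 *m ('D_(w.1) (fun y => conn nab i y (V z).1) z.1
               + conn nab i z.1 ('D_w V z).1)))).
Proof.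
move=> fV Oz; have [oO Oi Vs Vt] := fV; have Vd := field_is_derive w fV Oz.
have Jd : is_derive z w (fun z : amb R p d => z.2) w.2.
  by apply: is_derive_snd; exact: is_derive_id.
have cd := is_derive_conn_amb (Oi _ Oz) (is_derive_fst Vd).
apply: is_derive_add; first exact: is_derive_snd.
apply: is_derive_add; first exact: is_derive_mulmx.
by apply: is_derive_opp; exact: is_derive_mulmx.
Qed.

(** The definition of the torsion, solved for the bracket and pulled back to Z(F). *)
Lemma transv_bracket O U V z : isFieldZ i O U -> isFieldZ i O V -> O z ->
  transv (bracket U V) z = covN z (U z) (transv V) - covN z (V z) (transv U)
    - torVec nab i z.1 (U z).1 (V z).1.
Proof.
move=> fU fV Oz; rewrite /covN /torVec {1}/transv /bracket.
have [_ ->] := is_derive_transv (field_is_derive (U z) fV Oz).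
have [_ ->] := is_derive_transv (field_is_derive (V z) fU Oz).
rewrite /= linearB /= /transv; zmod.
Qed.

(** The X are the brackets of (IV, IW), (IV, W), (V, IW), (V, W), the P are covariant derivatives,
    the T are torsion or curvature terms, and f', g', f, g are the vertical parts of IV, IW, V, W.
    The width n is 1 for the transversal component and d for the vertical one. *)
Lemma nijenhuis_identity n (J f' g' f g : 'M[R]_d) (a b : 'M[R]_(d, n))
    (X1 X2 X3 X4 P1 P2 P3 P4 P5 P6 P7 P8 T1 T2 T3 T4 : 'M[R]_(d, n)) :
  J *m J = - 1%:M ->
  X1 = P1 - P2 - T1 -> X2 = P3 - P4 - T2 -> X3 = P5 - P6 - T3 -> X4 = P7 - P8 - T4 ->
  P1 = f' *m b + J *m P3 -> P2 = g' *m a + J *m P6 ->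
  P4 = g *m a + J *m P8 -> P5 = f *m b + J *m P7 ->
  X1 - J *m X2 - J *m X3 - X4 = f' *m b - g' *m a + J *m (g *m a) - J *m (f *m b)
    - (T1 - J *m T2 - J *m T3 - T4).
Proof.
move=> JJ -> -> -> -> -> -> -> ->.
have JJX (X : 'M[R]_(d, n)) : J *m (J *m X) = - X by rewrite mulmxA JJ mulNmx mul1mx.
by rewrite !(mulmxDr, mulmxN) !JJX; zmod.
Qed.

Lemma structure_identity (v1 v2 c1 c2 c3 c4 u v U2 V2 J : 'M[R]_d) :
  v1 - v2 + ((c1 - c2) *m J - J *m (c1 - c2)) =
  v1 + ((c3 + c1) *m J + v *m U2 - (U2 *m v + J *m (c3 + c1)))
    + (u *m (V2 + (v *m J - J *m v)) - (V2 + (v *m J - J *m v)) *m u)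
  - (v2 + ((c4 + c2) *m J + u *m V2 - (V2 *m u + J *m (c4 + c2)))
    + (v *m (U2 + (u *m J - J *m u)) - (U2 + (u *m J - J *m u)) *m v))
  - ((c3 - c4 + (u *m v - v *m u)) *m J - J *m (c3 - c4 + (u *m v - v *m u))).
Proof. by rewrite !(mulmxDl, mulmxDr, mulNmx, mulmxN) !mulmxA; zmod. Qed.

(** The vertical part of a field is the covariant derivative of the tautological section J.
    Commuting two such derivatives produces the curvature, which acts on endomorphisms by the
    commutator. *)
Lemma covJ_bracket O U V z : isFieldZ i O U -> isFieldZ i O V -> O z ->
  covJ nab i z (bracket U V z) = covE z (U z) (covV V) - covE z (V z) (covV U)
   - (curvMx nab i z.1 (U z).1 (V z).1 *m z.2 - z.2 *m curvMx nab i z.1 (U z).1 (V z).1).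
Proof.
move=> fU fV Oz; have [_ Oi _ _] := fU.
rewrite /covE.
have [_ ->] := is_derive_covV (U z) fV Oz.
have [_ ->] := is_derive_covV (V z) fU Oz.
rewrite /covV /covJ /bracket /curvMx /=.
have [_ CD _ CN] := linear_facts (conn_linear nab (Oi _ Oz)).
rewrite CD CN.
exact: structure_identity.
Qed.

Lemma covN_mul z w s : derivable s z w ->
  covN z w (fun y => y.2 *m s y) = covJ nab i z w *m s z + z.2 *m covN z w s.
Proof.
move=> /derivableP sd.
have Jd : is_derive z w (fun z : amb R p d => z.2) w.2.
  by apply: is_derive_snd; exact: is_derive_id.
rewrite /covN; have [_ ->] := is_derive_mulmx Jd sd.
rewrite /covJ !(mulmxDl, mulmxDr, mulNmx, mulmxN) !mulmxA; zmod.
Qed.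

Lemma covE_mul z w S : derivable S z w ->
  covE z w (fun y => y.2 *m S y) = covJ nab i z w *m S z + z.2 *m covE z w S.
Proof.
move=> /derivableP sd.
have Jd : is_derive z w (fun z : amb R p d => z.2) w.2.
  by apply: is_derive_snd; exact: is_derive_id.
rewrite /covE; have [_ ->] := is_derive_mulmx Jd sd.
rewrite /covJ !(mulmxDl, mulmxDr, mulNmx, mulmxN) !mulmxA; zmod.
Qed.

Lemma smooth_J O : open O -> smooth O (fun z : amb R p d => z.2).
Proof.
move=> oO; apply: (smooth_lin (L := snd)) => //.
exact: smooth_id.
Qed.

Lemma smooth_transv O V : isFieldZ i O V -> smooth O (transv V).
Proof.
move=> [oO _ Vs _].
apply: (smooth_lin (L := fun u : amb R p d => dsubmx u.1 : 'cV[R]_d)) => //.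
by move=> a u v /=; rewrite linearP.
Qed.

Lemma smooth_conn_amb O (Y : amb R p d -> vec R p d) :
  open O -> (forall z, O z -> img i z.1) -> smooth O Y ->
  smooth O (fun z => conn nab i z.1 (Y z)).
Proof.
move=> oO Oi Ys; apply: (smooth_param (l := fun z e => conn nab i z.1 e)) => //.
  by move=> z Oz; apply: conn_linear; exact: Oi.
move=> e; apply: (smooth_sub (U := fst @^-1` img i)) => //.
by apply: (smooth_precomp (P := fst) (f := fun x => conn nab i x e)); [|exact: conn_smooth].
Qed.

Lemma smooth_opp (E F : normedModType R) (f : E -> F) {fF : finite_coords F} (D : set E) :
  open D -> smooth D f -> smooth D (fun x => - f x).
Proof.
move=> oD fs; apply: (smooth_lin (L := fun y => - y)) => // a x y.
by rewrite opprD scalerN.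
Qed.

Lemma smooth_covV O V : isFieldZ i O V -> smooth O (covV V).
Proof.
move=> [oO Oi Vs _].
have s1 : smooth O (fun z => (V z).1).
  by apply: (smooth_lin (L := fst)) => //; exact: fst_linear.
have s2 : smooth O (fun z => (V z).2).
  by apply: (smooth_lin (L := snd)) => //; exact: snd_linear.
have sJ := smooth_J oO; have sc := smooth_conn_amb oO Oi s1.
apply: smooth_add => //; apply: smooth_add => //; first exact: smooth_mulmx.
by apply: smooth_opp => //; exact: smooth_mulmx.
Qed.

(** The relation between IV and V is known only on the twistor space, so it is differentiated in the
    tangent direction w; the covariant derivative of J along w is [covJ]. *)
Lemma covN_I O V IV z w : isFieldZ i O V -> isFieldZ i O IV ->
  (forall y, O y -> y.2 *m y.2 = - 1%:M -> transv IV y = y.2 *m transv V y) ->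
  O z -> z.2 *m z.2 = - 1%:M -> tangentZ z w ->
  covN z w (transv IV) = covJ nab i z w *m transv V z + z.2 *m covN z w (transv V).
Proof.
move=> fV fIV H Oz zz zw; have [oO _ _ _] := fV.
have sV := smooth_transv fV.
rewrite -covN_mul; last by have [] := smooth_is_derive w sV Oz.
have sJV : smooth O (fun y => y.2 *m transv V y) by apply: smooth_mulmx => //; exact: smooth_J.
have E := derive_eq_on_twistor oO Oz zz zw H
  (smooth_total_derivative oO Oz (smooth_transv fIV)) (smooth_total_derivative oO Oz sJV).
by rewrite /covN {}E (H z Oz zz).
Qed.

Lemma covE_I O V IV z w : isFieldZ i O V -> isFieldZ i O IV ->
  (forall y, O y -> y.2 *m y.2 = - 1%:M -> covV IV y = y.2 *m covV V y) ->
  O z -> z.2 *m z.2 = - 1%:M -> tangentZ z w ->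
  covE z w (covV IV) = covJ nab i z w *m covV V z + z.2 *m covE z w (covV V).
Proof.
move=> fV fIV H Oz zz zw; have [oO _ _ _] := fV.
have sV := smooth_covV fV.
rewrite -covE_mul; last by have [] := smooth_is_derive w sV Oz.
have sJV : smooth O (fun y => y.2 *m covV V y) by apply: smooth_mulmx => //; exact: smooth_J.
have E := derive_eq_on_twistor oO Oz zz zw H
  (smooth_total_derivative oO Oz (smooth_covV fIV)) (smooth_total_derivative oO Oz sJV).
by rewrite /covE {}E (H z Oz zz).
Qed.

Section Nijenhuis.
Variables (O : set (amb R p d)) (V W IV IW : amb R p d -> amb R p d).
Hypotheses (fV : isFieldZ i O V) (fW : isFieldZ i O W).
Hypotheses (fIV : isFieldZ i O IV) (fIW : isFieldZ i O IW).
Hypothesis hIV : forall y, O y -> y.2 *m y.2 = - 1%:M -> transv IV y = y.2 *m transv V y.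
Hypothesis hIW : forall y, O y -> y.2 *m y.2 = - 1%:M -> transv IW y = y.2 *m transv W y.

Let tor z (U U' : amb R p d -> amb R p d) := torVec nab i z.1 (U z).1 (U' z).1.
Let curvJ z (U U' : amb R p d -> amb R p d) :=
  curvMx nab i z.1 (U z).1 (U' z).1 *m z.2 - z.2 *m curvMx nab i z.1 (U z).1 (U' z).1.

Lemma tangent_field U z : isFieldZ i O U -> O z -> z.2 *m z.2 = - 1%:M -> tangentZ z (U z).
Proof. by move=> [oO Oi _ Ut] Oz zz; apply: Ut => //; split=> //; exact: Oi. Qed.

(** Only the transversal relation is assumed, which I_1 and I_2 share. The terms with [covV] are the
    mixed part. *)
Lemma nijenhuis_transv z : O z -> z.2 *m z.2 = - 1%:M ->
  transv (bracket IV IW) z - z.2 *m transv (bracket IV W) z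
    - z.2 *m transv (bracket V IW) z - transv (bracket V W) z =
  covV IV z *m transv W z - covV IW z *m transv V z
    + z.2 *m (covV W z *m transv V z) - z.2 *m (covV V z *m transv W z)
    - (tor z IV IW - z.2 *m tor z IV W - z.2 *m tor z V IW - tor z V W).
Proof.
move=> Oz zz; have T U fU := @tangent_field U z fU Oz zz.
exact: (nijenhuis_identity zz (transv_bracket fIV fIW Oz) (transv_bracket fIV fW Oz)
  (transv_bracket fV fIW Oz) (transv_bracket fV fW Oz)
  (covN_I fW fIW hIW Oz zz (T _ fIV)) (covN_I fV fIV hIV Oz zz (T _ fIW))
  (covN_I fV fIV hIV Oz zz (T _ fW)) (covN_I fW fIW hIW Oz zz (T _ fV))).
Qed.

(** With A and B the vertical parts of V and W, the mixed terms are J A B - J B A + J B A - J A B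
    for I_1, and cancel. *)
Lemma nijenhuis_covJ z : O z -> z.2 *m z.2 = - 1%:M ->
  (forall y, O y -> y.2 *m y.2 = - 1%:M -> covV IV y = y.2 *m covV V y) ->
  (forall y, O y -> y.2 *m y.2 = - 1%:M -> covV IW y = y.2 *m covV W y) ->
  covJ nab i z (bracket IV IW z) - z.2 *m covJ nab i z (bracket IV W z)
    - z.2 *m covJ nab i z (bracket V IW z) - covJ nab i z (bracket V W z) =
  - (curvJ z IV IW - z.2 *m curvJ z IV W - z.2 *m curvJ z V IW - curvJ z V W).
Proof.
move=> Oz zz vIV vIW; have T U fU := @tangent_field U z fU Oz zz.
have E := nijenhuis_identity zz (covJ_bracket fIV fIW Oz) (covJ_bracket fIV fW Oz)
  (covJ_bracket fV fIW Oz) (covJ_bracket fV fW Oz)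
  (covE_I fW fIW vIW Oz zz (T _ fIV)) (covE_I fV fIV vIV Oz zz (T _ fIW))
  (covE_I fV fIV vIV Oz zz (T _ fW)) (covE_I fW fIW vIW Oz zz (T _ fV)).
apply: etrans E _; rewrite -/(covV IV z) -/(covV IW z) -/(covV V z) -/(covV W z).
rewrite (vIV z Oz zz) (vIW z Oz zz).
rewrite -/(curvJ z IV IW) -/(curvJ z IV W) -/(curvJ z V IW) -/(curvJ z V W).
by rewrite -!mulmxA; zmod.
Qed.

End Nijenhuis.
End StructureEquations.

(** * Projectability of I_2 as a condition along the leaves *)

Section Projectability.
Variables (R : realType) (p d : nat) (M : foliatedManifold R p d).
Variables (nab : connection M) (i : chartIdx M).
Hypothesis adap : adapted nab.
Implicit Types (z w : amb R p d) (O : set (amb R p d)) (U V W : amb R p d -> amb R p d).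
Implicit Types (J S : 'M[R]_d) (a b : 'cV[R]_d).

Local Notation transStr := (amb R p d -> 'cV[R]_d * 'M[R]_d -> 'cV[R]_d * 'M[R]_d).

Lemma projectable_field (I : transStr) O V z : projectable nab I -> foliatedZ nab i O V ->
  O z -> z.2 *m z.2 = - 1%:M ->
  exists Q IV, [/\ Q z, Q `<=` O, foliatedZ nab i Q IV
    & forall z', Q z' -> z'.2 *m z'.2 = - 1%:M ->
        I z' (toN nab i z' (V z')) = toN nab i z' (IV z')].
Proof.
move=> pI fV Oz zz; have [[oO Oi Vs Vt] _] := fV.
have H : foliatedSection nab i O (fun z => toN nab i z (V z)).
  by move=> y Oy ty; exists O, V; split.
have [Q [IV [Qz QO fIV IVE]]] := pI i O _ oO Oi H z Oz ((twistor_in Oi Oz).2 zz).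
exists Q, IV; split=> // z' Qz' zz'; apply: IVE => //.
exact: (conj (Oi _ (QO _ Qz')) zz').
Qed.

(* The vertical part [S J - J S] runs through all vertical vectors at J. *)
Definition test_field a S : amb R p d -> amb R p d :=
  fun z => (embN p a, S *m z.2 - z.2 *m S).

Lemma foliated_test_field a S : foliatedZ nab i [set z | img i z.1] (test_field a S).
Proof.
have oO := @open_chart_amb R p d M i.
have sJ := smooth_J oO.
have Vs : smooth [set z | img i z.1] (test_field a S).
  apply: smooth_pair => //; first exact: (smooth_cst _ (embN p a)).
  apply: smooth_add => //; first by apply: smooth_mulmx => //; exact: (smooth_cst _ S).
  by apply: smooth_opp => //; apply: smooth_mulmx => //; exact: (smooth_cst _ S).
apply/(foliatedZP i adap); split.
  split=> // z iz [_ zz]; rewrite /tangentZ /= mulmxBl mulmxBr !mulmxA zz -!mulmxA zz.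
  by rewrite mulNmx mulmxN mulmx1 mul1mx; zmod.
move=> z iz zz e Fe.
have Jd : is_derive z ((e, 0) : amb R p d) (fun z : amb R p d => z.2) 0.
  by apply: (is_derive_snd (df := ((e, 0) : amb R p d))); exact: is_derive_id.
have Vd : is_derive z ((e, 0) : amb R p d) (test_field a S) (0, 0).
  rewrite /test_field; apply: is_derive_pair.
  apply: (is_derive_eq (is_derive_add (is_derive_mulmx (is_derive_cst S z _) Jd)
    (is_derive_opp (is_derive_mulmx Jd (is_derive_cst S z _))))).
  by rewrite !(mul0mx, mulmx0) !addr0 subr0.
by case: Vd => _ ->; rewrite /= linear0.
Qed.

Lemma toN_test_field a z : img i z.1 -> toN nab i z (test_field a 0 z) =
  (a, conn nab i z.1 (embN p a) *m z.2 - z.2 *m conn nab i z.1 (embN p a)).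
Proof.
by move=> iz; rewrite /toN /covJ /test_field /= embNK mul0mx mulmx0 subrr add0r.
Qed.

(** The image under I_2 of the class of a constant field has a foliated lift V. Its matrix component
    is forced by the connection form and must be constant along the leaf; the condition is the
    derivative of this formula along e. *)
Lemma leaf_condition_I2 x e a J : projectable nab (@I2 R p d) ->
  img i x -> inF e -> J *m J = - 1%:M ->
  let B b := 'D_e (fun y => conn nab i y (embN p b)) x in
  J *m B a *m J + B a + B (J *m a) *m J - J *m B (J *m a) = 0.
Proof.
move=> pI ix Fe JJ B.
have [Q [V [Qz QO fV VE]]] :=
  projectable_field (z := (x, J)) pI (foliated_test_field a 0) ix JJ.
have [fV' lV] := (foliatedZP i adap _ _).1 fV; have [oQ Qi _ _] := fV'.
pose w : amb R p d := (e, 0).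
(* The points (x + h e, J) lie in the twistor space, so the matrix component of V is determined
   there. *)
have V2E h : Q ((x, J) + h *: w) -> (V ((x, J) + h *: w)).2 =
   - (J *m (conn nab i (x + h *: e) (embN p a) *m J - J *m conn nab i (x + h *: e) (embN p a)))
   - (conn nab i (x + h *: e) (embN p (J *m a)) *m J
       - J *m conn nab i (x + h *: e) (embN p (J *m a))).
  move=> Oh; have ih := Qi _ Oh.
  have := VE _ Oh; rewrite toN_test_field// /I2 /toN /covJ /= scaler0 addr0 => /(_ JJ) [E1 E2].
  have E3 : conn nab i (x + h *: e) (V ((x, J) + h *: w)).1 =
      conn nab i (x + h *: e) (embN p (J *m a)).
    by rewrite E1 conn_embN.
  have {}E2 : (V ((x, J) + h *: w)).2 + (conn nab i (x + h *: e) (embN p (J *m a)) *m J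
       - J *m conn nab i (x + h *: e) (embN p (J *m a))) =
     - (J *m (conn nab i (x + h *: e) (embN p a) *m J - J *m conn nab i (x + h *: e) (embN p a))).
    by rewrite -E3 E2.
  by rewrite -E2 addrK.
have [r r0 rP] : exists2 r, 0 < r & forall h, `|h| < r -> Q ((x, J) + h *: w).
  have [r r0 rP] := (near_ballP _ _).1 (open_nbhs_nbhs (conj oQ Qz)).
  have w1 : 0 < `|w| + 1 by rewrite ltr_wpDl.
  exists (r / (`|w| + 1)) => [|h]; first exact: divr_gt0.
  rewrite ltr_pdivlMr// => hr; apply: rP; rewrite addrAC subrr add0r normrZ.
  by rewrite (le_lt_trans _ hr)// ler_wpM2l// lerDl.
have gd : is_derive (x, J) w (fun z : amb R p d =>
   - (J *m (conn nab i z.1 (embN p a) *m J - J *m conn nab i z.1 (embN p a)))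
   - (conn nab i z.1 (embN p (J *m a)) *m J - J *m conn nab i z.1 (embN p (J *m a))))
   (- (J *m (B a *m J - J *m B a)) - (B (J *m a) *m J - J *m B (J *m a))).
  have c b : is_derive (x, J) w (fun z : amb R p d => conn nab i z.1 (embN p b)) (B b).
    by apply: (is_derive_precomp_fst (f := fun y => conn nab i y (embN p b))); exact: conn_is_derive.
  have L1 (G : amb R p d -> 'M[R]_d) dG : is_derive (x, J) w G dG ->
      is_derive (x, J) w (fun z => G z *m J - J *m G z) (dG *m J - J *m dG).
    move=> Gd; apply: (is_derive_lin (L := fun X => X *m J - J *m X)) => // k X Y.
    rewrite mulmxDl mulmxDr -scalemxAl -scalemxAr scalerBr; zmod.
  exact: (is_derive_add (is_derive_opp (is_derive_lin (mulmx_linearr J) (L1 _ _ (c a))))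
    (is_derive_opp (L1 _ _ (c (J *m a))))).
have Vd : is_derive (x, J) w (fun z => (V z).2) 0.
  have [_ <-] := lV _ Qz JJ e Fe.
  exact: is_derive_snd (field_is_derive w fV' Qz).
have Vd' : is_derive (x, J) w (fun z => (V z).2)
    (- (J *m (B a *m J - J *m B a)) - (B (J *m a) *m J - J *m B (J *m a))).
  by apply: (is_derive_line_eq r0 _ gd) => h /rP/V2E.
have E : - (J *m (B a *m J - J *m B a)) - (B (J *m a) *m J - J *m B (J *m a)) = 0.
  by case: Vd' => _ <-; case: Vd.
apply: oppr_inj; rewrite oppr0 -E.
by rewrite !(mulmxDl, mulmxDr, mulNmx, mulmxN) !mulmxA JJ !(mulNmx, mul1mx); zmod.
Qed.
End Projectability.

(** * Curvature along the leaves and the foliated lift of I_1 *)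

Section CurvatureForms.
Variables (R : realType) (p d : nat) (M : foliatedManifold R p d).
Variables (nab : connection M) (i : chartIdx M).
Implicit Types (x v w e : vec R p d).
Local Notation Om := (curvMx nab i).

Lemma curvMxC x v w : Om x v w = - Om x w v.
Proof. rewrite /curvMx; zmod. Qed.

Lemma curvMx_linearr x v : img i x -> linear (Om x v).
Proof.
move=> ix a w w'; rewrite /curvMx.
have lD : linear (fun u => 'D_u (fun y => conn nab i y v) x).
  exact: smooth_linear (@img_openP R p d M i) ix (conn_smooth nab i v).
have cl := conn_linear nab ix.
have H : is_derive x v (fun y => conn nab i y (a *: w + w'))
   (a *: 'D_v (fun y => conn nab i y w) x + 'D_v (fun y => conn nab i y w') x).
  apply: (near_eq_smooth_derive (U := img i)
    (f := fun y => a *: conn nab i y w + conn nab i y w')) => //.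
  - exact: img_openP.
  - by move=> y iy; rewrite (conn_linear nab iy).
  - apply: is_derive_add; last exact: conn_is_derive.
    apply: (is_derive_lin (L := fun X : 'M[R]_d => a *: X)); last exact: conn_is_derive.
    by move=> k X Y; rewrite scalerDr !scalerA mulrC.
case: H => _ ->; rewrite lD cl !(mulmxDl, mulmxDr) -!scalemxAl -!scalemxAr.
rewrite !(scalerDr, scalerN). zmod.
Qed.

Lemma curvMx_linearl x w : img i x -> linear (fun v => Om x v w).
Proof.
move=> ix a v v'; rewrite curvMxC (curvMx_linearr w ix) opprD -scalerN.
by rewrite -!curvMxC.
Qed.

Hypothesis adap : adapted nab.

(** The connection form of e vanishes on the whole chart image, hence so do its derivatives, and a
    single term survives. *)
Lemma curvMx_leaf x e w : img i x -> inF e ->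
  Om x e w = 'D_e (fun y => conn nab i y w) x.
Proof.
move=> ix Fe; rewrite /curvMx (conn_inF adap ix Fe) mul0mx mulmx0 [0 - 0]subrr addr0.
suff H : is_derive x w (fun y => conn nab i y e) 0 by case: H => _ ->; rewrite subr0.
apply: (near_eq_smooth_derive (U := img i) (f := cst 0)) => //; first exact: img_openP.
by move=> y iy; rewrite (conn_inF adap iy Fe).
Qed.

Lemma curvMx_leaf_embN x e w : img i x -> inF e -> Om x e w = Om x e (embN p (dsubmx w)).
Proof.
move=> ix Fe; rewrite (curvMx_leaf w ix Fe) (curvMx_leaf (embN p (dsubmx w)) ix Fe).
have H : is_derive x e (fun y => conn nab i y (embN p (dsubmx w)))
    ('D_e (fun y => conn nab i y w) x).
  apply: (near_eq_smooth_derive (U := img i) (f := fun y => conn nab i y w)) => //.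
  - exact: img_openP.
  - by move=> y iy; rewrite conn_embN.
  - exact: conn_is_derive.
case: H => _ /esym; exact.
Qed.

Lemma torVec_embN x v w : img i x ->
  torVec nab i x v w = torVec nab i x (embN p (dsubmx v)) (embN p (dsubmx w)).
Proof. by move=> ix; rewrite /torVec !conn_embN// !embNK. Qed.

Definition leafScalar := forall x e w, img i x -> inF e -> exists l, Om x e w = l%:M.

Hypothesis leafS : leafScalar.

Lemma commutator_split (A A1 A2 A3 A4 J : 'M[R]_d) :
  A = A1 + A2 -> A2 = A3 + A4 -> A1 *m J = J *m A1 -> A3 *m J = J *m A3 ->
  A *m J - J *m A = A4 *m J - J *m A4.
Proof. by move=> -> -> E1 E3; rewrite !(mulmxDl, mulmxDr) E1 E3; zmod. Qed.

(** Replacing v and w by their transversal parts changes the curvature by scalars, which a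
    commutator does not see. *)
Lemma curvMx_comm x v w J : img i x ->
  Om x v w *m J - J *m Om x v w =
  Om x (embN p (dsubmx v)) (embN p (dsubmx w)) *m J
    - J *m Om x (embN p (dsubmx v)) (embN p (dsubmx w)).
Proof.
move=> ix.
have [_ Dl _ _] := linear_facts (curvMx_linearl w ix).
have [_ Dr _ _] := linear_facts (curvMx_linearr (embN p (dsubmx v)) ix).
have cl : Om x (v - embN p (dsubmx v)) w *m J = J *m Om x (v - embN p (dsubmx v)) w.
  by have [l ->] := leafS w ix (inF_sub_embN v); rewrite scalar_mxC.
have cr : Om x (embN p (dsubmx v)) (w - embN p (dsubmx w)) *m J =
    J *m Om x (embN p (dsubmx v)) (w - embN p (dsubmx w)).
  rewrite curvMxC mulNmx mulmxN.
  by have [l ->] := leafS (embN p (dsubmx v)) ix (inF_sub_embN w); rewrite scalar_mxC.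
have E1 := Dl (v - embN p (dsubmx v)) (embN p (dsubmx v)); rewrite subrK in E1.
have E2 := Dr (w - embN p (dsubmx w)) (embN p (dsubmx w)); rewrite subrK in E2.
exact: commutator_split E1 E2 cl cr.
Qed.

Lemma leaf_conn_comm x e w (J : 'M[R]_d) : img i x -> inF e ->
  'D_e (fun y => conn nab i y w) x *m J = J *m 'D_e (fun y => conn nab i y w) x.
Proof.
by move=> ix Fe; rewrite -curvMx_leaf//; have [l ->] := leafS w ix Fe; rewrite scalar_mxC.
Qed.

(** The subtracted commutator compensates the connection term of [covJ], so that the vertical part
    becomes J times that of V. *)
Definition lift_I1 (V : amb R p d -> amb R p d) : amb R p d -> amb R p d :=
  fun z => let a := embN p (z.2 *m transv V z) in
  (a, z.2 *m covV nab i V z - (conn nab i z.1 a *m z.2 - z.2 *m conn nab i z.1 a)).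

(** Along a leaf only the connection form varies, and by [leafScalar] its derivative commutes with J
    and drops out of the commutators. This is why I_1 is projectable as soon as I_2 is. *)
Lemma foliated_lift_I1 O V : foliatedZ nab i O V -> foliatedZ nab i O (lift_I1 V).
Proof.
move=> /(foliatedZP i adap)[fV lV]; have [oO Oi Vs Vt] := fV.
have sJ := smooth_J oO.
have sa : smooth O (fun z => embN p (z.2 *m transv V z)).
  apply: (smooth_lin (L := embN p)) => //; first exact: embN_linear.
  by apply: smooth_mulmx => //; exact: smooth_transv fV.
have sc := smooth_conn_amb nab oO Oi sa.
have s2 := smooth_covV nab fV.
apply/(foliatedZP i adap); split.
  split=> //.
    apply: smooth_pair => //; apply: smooth_add => //; first exact: smooth_mulmx.
    apply: smooth_opp => //; apply: smooth_add => //; first exact: smooth_mulmx.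
    by apply: smooth_opp => //; exact: smooth_mulmx.
  move=> z Oz tz; have [iz zz] := tz; rewrite /tangentZ /lift_I1 /=.
  set c := conn _ _ _ _.
  have cA : covV nab i V z *m z.2 = - (z.2 *m covV nab i V z).
    apply/eqP; rewrite -addr_eq0; apply/eqP; rewrite /covV /covJ.
    have {1}<- := Vt _ Oz tz; rewrite /=.
    rewrite !(mulmxDl, mulmxDr, mulNmx, mulmxN) !mulmxA zz -!mulmxA zz.
    by rewrite !(mulmxN, mulNmx, mulmx1, mul1mx); zmod.
  move: (covV nab i V z) c cA => C c cA.
  rewrite !(mulmxDl, mulmxDr, mulNmx, mulmxN) -!mulmxA cA zz !mulmxA zz.
  by rewrite !(mulmxN, mulNmx, mulmx1, mul1mx) mulmxA zz mulNmx mul1mx; zmod.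
move=> z Oz zz e Fe; have iz := Oi _ Oz.
have [h1 h2] := lV _ Oz zz e Fe.
pose w : amb R p d := (e, 0).
have Jd : is_derive z w (fun z : amb R p d => z.2) 0.
  by apply: (is_derive_snd (df := w)); exact: is_derive_id.
have ad : is_derive z w (fun z => embN p (z.2 *m transv V z)) 0.
  have H := is_derive_mulmx Jd (is_derive_transv (field_is_derive w fV Oz)).
  rewrite h1 mul0mx mulmx0 addr0 in H.
  apply: is_derive_eq (is_derive_lin (@embN_linear R p d) H) _.
  by rewrite /embN col_mx0.
have c0 : conn nab i z.1 0 = 0 by have [] := linear_facts (conn_linear nab iz).
have cd : is_derive z w (covV nab i V) 0.
  apply: is_derive_eq (is_derive_covV nab w fV Oz) _.
  rewrite h2 /= (conn_inF adap iz h1) !addr0 mulmx0 mul0mx add0r addr0.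
  by rewrite add0r (leaf_conn_comm _ _ iz Fe) subrr.
have Cd := is_derive_conn_amb nab iz ad.
rewrite c0 addr0 /= in Cd.
have Vd : is_derive z w (lift_I1 V) (0, 0).
  apply: is_derive_pair.
  apply: is_derive_eq (is_derive_add (is_derive_mulmx Jd cd) (is_derive_opp
    (is_derive_add (is_derive_mulmx Cd Jd) (is_derive_opp (is_derive_mulmx Jd Cd))))) _.
  by rewrite !(mulmx0, mul0mx) !addr0 !add0r leaf_conn_comm// subrr oppr0.
by case: Vd => _ ->; rewrite linear0.
Qed.

Lemma toN_lift_I1 V z : toN nab i z (lift_I1 V z) = I1 z (toN nab i z (V z)).
Proof. by rewrite /toN /lift_I1 /covJ /= embNK subrK. Qed.

Lemma foliatedSection_I1 O s : foliatedSection nab i O s ->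
  foliatedSection nab i O (fun z => I1 z (s z)).
Proof.
move=> H z Oz tz; have [Q [V [Qz QO fV sV]]] := H z Oz tz.
exists Q, (lift_I1 V); split; [exact: Qz|exact: QO|exact: foliated_lift_I1|].
move=> z' Qz' tz'.
exact: etrans (f_equal (I1 z') (sV z' Qz' tz')) (esym (toN_lift_I1 V z')).
Qed.

End CurvatureForms.

(** * Integrability as pointwise conditions on torsion and curvature *)

Section NijenhuisConditions.
Variables (R : realType) (p d : nat) (M : foliatedManifold R p d).
Variables (nab : connection M) (i : chartIdx M).
Hypothesis adap : adapted nab.
Implicit Types (x : vec R p d) (J S : 'M[R]_d) (a b : 'cV[R]_d).

Definition torN x a b := torVec nab i x (embN p a) (embN p b).
Definition curvN x a b := curvMx nab i x (embN p a) (embN p b).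

Definition torsionCond x J := forall a b,
  torN x (J *m a) (J *m b) - J *m torN x (J *m a) b - J *m torN x a (J *m b) - torN x a b = 0.

Definition curvatureCond x J :=
  let C a b := curvN x a b *m J - J *m curvN x a b in
  forall a b, C (J *m a) (J *m b) - J *m C (J *m a) b - J *m C a (J *m b) - C a b = 0.

(** The mixed part for I_1, where the vertical parts of IV and IW are J f and J g. *)
Lemma cancel_cov n (f g J : 'M[R]_d) (a b X : 'M[R]_(d, n)) :
  J *m f *m b - J *m g *m a + J *m (g *m a) - J *m (f *m b) - X = - X.
Proof. by rewrite -!mulmxA; zmod. Qed.

Section LeafScalar.
Hypothesis leafS : leafScalar nab i.

Lemma sliceNijenhuis0_I1 :
  (forall x J, img i x -> J *m J = - 1%:M -> torsionCond x J /\ curvatureCond x J) ->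
  sliceNijenhuis0 nab i (@I1 R p d).
Proof.
move=> H O V W IV IW /(foliatedZP i adap)[fV _] /(foliatedZP i adap)[fW _].
move=> /(foliatedZP i adap)[fIV _] /(foliatedZP i adap)[fIW _] hV hW z Oz tz.
have [_ Oi _ _] := fV; have [iz zz] := tz; have [cT cR] := H _ _ iz zz.
have tw y : O y -> y.2 *m y.2 = - 1%:M -> twistor i y by move=> Oy; split=> //; exact: Oi.
have V1 y : O y -> y.2 *m y.2 = - 1%:M -> transv IV y = y.2 *m transv V y.
  by move=> Oy yy; have := f_equal fst (hV y Oy (tw y Oy yy)).
have V2 y : O y -> y.2 *m y.2 = - 1%:M -> covV nab i IV y = y.2 *m covV nab i V y.
  by move=> Oy yy; have := f_equal snd (hV y Oy (tw y Oy yy)).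
have W1 y : O y -> y.2 *m y.2 = - 1%:M -> transv IW y = y.2 *m transv W y.
  by move=> Oy yy; have := f_equal fst (hW y Oy (tw y Oy yy)).
have W2 y : O y -> y.2 *m y.2 = - 1%:M -> covV nab i IW y = y.2 *m covV nab i W y.
  by move=> Oy yy; have := f_equal snd (hW y Oy (tw y Oy yy)).
apply: injective_projections => /=.
  apply: etrans (nijenhuis_transv nab fV fW fIV fIW V1 W1 Oz zz) _.
  rewrite (V2 z Oz zz) (W2 z Oz zz); apply: etrans (cancel_cov _ _ _ _ _ _) _.
  rewrite (torVec_embN adap (IV z).1 (IW z).1 iz) (torVec_embN adap (IV z).1 (W z).1 iz).
  rewrite (torVec_embN adap (V z).1 (IW z).1 iz) (torVec_embN adap (V z).1 (W z).1 iz).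
  rewrite -/(transv IV z) -/(transv IW z) -/(transv V z) -/(transv W z).
  by rewrite (V1 z Oz zz) (W1 z Oz zz) -oppr0; congr (- _); exact: cT.
apply: etrans (nijenhuis_covJ fV fW fIV fIW Oz zz V2 W2) _.
rewrite (curvMx_comm leafS (IV z).1 (IW z).1 z.2 iz).
rewrite (curvMx_comm leafS (IV z).1 (W z).1 z.2 iz).
rewrite (curvMx_comm leafS (V z).1 (IW z).1 z.2 iz).
rewrite (curvMx_comm leafS (V z).1 (W z).1 z.2 iz).
rewrite -/(transv IV z) -/(transv IW z) -/(transv V z) -/(transv W z).
by rewrite (V1 z Oz zz) (W1 z Oz zz) -oppr0; congr (- _); exact: cR.
Qed.

(** Constant transversal fields and their explicit lifts realize every pair a, b at every point of
    the twistor space. *)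
Lemma sliceNijenhuis0_I1_cond x J : sliceNijenhuis0 nab i (@I1 R p d) ->
  img i x -> J *m J = - 1%:M -> torsionCond x J /\ curvatureCond x J.
Proof.
move=> N ix JJ; suff H a b :
  torN x (J *m a) (J *m b) - J *m torN x (J *m a) b - J *m torN x a (J *m b)
    - torN x a b = 0 /\
  (let C a b := curvN x a b *m J - J *m curvN x a b in
   C (J *m a) (J *m b) - J *m C (J *m a) b - J *m C a (J *m b) - C a b = 0).
  by split=> [a b|C a b]; have [] := H a b.
pose V := (test_field a 0 : amb R p d -> amb R p d); pose W := (test_field b 0 : amb R p d -> amb R p d).
have fV := foliated_test_field i adap a 0; have fW := foliated_test_field i adap b 0.
have fIV := foliated_lift_I1 adap leafS fV; have fIW := foliated_lift_I1 adap leafS fW.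
set O := [set z : amb R p d | img i z.1] in fV fW fIV fIW.
have Oz : O (x, J) by [].
have NE := N O V W _ _ fV fW fIV fIW (fun z _ _ => toN_lift_I1 nab i V z)
  (fun z _ _ => toN_lift_I1 nab i W z) (x, J) Oz (conj ix JJ).
have [gV _] := (foliatedZP i adap _ _).1 fV; have [gW _] := (foliatedZP i adap _ _).1 fW.
have [gIV _] := (foliatedZP i adap _ _).1 fIV; have [gIW _] := (foliatedZP i adap _ _).1 fIW.
have t1 U y : O y -> y.2 *m y.2 = - 1%:M -> transv (lift_I1 nab i U) y = y.2 *m transv U y.
  by move=> _ _; rewrite /transv embNK.
have t2 U y : O y -> y.2 *m y.2 = - 1%:M ->
    covV nab i (lift_I1 nab i U) y = y.2 *m covV nab i U y.
  by move=> _ _; rewrite /covV /covJ subrK.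
have Va : transv V (x, J) = a by rewrite /transv embNK.
have Wb : transv W (x, J) = b by rewrite /transv embNK.
have E1 := nijenhuis_transv nab gV gW gIV gIW (t1 V) (t1 W) Oz JJ.
have E2 := nijenhuis_covJ gV gW gIV gIW Oz JJ (t2 V) (t2 W).
have N1 := f_equal fst NE; have N2 := f_equal snd NE.
rewrite (t2 V _ Oz JJ) (t2 W _ Oz JJ) in E1.
have {}E1 := etrans (esym (etrans E1 (cancel_cov _ _ _ _ _ _))) N1.
have {}E2 := etrans (esym E2) N2.
split; apply: oppr_inj; rewrite oppr0.
  by apply: etrans _ E1; rewrite /= -/V -/W Va Wb.
by apply: etrans _ E2; rewrite /= -/V -/W Va Wb.
Qed.

End LeafScalar.

(** V has no transversal part, so the torsion terms vanish. The sign in I_2 makes the two mixed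
    terms add up instead of cancelling, which leaves - 2 J [S, J] b. *)
Lemma sliceNijenhuis0_I2_false x J S b : projectable nab (@I2 R p d) ->
  sliceNijenhuis0 nab i (@I2 R p d) ->
  img i x -> J *m J = - 1%:M -> J *m ((S *m J - J *m S) *m b) = 0.
Proof.
move=> pI N ix JJ.
pose V := test_field (p := p) (0 : 'cV[R]_d) S; pose W := (test_field b 0 : amb R p d -> amb R p d).
have fV := foliated_test_field i adap 0 S; have fW := foliated_test_field i adap b 0.
have Oz : [set z : amb R p d | img i z.1] (x, J) by [].
have [Q [IV [Qz QO fIV hIV]]] := projectable_field pI fV Oz JJ.
have [Q' [IW [Q'z Q'O fIW hIW]]] := projectable_field pI fW Oz JJ.
have [[oQ _ _ _] _] := fIV; have [[oQ' _ _ _] _] := fIW.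
pose O := Q `&` Q'.
have oO : open O by exact: openI.
have {}Oz : O (x, J) by split.
have {}fV := foliatedZ_sub adap oO (fun z h => QO z h.1) fV.
have {}fW := foliatedZ_sub adap oO (fun z h => Q'O z h.2) fW.
have {}fIV := foliatedZ_sub adap oO (fun z h => h.1) fIV.
have {}fIW := foliatedZ_sub adap oO (fun z h => h.2) fIW.
have NE := N O V W IV IW fV fW fIV fIW (fun z h t => esym (hIV z h.1 t.2))
  (fun z h t => esym (hIW z h.2 t.2)) (x, J) Oz (conj ix JJ).
have [gV _] := (foliatedZP i adap _ _).1 fV; have [gW _] := (foliatedZP i adap _ _).1 fW.
have [gIV _] := (foliatedZP i adap _ _).1 fIV; have [gIW _] := (foliatedZP i adap _ _).1 fIW.
have t1 y : O y -> y.2 *m y.2 = - 1%:M -> transv IV y = y.2 *m transv V y.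
  by move=> h yy; have := f_equal fst (hIV y h.1 yy).
have t2 y : O y -> y.2 *m y.2 = - 1%:M -> transv IW y = y.2 *m transv W y.
  by move=> h yy; have := f_equal fst (hIW y h.2 yy).
have Va : transv V (x, J) = 0 by rewrite /transv embNK.
have Wb : transv W (x, J) = b by rewrite /transv embNK.
have IVa : transv IV (x, J) = 0 by rewrite (t1 _ Oz JJ) Va mulmx0.
have c1 : covV nab i V (x, J) = S *m J - J *m S.
  by rewrite /covV /covJ /= (conn_inF adap ix) ?mul0mx ?mulmx0 ?subr0 ?addr0// /inF embNK.
have c2 : covV nab i IV (x, J) = - (J *m (S *m J - J *m S)).
  by rewrite -c1; exact: esym (f_equal snd (hIV _ Oz.1 JJ)).
have tor0 v w : dsubmx v = 0 :> 'cV_d -> torVec nab i x v w = 0.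
  by move=> v0; rewrite /torVec v0 mulmx0 (conn_inF adap ix v0) mul0mx subrr.
have E1 := nijenhuis_transv nab gV gW gIV gIW t1 t2 Oz JJ.
have N1 := f_equal fst NE.
have {}E1 := etrans (esym E1) N1.
rewrite Va Wb c1 c2 /= in E1.
rewrite !(tor0 (IV (x, J)).1)// !(tor0 (V (x, J)).1)// in E1.
rewrite !mulmx0 !subr0 addr0 mulNmx -mulmxA in E1.
move: E1; move: (J *m (_ *m b)) => X E1.
have : 2 *: X = 0.
  by apply: oppr_inj; rewrite oppr0 -E1 scaler_nat mulr2n opprD.
by move=> /eqP; rewrite scaler_eq0 pnatr_eq0 /= => /eqP.
Qed.

End NijenhuisConditions.

(** * Algebra of the projectability and integrability conditions *)

Section MonomialComplexStructures.
Variables (R : realType) (d : nat).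
Hypothesis d_even : ~~ odd d.

Definition pair_flip n := if odd n then n.-1 else n.+1.

Lemma pair_flipK : involutive pair_flip.
Proof.
move=> n; rewrite /pair_flip; case: (boolP (odd n)) => on.
  by case: n on => //= n /negbTE ->.
by rewrite /= on.
Qed.

Lemma pair_flip_lt n : (n < d)%N -> (pair_flip n < d)%N.
Proof. by move: d_even; rewrite /pair_flip; case: ifP; lia. Qed.

(** The list s is completed to an enumeration L of all indices, in which the positions 2k and 2k+1
    are exchanged. The even one carries r k and the odd one - 1 / r k, so that J^2 = -1. *)
Lemma exists_pairing (s : seq 'I_d) (r : nat -> R) : uniq s -> (forall k, r k != 0) ->
  exists (f : 'I_d -> 'I_d) (t : 'I_d -> R),
  [/\ involutive f, forall j, t (f j) * t j = - 1
    & forall x0 k, (k.*2.+1 < size s)%N ->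
        f (nth x0 s k.*2) = nth x0 s k.*2.+1 /\ t (nth x0 s k.*2) = r k].
Proof.
move=> us r0; pose L := s ++ [seq x <- enum 'I_d | x \notin s].
have uL : uniq L.
  rewrite cat_uniq us filter_uniq ?enum_uniq// andbT -all_predC.
  by apply/allP => x; rewrite mem_filter => /andP[].
have mL j : j \in L by rewrite mem_cat mem_filter mem_enum andbT orbN.
have sL : size L = d.
  rewrite -[RHS](size_enum_ord d); apply/eqP; rewrite -uniq_size_uniq// ?enum_uniq// => j.
  by rewrite mL mem_enum.
have iL j : (index j L < d)%N by rewrite -[X in (_ < X)%N]sL index_mem mL.
pose f j := nth j L (pair_flip (index j L)).
have fL j : index (f j) L = pair_flip (index j L).
  by rewrite index_uniq// sL pair_flip_lt.
pose t j := let n := index j L in if odd n then - (r n./2)^-1 else r n./2.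
exists f, t; split.
- move=> j; rewrite {1}/f fL pair_flipK.
  by rewrite (set_nth_default j) ?nth_index// sL iL.
- move=> j; rewrite /t fL /pair_flip; case: (boolP (odd (index j L))) => on.
    have -> : odd (index j L).-1 = false.
      by case: (index j L) on => //= n /negbTE.
    have -> : ((index j L).-1)./2 = (index j L)./2.
      by case: (index j L) on => //= n /negbTE h; rewrite uphalf_half h.
    by rewrite mulrN mulfV.
  by rewrite /= on /= uphalf_half (negbTE on) add0n mulNr mulVf.
- move=> x0 k ks.
  have n1 : nth x0 s k.*2 = nth x0 L k.*2 by rewrite nth_cat ltnW.
  have n2 : nth x0 s k.*2.+1 = nth x0 L k.*2.+1 by rewrite nth_cat ks.
  have kd : (k.*2.+1 < size L)%N by rewrite size_cat ltn_addr.
  rewrite n1 n2 /f /t index_uniq// 1?ltnW// /pair_flip odd_double doubleK; split=> //.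
  exact: set_nth_default.
Qed.

(* [J e_j = t_j e_(f j)].  As the [t_j] of the chosen pairs are arbitrary, a condition which
   holds for all complex structures holds for each coefficient of a polynomial in the [t_j]. *)
Definition monomial_mx (f : 'I_d -> 'I_d) (t : 'I_d -> R) : 'M[R]_d :=
  \matrix_(i, j) (t j *+ (i == f j)).

Variables (f : 'I_d -> 'I_d) (t : 'I_d -> R).
Hypotheses (fK : involutive f) (tt : forall j, t (f j) * t j = - 1).
Local Notation J := (monomial_mx f t).

Lemma monomial_mulE n (X : 'M[R]_(d, n)) i k : (J *m X) i k = t (f i) * X (f i) k.
Proof.
rewrite !mxE (bigD1 (f i))//= mxE fK eqxx mulr1n big1 ?addr0// => j ji.
by rewrite mxE -(inv_eq fK) eq_sym (negbTE ji) mulr0n mul0r.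
Qed.

Lemma mul_monomialE n (X : 'M[R]_(n, d)) i k : (X *m J) i k = t k * X i (f k).
Proof.
rewrite !mxE (bigD1 (f k))//= mxE eqxx mulr1n big1 ?addr0 1?mulrC// => j jk.
by rewrite mxE (negbTE jk) mulr0n mulr0.
Qed.

Lemma monomial_sqr : J *m J = - 1%:M.
Proof.
apply/matrixP => i k; rewrite monomial_mulE !mxE (inj_eq (inv_inj fK)).
by case: eqVneq => [->|_]; rewrite ?mulr1n ?tt ?mulr0n ?mulr0 ?oppr0.
Qed.

Lemma monomial_delta j : J *m delta_mx j 0 = t j *: (delta_mx (f j) 0 : 'cV[R]_d).
Proof.
apply/matrixP => i k; rewrite monomial_mulE !mxE.
rewrite (inv_eq fK); case: eqVneq => [->|_]; last by rewrite !mulr0.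
by rewrite fK.
Qed.

End MonomialComplexStructures.

Section EntryRules.
Variables (R : realType) (m n : nat).
Implicit Types A B : 'M[R]_(m, n).
Lemma mxDE A B i j : (A + B) i j = A i j + B i j. Proof. by rewrite mxE. Qed.
Lemma mxNE A i j : (- A) i j = - A i j. Proof. by rewrite mxE. Qed.
Lemma mxZE a A i j : (a *: A) i j = a * A i j. Proof. by rewrite mxE. Qed.
Lemma mx0E i j : (0 : 'M[R]_(m, n)) i j = 0. Proof. by rewrite mxE. Qed.
End EntryRules.

Section Pairings.
Variables (R : realType) (d : nat).
Hypothesis d_even : ~~ odd d.

Lemma exists_fresh (s : seq 'I_d) : (size s < d)%N -> exists j, j \notin s.
Proof.
move=> sd; apply/existsP; rewrite -negb_forall; apply/negP => /forallP H.
suff : (d <= size s)%N by rewrite leqNgt sd.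
rewrite -[X in (X <= _)%N](size_enum_ord d); apply: uniq_leq_size (enum_uniq _) _ => j _.
exact: H.
Qed.

Definition pairing (f : 'I_d -> 'I_d) (t : 'I_d -> R) :=
  involutive f /\ forall j, t (f j) * t j = - 1.

Lemma pairing6 (a a' b b' c c' : 'I_d) (x y z : R) :
  uniq [:: a; a'; b; b'; c; c'] -> x != 0 -> y != 0 -> z != 0 ->
  exists f t, pairing f t /\
    [/\ f a = a', f b = b', f c = c', t a = x & t b = y /\ t c = z].
Proof.
move=> us x0 y0 z0.
have r0 k : (match k with 0 => x | 1 => y | _ => z end)%N != 0 by case: k => [|[|k]].
have [f [t [fK tt H]]] := exists_pairing d_even us r0.
exists f, t; split=> //.
by have [] := H a 0%N isT; have [] := H a 1%N isT; have [] := H a 2%N isT.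
Qed.

Lemma pairing4 (a a' b b' : 'I_d) (x y : R) :
  uniq [:: a; a'; b; b'] -> x != 0 -> y != 0 ->
  exists f t, pairing f t /\ [/\ f a = a', f b = b', t a = x & t b = y].
Proof.
move=> us x0 y0.
have r0 k : (match k with 0 => x | _ => y end)%N != 0 by case: k.
have [f [t [fK tt H]]] := exists_pairing d_even us r0.
by exists f, t; split=> //; have [] := H a 0%N isT; have [] := H a 1%N isT.
Qed.

Lemma pairing2 (a a' : 'I_d) (x : R) : a != a' -> x != 0 ->
  exists f t, [/\ pairing f t, f a = a' & t a = x].
Proof.
move=> us x0.
have us2 : uniq [:: a; a'] by rewrite /= inE us.
have r0 k : (match k with 0 => x | _ => x end)%N != 0 by case: k.
have [f [t [fK tt H]]] := exists_pairing d_even us2 r0.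
by exists f, t; have [] := H a 0%N isT.
Qed.

End Pairings.

Section Shear.
Variables (R : realType) (d : nat) (i : 'I_d) (l : 'I_d -> R).
Hypothesis li : l i = 0.

(* A condition on all complex structures is invariant under GL_d; conjugation by the shears
   relates its coefficients which monomial matrices do not compare. *)
Lemma exists_shear : exists g h : 'M[R]_d, [/\ g *m h = 1%:M, h *m g = 1%:M,
  forall k, g *m delta_mx k 0 = delta_mx k 0 + l k *: (delta_mx i 0 : 'cV[R]_d)
  & forall n (X : 'M[R]_(d, n)) a k,
      (h *m X) a k = X a k - (\sum_j l j * X j k) *+ (a == i)].
Proof.
pose L : 'rV[R]_d := \row_k l k.
pose N : 'M[R]_d := delta_mx i 0 *m L.
have Ldelta k : L *m delta_mx k 0 = (l k)%:M.
  apply/matrixP => a b; rewrite !ord1 !mxE (bigD1 k)//= big1 => [|j jk].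
    by rewrite !mxE !eqxx mulr1 addr0.
  by rewrite !mxE (negbTE jk) mulr0.
have NN : N *m N = 0.
  by rewrite /N -mulmxA (mulmxA L) Ldelta li raddf0 mul0mx mulmx0.
exists (1%:M + N), (1%:M - N); split.
- by rewrite mulmxBr mulmx1 mulmxDl mul1mx NN; zmod.
- by rewrite mulmxBl mul1mx mulmxDr mulmx1 NN; zmod.
- move=> k; rewrite mulmxDl mul1mx /N -mulmxA Ldelta; congr (_ + _).
  by rewrite mul_mx_scalar.
- move=> n X a k; rewrite mulmxBl mul1mx mxDE mxNE; congr (_ - _).
  rewrite /N -mulmxA mxE big_ord1 !mxE eqxx andbT mulrC mulr_natr; congr (_ *+ _).
  by apply: eq_bigr => j _; rewrite mxE.
Qed.

End Shear.

(** * Solution of the condition along the leaves *)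

Section LeafCondition.
Variables (R : realType) (d : nat).
Hypothesis d_even : ~~ odd d.
Local Notation ev j := (delta_mx j 0 : 'cV[R]_d).

Definition leafCond (B : 'cV[R]_d -> 'M[R]_d) := forall J a, J *m J = - 1%:M ->
  J *m B a *m J + B a + B (J *m a) *m J - J *m B (J *m a) = 0.

Lemma colE_delta (A : 'M[R]_d) i j : (A *m (ev j)) i 0 = A i j.
Proof. by rewrite -colE mxE. Qed.

Lemma delta_sum (v : 'cV[R]_d) : v = \sum_k v k 0 *: (ev k).
Proof.
rewrite {1}[v]matrix_sum_delta; apply: eq_bigr => k _; by rewrite big_ord1.
Qed.

Section Entries.
Variable B : 'cV[R]_d -> 'M[R]_d.
Hypotheses (Bl : linear B) (Bc : leafCond B).

Lemma leafCond_entry f t i l j : pairing f t ->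
  t (f l) * t j * B (ev i) (f l) (f j) + B (ev i) l j
    + t i * (t j * B (ev (f i)) l (f j) - t (f l) * B (ev (f i)) (f l) j) = 0.
Proof.
move=> [fK tt]; have := Bc (ev i) (monomial_sqr fK tt).
rewrite monomial_delta//; have [_ _ -> _] := linear_facts Bl.
move=> /matrixP/(_ l j); rewrite !(mxDE, mxNE, mx0E).
rewrite !mul_monomialE !(monomial_mulE _ fK) !mxZE => H.
by rewrite -H; ring.
Qed.

(** With i and l exchanged and t_i = c, the (l, i) entry is a polynomial in c whose coefficients are
    the two claims; c = 1 and c = 2 separate them. *)
Lemma leafCond_diag i l : i != l ->
  B (ev i) l i = 0 /\ B (ev i) i l + B (ev l) l l - B (ev l) i i = 0.
Proof.
move=> il.
have H c : c != 0 -> c * c * B (ev i) i l + B (ev i) l i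
    + c * (c * B (ev l) l l - c * B (ev l) i i) = 0.
  move=> c0; have [f [t [pf fi ti]]] := pairing2 d_even il c0.
  have fl : f l = i by rewrite -fi pf.1.
  by have := leafCond_entry i l i pf; rewrite fl fi ti.
have H1 := H 1 (oner_neq0 _); have H2 := H 2 (ltac:(by rewrite pnatr_eq0)).
split; lra.
Qed.

Lemma leafCond_off i l j : uniq [:: j; l; i] -> B (ev i) l j = 0.
Proof.
move=> us.
(* Three distinct indices and an even d force d >= 4. *)
have sd : (size [:: j; l; i] < d)%N.
  have : (size [:: j; l; i] <= d)%N by rewrite -[X in (_ <= X)%N](size_enum_ord d) uniq_leq_size// => x _; rewrite mem_enum.
  by move: d_even; rewrite /=; lia.
have [k kn] := exists_fresh sd.
have us4 : uniq (rcons [:: j; l; i] k) by rewrite rcons_uniq kn us.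
(* The two signs of c2 remove the last term, and the values 1 and 2 of c1 separate the first two. *)
have H c1 c2 : c1 != 0 -> c2 != 0 -> c1 * c1 * B (ev i) j l + B (ev i) l j
    + c2 * (c1 * B (ev k) l l - c1 * B (ev k) j j) = 0.
  move=> c10 c20; have [f [t [pf [fj fi tj ti]]]] := pairing4 d_even us4 c10 c20.
  have fl : f l = j by rewrite -fj pf.1.
  by have := leafCond_entry i l j pf; rewrite fl fj fi ti tj.
have n1 : (1 : R) != 0 by exact: oner_neq0.
have n2 : (2 : R) != 0 by rewrite pnatr_eq0.
have nm : (-1 : R) != 0 by rewrite oppr_eq0.
have := H 1 1 n1 n1; have := H 1 (-1) n1 nm; have := H 2 1 n2 n1; have := H 2 (-1) n2 nm.
lra.
Qed.

End Entries.

Lemma complex_structure_conj (g h J : 'M[R]_d) : h *m g = 1%:M -> g *m h = 1%:M ->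
  J *m J = - 1%:M -> (g *m J *m h) *m (g *m J *m h) = - 1%:M.
Proof.
move=> hg gh JJ; rewrite !mulmxA -(mulmxA _ h g) hg mulmx1 -(mulmxA g J J) JJ.
by rewrite mulmxN mulmx1 mulNmx gh.
Qed.

Lemma leafCond_conj B g h : g *m h = 1%:M -> h *m g = 1%:M -> leafCond B ->
  leafCond (fun a => h *m B (g *m a) *m g).
Proof.
move=> gh hg Bc J a JJ.
have JJ' := complex_structure_conj hg gh JJ.
have := Bc _ (g *m a) JJ'.
have -> : g *m J *m h *m (g *m a) = g *m (J *m a).
  by rewrite !mulmxA -(mulmxA _ h g) hg mulmx1.
move=> /(f_equal (fun X => h *m X *m g)); rewrite mulmx0 mul0mx => <-.
rewrite !(mulmxDl, mulmxDr, mulNmx, mulmxN) !mulmxA.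
by rewrite hg mul1mx -!(mulmxA _ h g) hg !mulmx1; zmod.
Qed.

Lemma leafCond_scalar B : linear B -> leafCond B -> forall a, exists l, B a = l%:M.
Proof.
move=> Bl Bc.
(* At first order in c, the shear e_x -> e_x + c e_i turns [leafCond_diag] into a relation between
   the same entries with the opposite sign of the difference of diagonal entries; hence both terms
   vanish. *)
have key i x : i != x -> B (ev i) i x = 0 /\ B (ev x) x x = B (ev x) i i.
  move=> ix; have xi : x != i by rewrite eq_sym.
  have [B0 BD BZ _] := linear_facts Bl.
  have H (c : R) : B ((ev x) + c *: (ev i)) i x + c * B ((ev x) + c *: (ev i)) i i =
      c * (B ((ev x) + c *: (ev i)) x x + c * B ((ev x) + c *: (ev i)) x i).
    have li : c *+ (i == x) = 0 by rewrite (negbTE ix).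
    have [g [h [gh hg ge hE]]] := exists_shear (l := fun k => c *+ (k == x)) li.
    have gl : linear (fun a => h *m B (g *m a) *m g).
      move=> k u v; rewrite mulmxDr -scalemxAr Bl mulmxDr -scalemxAr mulmxDl.
      by rewrite -scalemxAl.
    have [] := leafCond_diag gl (leafCond_conj gh hg Bc) xi.
    rewrite -colE_delta -!mulmxA hE ge !eqxx !mulr1n => H _.
    rewrite (bigD1 x)//= eqxx big1 in H; last by move=> j /negbTE ->; rewrite mul0r.
    rewrite addr0 mulr1n mulmxDr -!scalemxAr !mxDE !mxZE !colE_delta in H.
    by apply/eqP; rewrite -subr_eq0 H.
  have [h1 h2] := leafCond_diag Bl Bc xi; have [h3 h4] := leafCond_diag Bl Bc ix.
  have := H 1; have := H (-1); rewrite !BD !BZ !mxDE !mxZE; lra.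
have basis i : B (ev i) = (B (ev i) i i)%:M.
  apply/matrixP => l j; rewrite !mxE.
  have [<-{j}|lj] := eqVneq l j; rewrite ?mulr1n ?mulr0n.
    by have [->//|li] := eqVneq l i; have [_ ->] := key l i li.
  have [->{i}|ij] := eqVneq i j.
    by have [] := leafCond_diag Bl Bc (_ : j != l); rewrite // eq_sym.
  have [<-|il] := eqVneq i l; first by have [] := key i j ij.
  by apply: leafCond_off => //; rewrite /= !inE !negb_or eq_sym lj eq_sym ij eq_sym il.
move=> a; exists (\sum_k a k 0 * B (ev k) k k).
rewrite {1}[a]delta_sum linear_sum_coords//.
rewrite (big_morph _ (raddfD (@scalar_mx R d)) (raddf0 _)).
by apply: eq_bigr => k _; rewrite basis scale_scalar_mx mxE eqxx mulr1n.
Qed.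

End LeafCondition.

(** * Solution of the torsion condition *)

Section TorsionCondition.
Variables (R : realType) (d : nat).
Hypotheses (d_even : ~~ odd d) (d4 : (4 <= d)%N).
Local Notation vect := 'cV[R]_d.
Local Notation ev j := (delta_mx j 0 : 'cV[R]_d).

Definition bilinear (V : normedModType R) (T : vect -> vect -> V) :=
  (forall b, linear (T ^~ b)) /\ (forall a, linear (T a)).

Definition torCond (T : vect -> vect -> vect) := forall J a b, J *m J = - 1%:M ->
  T (J *m a) (J *m b) - J *m T (J *m a) b - J *m T a (J *m b) - T a b = 0.

Lemma bilinear_ext (V : normedModType R) (T T' : vect -> vect -> V) :
  bilinear T -> bilinear T' -> (forall i j, T (ev i) (ev j) = T' (ev i) (ev j)) ->
  forall a b, T a b = T' a b.
Proof.
move=> [Tl Tr] [T'l T'r] H a b.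
rewrite [b]delta_sum !linear_sum_coords//; apply: eq_bigr => j _; congr (_ *: _).
rewrite [a]delta_sum (linear_sum_coords _ _ (Tl _)) (linear_sum_coords _ _ (T'l _)).
by apply: eq_bigr => i _; rewrite H.
Qed.

Lemma torCond_conj T g h : g *m h = 1%:M -> h *m g = 1%:M -> torCond T ->
  torCond (fun a b => h *m T (g *m a) (g *m b)).
Proof.
move=> gh hg Tc J a b JJ.
have JJ' := complex_structure_conj hg gh JJ.
have E u : g *m J *m h *m (g *m u) = g *m (J *m u).
  by rewrite !mulmxA -(mulmxA _ h g) hg mulmx1.
have := Tc _ (g *m a) (g *m b) JJ'; rewrite !E.
move=> /(f_equal (fun X => h *m X)); rewrite mulmx0 => <-.
by rewrite !(mulmxDr, mulmxN) !mulmxA hg !mul1mx.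
Qed.

(** J exchanges i with k, and j with a fourth index. The k-th component is a quadratic polynomial in
    t = t_i, whose constant term is minus the claimed entry. *)
Lemma torCond_off T i j k : bilinear T -> torCond T -> uniq [:: i; k; j] ->
  T (ev i) (ev j) k 0 = 0.
Proof.
move=> [Tl Tr] Tc us.
have [l ln] : exists l, l \notin [:: i; k; j] by exact: exists_fresh.
have us4 : uniq (rcons [:: i; k; j] l) by rewrite rcons_uniq ln us.
have n1 : (1 : R) != 0 by exact: oner_neq0.
have H t : t != 0 -> t * T (ev k) (ev l) k 0 - t * (t * T (ev k) (ev j) i 0)
    - t * T (ev i) (ev l) i 0 - T (ev i) (ev j) k 0 = 0.
  move=> t0; have [f [s [[fK ss] [fi fj si sj]]]] := pairing4 d_even us4 t0 n1.
  have fk : f k = i by rewrite -fi fK.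
  have := Tc _ (ev i) (ev j) (monomial_sqr fK ss).
  rewrite !monomial_delta// fi fj si sj scale1r.
  have [_ _ TZ _] := linear_facts (Tl (ev l)); have [_ _ TZ' _] := linear_facts (Tl (ev j)).
  rewrite TZ TZ' => /matrixP/(_ k 0); rewrite !(mxDE, mxNE, mx0E) !(monomial_mulE _ fK) !mxZE.
  by rewrite fk si.
have n2 : (2 : R) != 0 by rewrite pnatr_eq0.
have nm : (-1 : R) != 0 by rewrite oppr_eq0.
have nm2 : (-2 : R) != 0 by rewrite oppr_eq0.
have := H 1 n1; have := H (-1) nm; have := H 2 n2; have := H (-2) nm2; lra.
Qed.

(** This is [torCond_off] for T conjugated by e_x -> e_x + e_i: the off-diagonal terms vanish, and
    the difference of two diagonal ones remains. *)
Lemma torCond_diag T i x y : bilinear T -> torCond T -> uniq [:: x; y; i] ->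
  T (ev i) (ev y) i 0 = T (ev x) (ev y) x 0.
Proof.
move=> bT Tc us; have [Tl Tr] := bT; move: (us); rewrite /= !inE !negb_or andbT.
move=> /andP[/andP[xy xi] yi].
have li : (i == x)%:R = 0 :> R by rewrite eq_sym (negbTE xi).
have [g [h [gh hg ge hE]]] := exists_shear (l := fun k => (k == x)%:R) li.
have bT' : bilinear (fun a b => h *m T (g *m a) (g *m b)).
  split=> [b|a] k u v.
    by rewrite mulmxDr -scalemxAr Tl mulmxDr -scalemxAr.
  by rewrite mulmxDr -scalemxAr Tr mulmxDr -scalemxAr.
have us' : uniq [:: x; i; y] by rewrite /= !inE !negb_or xi xy eq_sym yi.
have H1 := torCond_off bT Tc us'.
have us2 : uniq [:: i; x; y] by rewrite /= !inE !negb_or eq_sym xi eq_sym yi xy.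
have H2 := torCond_off bT Tc us2.
have := torCond_off bT' (torCond_conj gh hg Tc) us'.
rewrite hE !ge !eqxx mulr1n (negbTE (_ : y != x)) 1?eq_sym// scale0r addr0 scale1r.
rewrite (bigD1 x)//= eqxx mul1r big1 ?addr0; last by move=> j /negbTE ->; rewrite mul0r.
have [_ TD _ _] := linear_facts (Tl (ev y)).
by rewrite TD !mxDE H1 H2; lra.
Qed.

Lemma torCond_form T : bilinear T -> (forall a b, T a b = - T b a) -> torCond T ->
  let al a := (d.-1)%:R^-1 * \sum_k T a (ev k) k 0 in
  forall a b, T a b = al a *: b - al b *: a.
Proof.
move=> bT Ta Tc al; have [Tl Tr] := bT.
have all : linear (al : vect -> R^o).
  move=> k u v; rewrite /al.
  rewrite [LHS](_ : _ = d.-1%:R^-1 * (k * (\sum_j T u (ev j) j 0) + \sum_j T v (ev j) j 0)).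
    by rewrite mulrDr mulrCA.
  congr (_ * _); rewrite mulr_sumr -big_split; apply: eq_bigr => j _ /=.
  by rewrite Tl mxDE mxZE.
have alD k u v : al (k *: u + v) = k * al u + al v by exact: all.
have T0 i k : T (ev i) (ev i) k 0 = 0.
  by have := f_equal (fun v : vect => v k 0) (Ta (ev i) (ev i)); rewrite mxNE; lra.
have d1 : (d.-1)%:R != 0 :> R by rewrite pnatr_eq0; move: d4; lia.
have alE i j : i != j -> T (ev i) (ev j) j 0 = al (ev i).
  move=> ij; rewrite /al (bigD1 i)//= T0 add0r.
  rewrite (eq_bigr (fun=> T (ev i) (ev j) j 0)) => [|k ki]; last first.
    have [->//|kj] := eqVneq k j.
    rewrite (Ta (ev i)) [in RHS](Ta (ev i)) !mxNE; congr (- _).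
    by apply: torCond_diag => //; rewrite /= !inE !negb_or eq_sym ij eq_sym kj eq_sym ki.
  rewrite sumr_const cardC1 card_ord -[X in _ * X]mulr_natl mulrA mulVf ?mul1r//.
suff [bT' H] : bilinear (fun a b => al a *: b - al b *: a) /\
    forall i j, T (ev i) (ev j) = al (ev i) *: (ev j) - al (ev j) *: (ev i).
  exact: (bilinear_ext bT bT' H).
split=> [|i j].
  split=> [b|a] k u v /=.
    by apply/matrixP => r s; rewrite !(mxDE, mxNE, mxZE) alD; ring.
  by apply/matrixP => r s; rewrite !(mxDE, mxNE, mxZE) alD; ring.
apply/matrixP => k z; rewrite ord1 !(mxDE, mxNE, mxZE) !mxE andbT andbT.
have [->|ij] := eqVneq i j; first by rewrite T0 subrr.
have [->|kj] := eqVneq k j.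
  by rewrite alE// (negbTE (_ : j != i)) 1?eq_sym// mulr1 mulr0 subr0.
have [->|ki] := eqVneq k i.
  by rewrite Ta mxNE alE 1?eq_sym// mulr0 mulr1 sub0r.
by rewrite !mulr0 subr0 torCond_off// /= !inE !negb_or ij eq_sym ki kj.
Qed.

Lemma form_torCond (T : vect -> vect -> vect) (al : vect -> R) :
  (forall a b, T a b = al a *: b - al b *: a) -> torCond T.
Proof.
move=> TE J a b JJ; rewrite !TE !(mulmxDr, mulmxN) -!scalemxAr !mulmxA JJ !mulNmx !mul1mx.
rewrite !scalerN; zmod.
Qed.

End TorsionCondition.

(** * The curvature condition tested on monomial complex structures *)

Section CurvatureCondition.
Variables (R : realType) (d : nat).
Hypotheses (d_even : ~~ odd d) (d4 : (4 <= d)%N).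
Local Notation vect := 'cV[R]_d.
Local Notation ev j := (delta_mx j 0 : 'cV[R]_d).

Definition curvCond (F : vect -> vect -> 'M[R]_d) := forall J, J *m J = - 1%:M ->
  let C a b := F a b *m J - J *m F a b in forall a b,
  C (J *m a) (J *m b) - J *m C (J *m a) b - J *m C a (J *m b) - C a b = 0.

Lemma curvCond_conj F g h : g *m h = 1%:M -> h *m g = 1%:M -> curvCond F ->
  curvCond (fun a b => h *m F (g *m a) (g *m b) *m g).
Proof.
move=> gh hg Fc J JJ C a b.
have JJ' := complex_structure_conj hg gh JJ.
have E u : g *m J *m h *m (g *m u) = g *m (J *m u).
  by rewrite !mulmxA -(mulmxA _ h g) hg mulmx1.
have hgX n (X : 'M[R]_(d, n)) : h *m (g *m X) = X by rewrite mulmxA hg mul1mx.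
have := Fc _ JJ' (g *m a) (g *m b); rewrite !E /C.
move=> /(f_equal (fun X => h *m X *m g)); rewrite mulmx0 mul0mx => <-.
by rewrite !(mulmxDl, mulmxDr, mulNmx, mulmxN) -!mulmxA !hgX hg !mulmx1; zmod.
Qed.

Lemma bilinear_conj (F : vect -> vect -> 'M[R]_d) (g h : 'M[R]_d) :
  bilinear F -> bilinear (fun a b => h *m F (g *m a) (g *m b) *m g).
Proof.
move=> [Fl Fr]; split=> [b|a] k u v; rewrite mulmxDr -scalemxAr (Fl, Fr).
  by rewrite mulmxDr mulmxDl -scalemxAr -scalemxAl.
by rewrite mulmxDr mulmxDl -scalemxAr -scalemxAl.
Qed.

Lemma altern_conj (F : vect -> vect -> 'M[R]_d) (g h : 'M[R]_d) : (forall a b, F a b = - F b a) ->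
  forall a b, h *m F (g *m a) (g *m b) *m g = - (h *m F (g *m b) (g *m a) *m g).
Proof. by move=> Fa a b; rewrite Fa mulmxN mulNmx. Qed.

Section Entries.
Variable F : vect -> vect -> 'M[R]_d.
Hypotheses (Fb : bilinear F) (Fa : forall a b, F a b = - F b a) (Fc : curvCond F).

Lemma curvCond_entry f t i j l k : pairing f t ->
 t i * t j * (t k * F (ev (f i)) (ev (f j)) l (f k) - t (f l) * F (ev (f i)) (ev (f j)) (f l) k)
 - t (f l) * (t i * (t k * F (ev (f i)) (ev j) (f l) (f k) - t l * F (ev (f i)) (ev j) l k))
 - t (f l) * (t j * (t k * F (ev i) (ev (f j)) (f l) (f k) - t l * F (ev i) (ev (f j)) l k))
 - (t k * F (ev i) (ev j) l (f k) - t (f l) * F (ev i) (ev j) (f l) k) = 0.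
Proof.
move=> [fK tt]; have [Fl Fr] := Fb.
have := Fc (monomial_sqr fK tt) (ev i) (ev j).
rewrite !monomial_delta//.
have [_ _ FZ _] := linear_facts (Fl (ev j)); have [_ _ FZ' _] := linear_facts (Fl (t j *: ev (f j))).
have [_ _ FZ2 _] := linear_facts (Fr (ev i)); have [_ _ FZ3 _] := linear_facts (Fr (ev (f i))).
rewrite FZ FZ' FZ2 FZ3 => /matrixP/(_ l k).
rewrite !(mxDE, mxNE, mx0E, monomial_mulE _ fK, mul_monomialE, mxZE) fK => H.
by rewrite -[RHS]H; ring.
Qed.

(** J exchanges i with l, and j with a fourth index, where t_i = t and t_j = 1. The (i, i) entry
    times t is a cubic polynomial in t with constant term minus the claimed entry; four values of t
    isolate it. *)
Lemma curvCond_off2 i j l : uniq [:: i; l; j] -> F (ev i) (ev j) l i = 0.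
Proof.
move=> us; have [j' jn] : exists j', j' \notin [:: i; l; j] by exact: exists_fresh.
have us4 : uniq (rcons [:: i; l; j] j') by rewrite rcons_uniq jn us.
have n1 : (1 : R) != 0 by exact: oner_neq0.
have H t : t != 0 -> t * t * t * F (ev l) (ev j') i l + t * F (ev l) (ev j') l i
   + t * t * (F (ev l) (ev j) l l - F (ev l) (ev j) i i)
   + t * (F (ev i) (ev j') l l - F (ev i) (ev j') i i)
   - t * t * F (ev i) (ev j) i l - F (ev i) (ev j) l i = 0.
  move=> t0; have [f [s [pf [fi fj si sj]]]] := pairing4 d_even us4 t0 n1.
  have sl : s l = - t^-1.
    have := pf.2 i; rewrite fi si => E; apply: (mulIf t0).
    by rewrite E mulNr mulVf.
  have := curvCond_entry i j i i pf; rewrite fi fj si sj sl => E.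
  by rewrite -[RHS](mulr0 t) -E; field.
have n2 : (2 : R) != 0 by rewrite pnatr_eq0.
have nm : (-1 : R) != 0 by rewrite oppr_eq0.
have nm2 : (-2 : R) != 0 by rewrite oppr_eq0.
have := H 1 n1; have := H (-1) nm; have := H 2 n2; have := H (-2) nm2; lra.
Qed.

(** Three disjoint pairs with coefficients t, 1, r isolate the entry as the constant term of a
    polynomial in t and r; they need six indices. *)
Lemma curvCond_off3 i j k l : (6 <= d)%N -> uniq [:: i; l; j; k] ->
  F (ev i) (ev j) l k = 0.
Proof.
move=> d6 us; have [j' jn] : exists j', j' \notin [:: i; l; j; k] by apply: exists_fresh => /=; lia.
have us5 : uniq (rcons [:: i; l; j; k] j') by rewrite rcons_uniq jn us.
have [k' kn] : exists k', k' \notin rcons [:: i; l; j; k] j' by apply: exists_fresh => /=; lia.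
have us6 : uniq (rcons (rcons [:: i; l; j; k] j') k') by rewrite rcons_uniq kn us5.
(* [pairing6] expects partners next to each other. *)
have {}us6 : uniq [:: i; l; j; j'; k; k'].
  apply: etrans us6; apply: perm_uniq.
  rewrite -[X in perm_eq X _]/([:: i; l; j] ++ [:: j'; k; k']).
  rewrite -[X in perm_eq _ X]/([:: i; l; j] ++ [:: k; j'; k']) perm_cat2l.
  by apply/permEl/(perm_catCA [:: j'] [:: k] [:: k']).
have n1 : (1 : R) != 0 by exact: oner_neq0.
have H t r : t != 0 -> r != 0 ->
  t * t * r * F (ev l) (ev j') i k' + t * F (ev l) (ev j') l k
  + t * (r * F (ev l) (ev j) l k' - t * F (ev l) (ev j) i k)
  + (r * F (ev i) (ev j') l k' - t * F (ev i) (ev j') i k)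
  - t * r * F (ev i) (ev j) i k' - F (ev i) (ev j) l k = 0.
  move=> t0 r0; have [f [s [pf [fi fj fk si [sj sk]]]]] := pairing6 d_even us6 t0 n1 r0.
  have sl : s l = - t^-1.
    have := pf.2 i; rewrite fi si => E; apply: (mulIf t0).
    by rewrite E mulNr mulVf.
  have := curvCond_entry i j i k pf; rewrite fi fj fk si sj sk sl => E.
  by rewrite -[RHS](mulr0 t) -E; field.
have n2 : (2 : R) != 0 by rewrite pnatr_eq0.
have nm : (-1 : R) != 0 by rewrite oppr_eq0.
have nm2 : (-2 : R) != 0 by rewrite oppr_eq0.
have := H 1 1 n1 n1; have := H (-1) 1 nm n1; have := H 2 1 n2 n1; have := H (-2) 1 nm2 n1.
have := H 1 (-1) n1 nm; have := H (-1) (-1) nm nm; have := H 2 (-1) n2 nm.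
have := H (-2) (-1) nm2 nm; lra.
Qed.

End Entries.
End CurvatureCondition.

(** * Relations between curvature entries obtained from shears *)

Section CurvatureForm.
Variables (R : realType) (d : nat).
Hypotheses (d_even : ~~ odd d) (d4 : (4 <= d)%N).
Local Notation vect := 'cV[R]_d.
Local Notation ev j := (delta_mx j 0 : 'cV[R]_d).
Variable F : vect -> vect -> 'M[R]_d.
Hypotheses (Fb : bilinear F) (Fa : forall a b, F a b = - F b a) (Fc : curvCond F).
Local Notation f i j l k := (F (ev i) (ev j) l k).

Lemma altE i j l k : f i j l k = - f j i l k.
Proof. by rewrite Fa mxNE. Qed.

Lemma conj_entry (i : 'I_d) (l : 'I_d -> R) (g h X : 'M[R]_d) a k :
  (forall n (Y : 'M[R]_(d, n)) a k,
      (h *m Y) a k = Y a k - (\sum_j l j * Y j k) *+ (a == i)) ->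
  (h *m X *m g) a k =
    (X *m (g *m ev k)) a 0 - (\sum_j l j * (X *m (g *m ev k)) j 0) *+ (a == i).
Proof.
by move=> hE; rewrite -colE_delta -!mulmxA hE.
Qed.

Lemma sum2 (l Y : 'I_d -> R) x y : x != y -> (forall j, j != x -> j != y -> l j = 0) ->
  \sum_j l j * Y j = l x * Y x + l y * Y y.
Proof.
move=> xy l0; rewrite (bigD1 x)//= (bigD1 y) 1?eq_sym//= big1 ?addr0// => j /andP[jx jy].
by rewrite l0// mul0r.
Qed.

(** This is [curvCond_off2] for F conjugated by the shear that sends e_x and e_y to x' and y'. Free
    lam and mu encode several relations in one polynomial identity. *)
Lemma sheared_off2 x y i (lam mu : R) : uniq [:: x; i; y] ->
  let x' := ev x + lam *: ev i in let y' := ev y + mu *: ev i in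
  (F x' y' *m x') i 0 = lam * (F x' y' *m x') x 0 + mu * (F x' y' *m x') y 0 /\
  forall p, p \notin [:: x; i; y] -> (F x' y' *m x') p 0 = 0.
Proof.
move=> us x' y'; move: (us); rewrite /= !inE !negb_or andbT => /andP[/andP[xi xy] iy].
pose l k := lam *+ (k == x) + mu *+ (k == y).
have li : l i = 0 by rewrite /l (eq_sym i x) (negbTE xi) (negbTE iy) addr0.
have lx : l x = lam by rewrite /l eqxx (negbTE xy) addr0.
have ly : l y = mu by rewrite /l eqxx (eq_sym y x) (negbTE xy) add0r.
have [g [h [gh hg ge hE]]] := exists_shear li.
have gx : g *m ev x = x' by rewrite ge lx.
have gy : g *m ev y = y' by rewrite ge ly.
have b' := bilinear_conj g h Fb; have a' := altern_conj g h Fa.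
have c' := curvCond_conj gh hg Fc.
split=> [|p pn].
  have := curvCond_off2 d_even d4 b' c' us.
  rewrite (conj_entry _ _ _ _ hE) eqxx mulr1n gx gy (@sum2 _ _ x y)//.
    by rewrite lx ly => /eqP; rewrite subr_eq0 => /eqP.
  by move=> j jx jy; rewrite /l (negbTE jx) (negbTE jy) addr0.
move: pn; rewrite !inE !negb_or => /and3P[px pi py].
have us' : uniq [:: x; p; y] by rewrite /= !inE !negb_or eq_sym px xy py.
have := curvCond_off2 d_even d4 b' c' us'.
by rewrite (conj_entry _ _ _ _ hE) (negbTE pi) mulr0n subr0 gx gy.
Qed.

Lemma sheared_entry x y i (lam mu : R) p :
  (F (ev x + lam *: ev i) (ev y + mu *: ev i) *m (ev x + lam *: ev i)) p 0 =
  f x y p x + mu * f x i p x + lam * (f i y p x + f x y p i) + lam * mu * f x i p i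
   + lam * lam * f i y p i.
Proof.
have [Fl Fr] := Fb.
have Fii : F (ev i) (ev i) = 0.
  apply/matrixP => a b; rewrite mx0E; have := altE i i a b; lra.
have [_ D1 Z1 _] := linear_facts (Fl (ev y + mu *: ev i)).
have [_ D2 Z2 _] := linear_facts (Fr (ev x)); have [_ D3 Z3 _] := linear_facts (Fr (ev i)).
rewrite D1 Z1 D2 D3 Z2 Z3 Fii scaler0 addr0 mulmxDr -scalemxAr mxDE mxZE.
by rewrite !colE_delta !(mxDE, mxZE); ring.
Qed.

(** These are coefficients in lam and mu, extracted at six sample points after the entries known
    from [curvCond_off2] are dropped. The first relation makes the e_i component of F(e_x, e_i) e_x
    independent of i. *)
Lemma curvature_facts x y i : uniq [:: x; i; y] ->
  [/\ f x i i x = f x y y x, f i y i x + f x y i i = f x y x x,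
      f i y i i = f i y x x + f x y x i
    & f x i i i = f x i x x + f i y y x + f x y y i].
Proof.
move=> us; have H lam mu := (sheared_off2 lam mu us).1.
rewrite /= in H.
move: (us); rewrite /= !inE !negb_or andbT => /andP[/andP[xi xy] iy].
have z1 : f x y i x = 0 by exact: curvCond_off2.
have z2 : f x i y x = 0.
  by apply: curvCond_off2 => //; rewrite /= !inE !negb_or xy xi eq_sym iy.
have z3 : f i y x i = 0.
  by apply: curvCond_off2 => //; rewrite /= !inE !negb_or eq_sym xi iy xy.
have z4 : f x i y i = 0.
  rewrite altE curvCond_off2 ?oppr0//.
  by rewrite /= !inE !negb_or iy eq_sym xi eq_sym xy.
have e1 := H 0 1; have e2 := H 1 0; have e3 := H (-1) 0.
have e4 := H 1 1; have e5 := H (-1) 1; have e6 := H 1 (-1).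
rewrite !sheared_entry in e1 e2 e3 e4 e5 e6.
split; lra.
Qed.

(** The first order term in lam. In rank 4 it takes the place of [curvCond_off3]. *)
Lemma curvature_facts4 x y i p : uniq [:: x; i; y] -> p \notin [:: x; i; y] ->
  f i y p x + f x y p i = 0.
Proof.
move=> us pn; have H lam mu := (sheared_off2 lam mu us).2 p pn.
rewrite /= in H; have e1 := H 0 0; have e2 := H 1 0; have e3 := H (-1) 0.
rewrite !sheared_entry in e1 e2 e3; lra.
Qed.

(** The case w = y compares the e_j components of F(e_x, e_j) e_z for different j, the case w = z
    the diagonal entries of F(e_x, e_y) away from x and y. *)
Lemma sheared_off3 x y z i (lam : R) w : (6 <= d)%N -> uniq [:: x; i; y; z] ->
  w = y \/ w = z ->
  let s k := ev k + (if k == w then lam else 0) *: ev i in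
  (F (ev x) (s y) *m s z) i 0 = lam * (F (ev x) (s y) *m s z) w 0.
Proof.
move=> d6 us wyz s; move: (us); rewrite /= !inE !negb_or andbT.
move=> /and3P[/and3P[xi xy xz] /andP[iy iz] yz].
pose l k : R := if k == w then lam else 0.
have iw : i != w by case: wyz => ->.
have xw : x != w by case: wyz => ->.
have li : l i = 0 by rewrite /l (negbTE iw).
have [g [h [gh hg ge hE]]] := exists_shear li.
have b' := bilinear_conj g h Fb; have c' := curvCond_conj gh hg Fc.
have := curvCond_off3 d_even d4 b' c' d6 us.
have gs k : g *m ev k = s k by rewrite ge.
have gx : g *m ev x = ev x by rewrite ge /l (negbTE xw) scale0r addr0.
have lw : l w = lam by rewrite /l eqxx.
rewrite (conj_entry _ _ _ _ hE) eqxx mulr1n gx !gs.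
rewrite (bigD1 w)//= big1 ?addr0 => [|j /negbTE jw]; last by rewrite /l jw mul0r.
by rewrite lw => /eqP; rewrite subr_eq0 => /eqP.
Qed.

End CurvatureForm.

Ltac solve_neqs :=
  rewrite /= ?inE ?negb_or; repeat (apply/andP; split); by [|rewrite eq_sym].

(** * From curvature entries to the multilinear formulas *)

Section Forms.
Variables (R : realType) (d : nat).
Local Notation vect := 'cV[R]_d.
Local Notation ev j := (delta_mx j 0 : 'cV[R]_d).

Definition mxform (B : 'M[R]_d) (a b : vect) : R := (a^T *m B *m b) 0 0.

Lemma mxform_linearl B b : linear (fun a => mxform B a b : R^o).
Proof.
by move=> k u v; rewrite /mxform linearP /= mulmxDl mulmxDl -!scalemxAl mxDE mxZE.
Qed.

Lemma mxform_linearr B a : linear (fun b => mxform B a b : R^o).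
Proof. by move=> k u v; rewrite /mxform mulmxDr -!scalemxAr mxDE mxZE. Qed.

Lemma mxform_delta B i j : mxform B (ev i) (ev j) = B i j.
Proof. by rewrite /mxform trmx_delta -mulmxA -colE -rowE !mxE. Qed.

Lemma mxformDl B k u v b : mxform B (k *: u + v) b = k * mxform B u b + mxform B v b.
Proof. exact: mxform_linearl. Qed.

Lemma mxformDr B k u v a : mxform B a (k *: u + v) = k * mxform B a u + mxform B a v.
Proof. exact: mxform_linearr. Qed.

Lemma linear_ext (V : normedModType R) (T T' : vect -> V) :
  linear T -> linear T' -> (forall i, T (ev i) = T' (ev i)) -> forall a, T a = T' a.
Proof.
move=> Tl T'l H a; rewrite [a]delta_sum !linear_sum_coords//.
by apply: eq_bigr => i _; rewrite H.
Qed.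

Variable F : vect -> vect -> 'M[R]_d.
Hypotheses (Fb : bilinear F) (Fa : forall a b, F a b = - F b a).
Local Notation f i j l k := (F (ev i) (ev j) l k).

Lemma form3_of_entries (Be Ga : 'M[R]_d) :
  (forall i j l k, f i j l k =
     Be i k *+ (l == j) - Be j k *+ (l == i) + Ga i j *+ (l == k)) ->
  forall a b c, F a b *m c = mxform Be a c *: b - mxform Be b c *: a + mxform Ga a b *: c.
Proof.
move=> H a b c; move: a b.
have bl : bilinear (fun a b => F a b *m c).
  by have [Fl Fr] := Fb; split=> [b|a] k u v; rewrite (Fl, Fr) mulmxDl -scalemxAl.
have br : bilinear (fun a b => mxform Be a c *: b - mxform Be b c *: a + mxform Ga a b *: c).
  split=> [b|a] k u v; apply/matrixP => r s; rewrite !(mxDE, mxNE, mxZE) !(mxformDl, mxformDr); ring.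
apply: (bilinear_ext bl br) => i j.
have ll : linear (fun c : vect => F (ev i) (ev j) *m c) by exact: mulmx_linearr.
have lr : linear (fun c : vect => mxform Be (ev i) c *: ev j - mxform Be (ev j) c *: ev i
    + mxform Ga (ev i) (ev j) *: c).
  by move=> k u v; apply/matrixP => r s; rewrite !(mxDE, mxNE, mxZE) !mxformDr; ring.
apply: (linear_ext ll lr) => k; apply/matrixP => l s.
rewrite ord1 colE_delta H !(mxDE, mxNE, mxZE) !mxform_delta !mxE !andbT.
by rewrite !mulr_natr.
Qed.

(** As F is alternating, zeta must be minus the symmetric part of xi, so a single matrix X carries
    both. *)
Lemma form2_of_entries (X : 'M[R]_d) :
  (forall i j l k, f i j l k + f k j l i =
     X i j *+ (l == k) + X k j *+ (l == i) - (X i k + X k i) *+ (l == j)) ->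
  forall a b c, F a b *m c + F c b *m a =
    mxform X a b *: c + mxform X c b *: a - (mxform X a c + mxform X c a) *: b.
Proof.
move=> H a b c; have [Fl Fr] := Fb; move: a c.
have bl : bilinear (fun a c => F a b *m c + F c b *m a).
  split=> [c|a] k u v; rewrite Fl !mulmxDl !mulmxDr -!scalemxAl -!scalemxAr;
  by apply/matrixP => r s; rewrite !(mxDE, mxZE); ring.
have br : bilinear (fun a c => mxform X a b *: c + mxform X c b *: a
    - (mxform X a c + mxform X c a) *: b).
  split=> [c|a] k u v; apply/matrixP => r s; rewrite !(mxDE, mxNE, mxZE) !(mxformDl, mxformDr); ring.
apply: (bilinear_ext bl br) => i k; move: b {bl br}.
have ll : linear (fun b => F (ev i) b *m ev k + F (ev k) b *m ev i).
  by move=> c u v; rewrite !Fr !mulmxDl -!scalemxAl; apply/matrixP => r s;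
    rewrite !(mxDE, mxZE); ring.
have lr : linear (fun b => mxform X (ev i) b *: ev k + mxform X (ev k) b *: ev i
    - (mxform X (ev i) (ev k) + mxform X (ev k) (ev i)) *: b).
  by move=> c u v; apply/matrixP => r s; rewrite !(mxDE, mxNE, mxZE) !mxformDr; ring.
apply: (linear_ext ll lr) => j; apply/matrixP => l s.
rewrite ord1 mxDE !colE_delta H !(mxDE, mxNE, mxZE) !mxform_delta !mxE !andbT.
by rewrite !mulr_natr.
Qed.

Hypotheses (d_even : ~~ odd d) (d4 : (4 <= d)%N) (Fc : curvCond F).

Lemma fresh2 (i k : 'I_d) : exists j, j \notin [:: i; k].
Proof. by apply: exists_fresh => /=; lia. Qed.

Lemma alt0 i l k : f i i l k = 0.
Proof. have := altE Fa i i l k; lra. Qed.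

Lemma off2' i j l : l \notin [:: i; j] -> f i j l i = 0.
Proof.
rewrite !inE !negb_or => /andP[li lj]; have [->|ij] := eqVneq i j; first exact: alt0.
by apply: curvCond_off2 => //; rewrite /= !inE !negb_or eq_sym li ij lj.
Qed.

Lemma curvCond_form3 : (6 <= d)%N -> exists Be Ga : 'M[R]_d, forall a b c,
  F a b *m c = mxform Be a c *: b - mxform Be b c *: a + mxform Ga a b *: c.
Proof.
move=> d6.
have off3 i j l k : uniq [:: i; l; j; k] -> f i j l k = 0 by exact: curvCond_off3.
have facts x y i (us : uniq [:: x; i; y]) := curvature_facts d_even d4 Fb Fa Fc us.
(* The e_j component of F(e_x, e_j) e_z does not depend on j outside x and z: by [curvature_facts]
   if x = z, by a shear otherwise. It defines beta. *)
have [be beE] : exists be : {ffun 'I_d * 'I_d -> R}, forall x j z, j \notin [:: x; z] ->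
    f x j j z = be (x, z).
  suff : forall xz : 'I_d * 'I_d, exists b : R, forall j, j \notin [:: xz.1; xz.2] ->
      f xz.1 j j xz.2 = b.
    move=> /fin_all_exists[b bE]; exists [ffun xz => b xz] => x j z.
    by rewrite ffunE; exact: (bE (x, z)).
  move=> [x z] /=; have [j0 j0n] := fresh2 x z; exists (f x j0 j0 z) => j jn.
  have [->//|jj] := eqVneq j j0.
  move: j0n jn; rewrite !inE !negb_or => /andP[j0x j0z] /andP[jx jz].
  have [xz|xz] := eqVneq x z.
    have us : uniq [:: x; j; j0] by solve_neqs.
    by subst z; have [] := facts _ _ _ us.
  have us : uniq [:: x; j; j0; z].
    by solve_neqs.
  have := sheared_off3 d_even d4 Fb Fc 1 d6 us (or_introl erefl).
  rewrite /= eqxx (negbTE (_ : z != j0)) 1?eq_sym// scale0r addr0 scale1r !mul1r !colE_delta.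
  have [_ Fr] := Fb; have [_ D _ _] := linear_facts (Fr (ev x)).
  rewrite D !mxDE (off3 x j0 j z)// (off3 x j j0 z) ?addr0 ?add0r//.
  by solve_neqs.
(* The diagonal entries of F(e_x, e_y) away from x and y agree and define gamma; those at x and y
   contain a beta term as well. *)
have [ga gaE] : exists ga : {ffun 'I_d * 'I_d -> R}, forall x y z, z \notin [:: x; y] ->
    f x y z z = ga (x, y).
  suff : forall xz : 'I_d * 'I_d, exists b : R, forall j, j \notin [:: xz.1; xz.2] ->
      f xz.1 xz.2 j j = b.
    move=> /fin_all_exists[b bE]; exists [ffun xz => b xz] => x j z.
    by rewrite ffunE; exact: (bE (x, j)).
  move=> [x y] /=; have [j0 j0n] := fresh2 x y; exists (f x y j0 j0) => j jn.
  have [->//|jj] := eqVneq j j0.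
  have [->|xy] := eqVneq x y; first by rewrite !alt0.
  move: j0n jn; rewrite !inE !negb_or => /andP[j0x j0y] /andP[jx jy].
  have us : uniq [:: x; j; y; j0].
    by solve_neqs.
  have := sheared_off3 d_even d4 Fb Fc 1 d6 us (or_intror erefl).
  rewrite /= eqxx (negbTE (_ : y != j0)) 1?eq_sym// scale0r addr0 scale1r !mul1r.
  rewrite !mulmxDr !mxDE !colE_delta (off3 x y j j0)// (off3 x y j0 j) ?addr0 ?add0r//.
  by solve_neqs.
exists (\matrix_(i, k) be (i, k)), (\matrix_(i, j) ga (i, j)).
apply: form3_of_entries => i j l k; rewrite !mxE.
have [<-{j}|ij] := eqVneq i j.
  have [z zn] := fresh2 i i.
  by rewrite alt0 subrr add0r -(gaE i i z zn) alt0 mul0rn.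
have gaN : ga (i, j) = - ga (j, i).
  have [z zn] := fresh2 i j; rewrite -(gaE i j z zn) (altE Fa) (gaE j i z)//.
  by move: zn; rewrite !inE !negb_or andbC.
have main i' j' l' : i' != j' -> f i' j' l' i' =
    be (i', i') *+ (l' == j') - be (j', i') *+ (l' == i') + ga (i', j') *+ (l' == i').
  move=> ij'; have [->|lj] := eqVneq l' j'.
    by rewrite beE ?inE ?negb_or eq_sym ?ij'// (negbTE ij') !mulr0n subr0 addr0.
  have [->|li] := eqVneq l' i'; last by rewrite off2' ?inE ?negb_or ?li ?lj// !mulr0n subr0 addr0.
  have [x xn] := fresh2 i' j'; move: (xn); rewrite !inE !negb_or => /andP[xi xj].
  have us : uniq [:: x; i'; j'] by solve_neqs.
  have [_ _ -> _] := facts _ _ _ us.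
  rewrite gaE// (altE Fa x) beE; first by rewrite !mulr1n mulr0n; ring.
  by rewrite !inE !negb_or xi xj.
have [->|ki] := eqVneq k i; first exact: main.
have [->|kj] := eqVneq k j.
  rewrite (altE Fa) main 1?eq_sym// gaN.
  by case: (l == j); case: (l == i); rewrite ?mulr0n ?mulr1n; ring.
have ji : (j == i) = false by rewrite eq_sym (negbTE ij).
have jk : (j == k) = false by rewrite eq_sym (negbTE kj).
have ik : (i == k) = false by rewrite eq_sym (negbTE ki).
have [->|lj] := eqVneq l j.
  by rewrite beE ?inE ?negb_or ?ji ?jk// !mulr0n subr0 addr0.
have [->|li] := eqVneq l i.
  by rewrite (altE Fa) beE ?inE ?negb_or ?ij ?ik// !mulr0n addr0 add0r.
have [->|lk] := eqVneq l k; first by rewrite gaE ?inE ?negb_or ?ki// !mulr0n !mulr1n subr0 add0r.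
rewrite off3; first by rewrite !mulr0n subr0 addr0.
by solve_neqs.
Qed.

Lemma curvCond_form2 : exists X : 'M[R]_d, forall a b c, F a b *m c + F c b *m a =
    mxform X a b *: c + mxform X c b *: a - (mxform X a c + mxform X c a) *: b.
Proof.
have facts x y i (us : uniq [:: x; i; y]) := curvature_facts d_even d4 Fb Fa Fc us.
have [z zE] : exists z : 'I_d -> R, forall i j, j != i -> f i j j i = z i.
  suff /fin_all_exists[z zE] : forall i : 'I_d, exists b : R, forall j, j != i -> f i j j i = b.
    by exists z.
  move=> i; have [j0 j0n] := fresh2 i i; exists (f i j0 j0 i) => j ji.
  have [->//|jj] := eqVneq j j0; move: j0n; rewrite !inE !negb_or => /andP[j0i _].
  have us : uniq [:: i; j; j0] by solve_neqs.
  by have [] := facts _ _ _ us.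
(* [z i] is to be zeta(e_i, e_i) = - xi(e_i, e_i), which fixes the diagonal of X. *)
pose X : 'M[R]_d := \matrix_(i, j) (if i == j then - z i else f i j i i).
have Xd i : X i i = - z i by rewrite mxE eqxx.
have Xo i j : i != j -> X i j = f i j i i by rewrite mxE => /negbTE ->.
exists X; apply: form2_of_entries => i j l k.
have main i' j' l' : i' != j' -> f i' j' l' i' = X i' j' *+ (l' == i') - X i' i' *+ (l' == j').
  move=> ij'; have [->|lj] := eqVneq l' j'.
    by rewrite eq_sym (negbTE ij') zE 1?eq_sym// Xd mulr0n mulr1n; ring.
  have [->|li] := eqVneq l' i'; last by rewrite off2' ?inE ?negb_or ?li ?lj// !mulr0n subr0.
  by rewrite Xo// mulr1n mulr0n subr0.
have [<-{k}|ik] := eqVneq i k.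
  have [<-|ij] := eqVneq i j; first by rewrite alt0; case: (l == i); rewrite ?mulr0n ?mulr1n; ring.
  by rewrite main//; case: (l == i); case: (l == j); rewrite ?mulr0n ?mulr1n; ring.
have [<-{j}|ij] := eqVneq i j.
  rewrite alt0 add0r (altE Fa) main//.
  by case: (l == i); case: (l == k); rewrite ?mulr0n ?mulr1n; ring.
have [<-{j ij}|kj] := eqVneq k j.
  rewrite alt0 addr0 (altE Fa) main 1?eq_sym//.
  by case: (l == i); case: (l == k); rewrite ?mulr0n ?mulr1n; ring.
have us : uniq [:: i; k; j] by solve_neqs.
have [_ e2 e3 e4] := facts _ _ _ us.
have [->|lk] := eqVneq l k.
  have ki : (k == i) = false by rewrite eq_sym (negbTE ik).
  rewrite ki (negbTE kj) !mulr0n !mulr1n Xo//; lra.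
have [->|li] := eqVneq l i.
  rewrite (negbTE ij) !mulr0n !mulr1n Xo//; lra.
have [->|lj] := eqVneq l j.
  have ki : k != i by rewrite eq_sym.
  rewrite !mulr0n mulr1n (Xo i k ik) (Xo k i ki).
  have := altE Fa k i k k; lra.
rewrite !mulr0n addr0 subr0 addrC.
by apply: (curvature_facts4 d_even d4 Fb Fa Fc us); rewrite !inE !negb_or li lk lj.
Qed.

End Forms.

(** * Sufficiency of the forms, and the ranks 2 and 4 *)

Section Converse.
Variables (R : realType) (d : nat).
Local Notation vect := 'cV[R]_d.
Local Notation ev j := (delta_mx j 0 : 'cV[R]_d).

Lemma mulmx_eq0 (A : 'M[R]_d) : (forall c : vect, A *m c = 0) -> A = 0.
Proof.
by move=> H; apply/matrixP => i j; rewrite -colE_delta H !mxE.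
Qed.

(** The gamma term is a scalar and commutes with J; the beta terms cancel by J^2 = -1. *)
Lemma form3_curvCond (F : vect -> vect -> 'M[R]_d) (be ga : vect -> vect -> R) :
  (forall a b c, F a b *m c = be a c *: b - be b c *: a + ga a b *: c) -> curvCond F.
Proof.
move=> H J JJ C a b; apply: mulmx_eq0 => c; rewrite /C.
have JJX (X : vect) : J *m (J *m X) = - X by rewrite mulmxA JJ mulNmx mul1mx.
rewrite !(mulmxDl, mulmxDr, mulNmx, mulmxN) -!mulmxA !JJX !H.
rewrite !(mulmxDr, mulmxN) -!scalemxAr !JJX !scalerN; zmod.
Qed.

(** J sends e_0 to e_1, and S is the coordinate projection onto the line of e_0; then J [S, J] e_0 =
    e_0. *)
Lemma complex_structure_noncentral : ~~ odd d -> (0 < d)%N ->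
  exists (J S : 'M[R]_d) (b : vect), J *m J = - 1%:M /\ J *m ((S *m J - J *m S) *m b) != 0.
Proof.
move=> de d0; have d1 : (1 < d)%N by lia.
pose i0 := Ordinal d0.
have [i1 i1n] : exists j, j \notin [:: i0] by exact: exists_fresh.
have i01 : i0 != i1 by move: i1n; rewrite inE eq_sym.
have [f [t [[fK tt] f0 t0]]] := pairing2 de i01 (oner_neq0 R).
have JJ := monomial_sqr fK tt.
exists (monomial_mx f t), (delta_mx i0 i0), (ev i0); split=> //.
apply/eqP => /matrixP/(_ i0 0); rewrite mx0E mulmxBl mulmxBr mxDE mxNE.
rewrite -!mulmxA monomial_delta// f0 t0 scale1r (mul_delta_mx_0 _ _ _ i01) mulmx0 !mx0E sub0r mul_delta_mx.
rewrite !mulmxA JJ mulNmx mul1mx !mxE !eqxx /=.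
by rewrite opprK => /eqP; rewrite oner_eq0.
Qed.
End Converse.

(** An alternating form on the plane is a multiple of the determinant, and a complex structure has
    determinant 1. *)
Lemma altern_dim2 (R : realType) (V : normedModType R)
    (T : 'cV[R]_2 -> 'cV[R]_2 -> V) (J : 'M[R]_2) :
  bilinear T -> (forall a b, T a b = - T b a) -> J *m J = - 1%:M ->
  forall a b, T (J *m a) (J *m b) = T a b.
Proof.
move=> bT Ta JJ; have [Tl Tr] := bT.
have bJ : bilinear (fun a b => T (J *m a) (J *m b)).
  by split=> [b|a] k u v; rewrite mulmxDr -scalemxAr (Tl, Tr).
apply: (bilinear_ext bJ bT).
pose i0 : 'I_2 := ord0; pose i1 : 'I_2 := lift ord0 ord0.
have E00 : J i0 i0 * J i0 i0 + J i0 i1 * J i1 i0 = -1.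
  by move/matrixP/(_ i0 i0): (JJ); rewrite !mxE !big_ord_recl big_ord0 addr0 mulr1n.
have E01 : J i0 i0 * J i0 i1 + J i0 i1 * J i1 i1 = 0.
  by move/matrixP/(_ i0 i1): (JJ); rewrite !mxE !big_ord_recl big_ord0 addr0 mulr0n oppr0.
have J01 : J i0 i1 != 0.
  apply/eqP => J0; move: E00; rewrite J0 mul0r addr0 => E.
  by have := sqr_ge0 (J i0 i0); rewrite expr2 E lerNr oppr0 ler10.
have J11 : J i1 i1 = - J i0 i0.
  by apply: (mulfI J01); rewrite mulrN; apply/eqP; rewrite -addr_eq0 addrC [J i0 i1 * J i0 i0]mulrC E01.
have detJ : J i0 i0 * J i1 i1 - J i1 i0 * J i0 i1 = 1 by rewrite J11; lra.
pose e0 : 'cV[R]_2 := delta_mx i0 0; pose e1 : 'cV[R]_2 := delta_mx i1 0.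
have JE j : J *m delta_mx j 0 = J i0 j *: e0 + J i1 j *: e1.
  by rewrite [LHS]delta_sum !big_ord_recl big_ord0 addr0 !colE_delta.
have T0 a : T a a = 0.
  have : 2 *: T a a = 0 by rewrite scaler_nat mulr2n {2}Ta subrr.
  by move/eqP; rewrite scaler_eq0 pnatr_eq0 => /eqP.
have key i j : T (J *m delta_mx i 0) (J *m delta_mx j 0) =
    (J i0 i * J i1 j - J i1 i * J i0 j) *: T e0 e1.
  rewrite !JE.
  have [_ D1 Z1 _] := linear_facts (Tl (J i0 j *: e0 + J i1 j *: e1)).
  have [_ D2 Z2 _] := linear_facts (Tr e0); have [_ D3 Z3 _] := linear_facts (Tr e1).
  rewrite D1 !Z1 D2 D3 !Z2 !Z3 !T0 !scaler0 add0r addr0 (Ta e1) !scalerN !scalerA scalerBl.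
  by [].
have c (i : 'I_2) : i = i0 \/ i = i1.
  by case: i => [[|[|//]] h]; [left|right]; apply: val_inj.
move=> i j; rewrite key; case: (c i) => ->; case: (c j) => ->.
- by rewrite mulrC subrr scale0r -/e0 T0.
- by rewrite detJ scale1r.
- by rewrite -opprB [J i1 i1 * _]mulrC [J i0 i1 * _]mulrC detJ scaleN1r -Ta.
- by rewrite mulrC subrr scale0r -/e1 T0.
Qed.

Lemma altern_dim2_torCond (R : realType) (T : 'cV[R]_2 -> 'cV[R]_2 -> 'cV[R]_2) :
  bilinear T -> (forall a b, T a b = - T b a) -> torCond T.
Proof.
move=> bT Ta J a b JJ; have [Tl Tr] := bT.
rewrite altern_dim2//; have := altern_dim2 bT Ta JJ a (J *m b).
rewrite mulmxA JJ mulNmx mul1mx; have [_ _ _ TN] := linear_facts (Tr (J *m a)).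
by rewrite TN => <-; rewrite mulmxN; zmod.
Qed.

Lemma altern_dim2_curvCond (R : realType) (F : 'cV[R]_2 -> 'cV[R]_2 -> 'M[R]_2) :
  bilinear F -> (forall a b, F a b = - F b a) -> curvCond F.
Proof.
move=> bF Fa J JJ C a b; have [Fl Fr] := bF.
rewrite /C altern_dim2//; have := altern_dim2 bF Fa JJ a (J *m b).
rewrite mulmxA JJ mulNmx mul1mx; have [_ _ _ FN] := linear_facts (Fr (J *m a)).
by rewrite FN => <-; rewrite !(mulmxBr, mulmxN, mulNmx); zmod.
Qed.

Section Dimension4.
Variable R : realType.
Local Notation vect := 'cV[R]_4.

Lemma complex_span (J : 'M[R]_4) (a b c : vect) : J *m J = - 1%:M -> a != 0 ->
  (exists x y, b = x *: a + y *: (J *m a)) \/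
  (exists x y z w, c = x *: a + y *: (J *m a) + z *: b + w *: (J *m b)).
Proof.
move=> JJ a0.
have JJX (X : vect) : J *m (J *m X) = - X by rewrite mulmxA JJ mulNmx mul1mx.
pose Q : 'M[R]_4 := \matrix_(i, j) (nth 0 [:: a; J *m a; b; J *m b] i) j 0.
have QE (u : 'rV[R]_4) : exists x y z w,
    (u *m Q)^T = x *: a + y *: (J *m a) + z *: b + w *: (J *m b) /\
    (x = 0 -> y = 0 -> z = 0 -> w = 0 -> u = 0).
  pose k0 : 'I_4 := inord 0; pose k1 : 'I_4 := inord 1.
  pose k2 : 'I_4 := inord 2; pose k3 : 'I_4 := inord 3.
  have all4 (i : 'I_4) : [\/ i = k0, i = k1, i = k2 | i = k3].
    case: i => [[|[|[|[|//]]]] h]; [apply: Or41|apply: Or42|apply: Or43|apply: Or44];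
    by apply: val_inj; rewrite /= inordK.
  exists (u 0 k0), (u 0 k1), (u 0 k2), (u 0 k3); split.
    apply/matrixP => i j; rewrite ord1 mxE mxE !big_ord_recl big_ord0 addr0 !(mxDE, mxZE).
    rewrite !mxE /= !addrA.
    by do !congr (_ + _); congr (u _ _ * _); apply: val_inj; rewrite /= inordK.
  by move=> x0 y0 z0 w0; apply/matrixP => i j; rewrite ord1 mx0E; case: (all4 j) => ->.
have [uQ|nQ] := boolP (Q \in unitmx).
  right; have [x [y [z [w [E _]]]]] := QE (c^T *m invmx Q).
  by exists x, y, z, w; rewrite -E -mulmxA mulVmx// mulmx1 trmxK.
left; have : kermx Q != 0 by rewrite kermx_eq0 row_free_unit.
move=> /rowV0Pn[u /sub_kermxP uQ u0]; have [x [y [z [w [E H]]]]] := QE u.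
rewrite uQ trmx0 in E.
have [zw|zw] := eqVneq (z * z + w * w) 0.
  have z0 : z = 0.
    by apply/eqP; rewrite -sqrf_eq0 expr2; apply/eqP; have := sqr_ge0 z; have := sqr_ge0 w; rewrite !expr2; lra.
  have w0 : w = 0.
    by apply/eqP; rewrite -sqrf_eq0 expr2; apply/eqP; have := sqr_ge0 z; have := sqr_ge0 w; rewrite !expr2; lra.
  rewrite z0 w0 !scale0r !addr0 in E.
  have : (x * x + y * y) *: a = 0.
    have E2 := f_equal (fun v => x *: v - y *: (J *m v)) E.
    rewrite mulmx0 !scaler0 subr0 mulmxDr -!scalemxAr JJX in E2.
    rewrite E2; apply/matrixP => r s; rewrite !(mxDE, mxNE, mxZE); ring.
  move/eqP; rewrite scaler_eq0 (negbTE a0) orbF => /eqP xy.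
  have x0 : x = 0.
    by apply/eqP; rewrite -sqrf_eq0 expr2; apply/eqP; have := sqr_ge0 x; have := sqr_ge0 y; rewrite !expr2; lra.
  have y0 : y = 0.
    by apply/eqP; rewrite -sqrf_eq0 expr2; apply/eqP; have := sqr_ge0 x; have := sqr_ge0 y; rewrite !expr2; lra.
  by move: u0; rewrite H// eqxx.
(* Applying z - w J, the conjugate of the complex coefficient z + w J of b, makes this coefficient
   the real number z^2 + w^2. *)
exists (- (z * x + w * y) / (z * z + w * w)), ((w * x - z * y) / (z * z + w * w)).
have E2 := f_equal (fun v => z *: v - w *: (J *m v)) E.
rewrite mulmx0 !scaler0 subr0 !mulmxDr -!scalemxAr !JJX in E2.
apply: (scalerI zw); apply/matrixP => r s.
have := f_equal (fun v : vect => v r s) E2.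
rewrite mx0E !(mxDE, mxNE, mxZE) => H2.
have cancel t v : (z * z + w * w) * (t / (z * z + w * w) * v) = t * v by field.
rewrite mulrDr !cancel; apply/eqP; rewrite -subr_eq0 [in X in _ == X]H2; apply/eqP; ring.
Qed.

(* The Nijenhuis expression [M a b] anticommutes with J, is J-antilinear in a and b, and kills
   a and b; in dimension 4 either a, J a, b, J b span everything or [M a b = 0]. *)
Lemma form2_curvCond (F : vect -> vect -> 'M[R]_4) (xi ze : vect -> vect -> R) :
  bilinear F -> (forall a b, F a b = - F b a) ->
  (forall a c, ze a c = ze c a) ->
  (forall a b c, F a b *m c + F c b *m a =
     xi a b *: c + xi c b *: a + (2 * ze a c) *: b) -> curvCond F.
Proof.
move=> bF Fa zeC H J JJ C a b; have [Fl Fr] := bF.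
have JJX n (X : 'M[R]_(4, n)) : J *m (J *m X) = - X by rewrite mulmxA JJ mulNmx mul1mx.
pose M a b := C (J *m a) (J *m b) - J *m C (J *m a) b - J *m C a (J *m b) - C a b.
rewrite -/(M a b).
have Ca u v : C u v = - C v u by rewrite /C Fa mulNmx mulmxN; zmod.
have CJ u v : C u v *m J = - (J *m C u v).
  by rewrite /C !(mulmxBl, mulmxBr, mulmxN) !mulmxA JJ -!mulmxA JJ !(mulmxN, mulNmx, mulmx1, mul1mx); zmod.
have Cl v : linear (C ^~ v).
  by move=> k u u'; rewrite /C Fl mulmxDl mulmxDr -scalemxAl -scalemxAr;
    apply/matrixP => r s; rewrite !(mxDE, mxNE, mxZE); ring.
have Cr u : linear (C u).
  by move=> k v v'; rewrite (Ca u) Cl (Ca v u) (Ca v' u);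
    apply/matrixP => r s; rewrite !(mxDE, mxNE, mxZE); ring.
have CN u v : C (- u) v = - C u v by have [_ _ _ ->] := linear_facts (Cl v).
have CNr u v : C u (- v) = - C u v by have [_ _ _ ->] := linear_facts (Cr u).
have CE u v : C u v = F u v *m J - J *m F u v by [].
clearbody C.
have Ma u v : M u v = - M v u.
  by rewrite /M (Ca (J *m u)) (Ca (J *m u) v) (Ca u (J *m v)) (Ca u v) !mulmxN; zmod.
have MJ u v : M u v *m J = - (J *m M u v).
  rewrite /M !(mulmxDl, mulNmx) -!mulmxA !CJ !(mulmxDr, mulmxN) !JJX; zmod.
have MJl u v : M (J *m u) v = - (J *m M u v).
  rewrite /M !JJX !(CN, CNr) !(mulmxDr, mulmxN) !JJX; zmod.
have Ml v : linear (M ^~ v).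
  move=> k u u'; rewrite /M !mulmxDr -!scalemxAr !Cl !mulmxDr -!scalemxAr.
  by apply/matrixP => r s; rewrite !(mxDE, mxNE, mxZE); ring.
have Mr u : linear (M u).
  by move=> k v v'; rewrite (Ma u) Ml (Ma v u) (Ma v' u);
    apply/matrixP => r s; rewrite !(mxDE, mxNE, mxZE); ring.
have H1 u v : F u v *m u = xi u v *: u + ze u u *: v.
  have n2 : (2 : R) != 0 by rewrite pnatr_eq0.
  apply: (scalerI n2); rewrite scaler_nat mulr2n H.
  by apply/matrixP => r s; rewrite !(mxDE, mxNE, mxZE); ring.
(* It trades F(J u, .) u for F(u, .) J u; the terms of the latter kind then cancel in pairs in
   [Mz]. *)
have H2 u v w : F w v *m u = - (F u v *m w) + (xi u v *: w + xi w v *: u + (2 * ze u w) *: v).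
  by rewrite -H; zmod.
have Mz u v : M u v *m u = 0.
  rewrite /M !CE !(mulmxDl, mulmxDr, mulNmx, mulmxN) -!mulmxA !JJX.
  rewrite !H1 (H2 u (J *m v) (J *m u)) (H2 u v (J *m u)).
  rewrite !(mulmxDr, mulmxN, JJX) -!scalemxAr !JJX.
  by apply/matrixP => r s; rewrite !(mxDE, mxNE, mxZE, mx0E); normalize_mulmx; ring.
apply: mulmx_eq0 => c.
have M0 v : M v v = 0.
  by apply/matrixP => r s; have := f_equal (fun X : 'M[R]_4 => X r s) (Ma v v); rewrite mxNE mx0E; lra.
have MM u v : M u v *m v = 0 by rewrite Ma mulNmx Mz oppr0.
have MJz u v w : M u v *m w = 0 -> M u v *m (J *m w) = 0.
  by move=> E; rewrite mulmxA MJ mulNmx -mulmxA E mulmx0 oppr0.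
have [->|a0] := eqVneq a 0; first by have [-> _ _ _] := linear_facts (Ml b); rewrite mul0mx.
have [[x [y ->]]|[x [y [z [w ->]]]]] := complex_span b c JJ a0.
  have [_ D Z _] := linear_facts (Mr a).
  by rewrite D !Z M0 (Ma a (J *m a)) MJl M0 mulmx0 !oppr0 !scaler0 addr0 mul0mx.
rewrite !mulmxDr -!scalemxAr MM Mz (MJz _ _ _ _ (MM _ _)) (MJz _ _ _ _ (Mz _ _)).
by rewrite !scaler0 !addr0.
Qed.

End Dimension4.

(** * Consequences for strongly suitable connections *)

Section Suitable.
Variables (R : realType) (p d : nat) (M : foliatedManifold R p d).
Variable nab : connection M.
Implicit Types (x v w e : vec R p d) (a b c : 'cV[R]_d).

Lemma curvN_bilinear i x : img i x -> bilinear (curvN nab i x).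
Proof.
move=> ix; split=> [b|a] k u v; rewrite /curvN embN_linear.
  exact: curvMx_linearl.
exact: curvMx_linearr.
Qed.

Lemma curvNC i x a b : curvN nab i x a b = - curvN nab i x b a.
Proof. exact: curvMxC. Qed.

Lemma torVecC i x v w : torVec nab i x v w = - torVec nab i x w v.
Proof. rewrite /torVec; zmod. Qed.

Lemma torVec_linearr i x v : img i x -> linear (torVec nab i x v).
Proof.
move=> ix k w w'; rewrite /torVec (conn_linear nab ix) (dsubmx_linear k w w').
by rewrite mulmxDr mulmxDl -scalemxAr -scalemxAl scalerBr; zmod.
Qed.

Lemma torVec_linearl i x w : img i x -> linear (fun v => torVec nab i x v w).
Proof.
move=> ix k v v'; rewrite torVecC (torVec_linearr w ix) opprD -scalerN.
by rewrite -!torVecC.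
Qed.

Lemma torN_bilinear i x : img i x -> bilinear (torN nab i x).
Proof.
move=> ix; split=> [b|a] k u v; rewrite /torN embN_linear.
  exact: torVec_linearl.
exact: torVec_linearr.
Qed.

Lemma torNC i x a b : torN nab i x a b = - torN nab i x b a.
Proof. exact: torVecC. Qed.

Hypotheses (d_even : ~~ odd d) (suit : stronglySuitable nab).

(** For fixed e in F, the curvature R(e, .) depends only on the transversal part of its argument and
    satisfies [leafCond], whose solutions are scalar. *)
Lemma leafScalar_suitable i : leafScalar nab i.
Proof.
move=> x e w ix Fe; have [adap pI] := suit.
pose B a := 'D_e (fun y => conn nab i y (embN p a)) x.
have BE a : B a = curvMx nab i x e (embN p a) by rewrite (curvMx_leaf adap _ ix Fe).
have Bl : linear B.
  by move=> k u v; rewrite !BE embN_linear (curvMx_linearr nab e ix).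
have Bc : leafCond B by move=> J a JJ; exact: (leaf_condition_I2 adap a pI ix Fe JJ).
have [l Bw] := leafCond_scalar d_even Bl Bc (dsubmx w).
by exists l; rewrite (curvMx_leaf_embN adap w ix Fe) -BE.
Qed.

Lemma projectable_I1 : projectable nab (@I1 R p d).
Proof.
have [adap _] := suit => i O s _ _.
exact: (foliatedSection_I1 adap (@leafScalar_suitable i)).
Qed.

Lemma integrable_I1P : integrable_acs nab (@I1 R p d) <->
  forall i x, img i x -> torCond (torN nab i x) /\ curvCond (curvN nab i x).
Proof.
have [adap _] := suit; split=> [[_ N] i x ix|H].
  split=> [J a b JJ|J JJ].
    by have [h _] := sliceNijenhuis0_I1_cond adap (@leafScalar_suitable i) (N i) ix JJ; exact: h.
  by have [_ h] := sliceNijenhuis0_I1_cond adap (@leafScalar_suitable i) (N i) ix JJ; exact: h.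
split=> [|i]; first exact: projectable_I1.
apply: (sliceNijenhuis0_I1 adap (@leafScalar_suitable i)) => x J ix JJ.
have [hT hF] := H i x ix; split=> [a b|]; first exact: hT.
exact: hF JJ.
Qed.

Lemma integrable_I2_false : (0 < d)%N -> ~ integrable_acs nab (@I2 R p d).
Proof.
move=> d0 [pI N]; have [adap _] := suit.
have [m _] := @carrier_nonempty R p d M; have [i im] := dom_cover m.
have ix : img i (chart i m) by exists m.
have [J [S [b [JJ /eqP]]]] := complex_structure_noncentral R d_even d0; apply.
exact: (sliceNijenhuis0_I2_false adap S b pI (N i) ix JJ).
Qed.

End Suitable.

(** * The forms of torsion and curvature, read at a point *)

Section PointwiseForms.
Variables (R : realType) (p d : nat) (M : foliatedManifold R p d).
Variable nab : connection M.
Implicit Types (x v w z : vec R p d).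
Implicit Types (a : chartIdx M -> vec R p d -> vec R p d -> R^o)
  (b c xi ze : chartIdx M -> vec R p d -> vec R p d -> vec R p d -> R^o).

Lemma isField_cst (i : chartIdx M) v : isField i (img i) (cst v).
Proof. by split=> //; [exact: img_openP|exact: smooth_cst]. Qed.

Lemma torsion_cst i x v w : img i x -> torsion nab i (cst v) (cst w) x = torVec nab i x v w.
Proof. by move=> ix; rewrite (torsionE nab (isField_cst i v) (isField_cst i w) ix). Qed.

Lemma curvature_cst i x v w s : img i x -> smooth (img i) s ->
  curvature nab i (cst v) (cst w) s x = curvMx nab i x v w *m s x.
Proof. by move=> ix ss; rewrite (curvatureE nab (isField_cst i v) (isField_cst i w) ss ix). Qed.

Lemma smooth_piN_cst (i : chartIdx M) v : smooth (img i) (piN (cst v : vec R p d -> vec R p d)).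
Proof. by apply: smooth_piN; [exact: img_openP|exact: smooth_cst]. Qed.

Lemma endoTr_mulmx (A : 'M[R]_d) : endoTr (fun u => A *m u) = \tr A.
Proof. by apply: eq_bigr => k _; rewrite colE_delta. Qed.

(** By tensoriality it suffices to insert constant fields on the whole chart image; the same
    reduction serves for the curvature below. *)
Lemma torsionFormP a : torsionForm nab a <-> forall i x v w, img i x ->
  torVec nab i x v w = a i x v *: dsubmx w - a i x w *: dsubmx v.
Proof.
split=> [H i x v w ix|H i W X Y fX fY x Wx].
  by rewrite -torsion_cst// (H i _ _ _ (isField_cst i v) (isField_cst i w) x ix).
by rewrite (torsionE nab fX fY Wx) H//; case: fX => _ + _; apply.
Qed.

Lemma curvatureForm3P b c : curvatureForm3 nab b c <-> forall i x v w z, img i x ->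
  curvMx nab i x v w *m dsubmx z =
    b i x v z *: dsubmx w - b i x w z *: dsubmx v + c i x v w *: dsubmx z.
Proof.
split=> [H i x v w z ix|H i W X Y Z fX fY fZ x Wx].
  have := H i _ _ _ _ (isField_cst i v) (isField_cst i w) (isField_cst i z) x ix.
  by rewrite (curvature_cst v w ix (smooth_piN_cst i z)).
have sZ : smooth W (piN Z) by case: fZ => oW _ Zs; exact: smooth_piN.
by rewrite (curvatureE nab fX fY sZ Wx) H//; case: fX => _ + _; apply.
Qed.

Lemma curvatureForm2P xi ze : curvatureForm2 nab xi ze <-> forall i x v w, img i x ->
  curvMx nab i x v w *m dsubmx v = xi i x v w *: dsubmx v + ze i x v v *: dsubmx w.
Proof.
split=> [H i x v w ix|H i W X Y fX fY x Wx].
  have := H i _ _ _ (isField_cst i v) (isField_cst i w) x ix.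
  by rewrite (curvature_cst v w ix (smooth_piN_cst i v)).
have sX : smooth W (piN X) by case: fX => oW _ Xs; exact: smooth_piN.
by rewrite (curvatureE nab fX fY sX Wx) H//; case: fX => _ + _; apply.
Qed.

Lemma curvatureForm2PolarP xi ze : curvatureForm2Polar nab xi ze <->
  forall i x v w z, img i x ->
  curvMx nab i x v w *m dsubmx z + curvMx nab i x z w *m dsubmx v =
    xi i x v w *: dsubmx z + xi i x z w *: dsubmx v + (2 * ze i x v z) *: dsubmx w.
Proof.
split=> [H i x v w z ix|H i W X Y Z fX fY fZ x Wx].
  have := H i _ _ _ _ (isField_cst i v) (isField_cst i w) (isField_cst i z) x ix.
  rewrite (curvature_cst v w ix (smooth_piN_cst i z)).
  by rewrite (curvature_cst z w ix (smooth_piN_cst i v)).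
have sX : smooth W (piN X) by case: fX => oW _ Xs; exact: smooth_piN.
have sZ : smooth W (piN Z) by case: fZ => oW _ Zs; exact: smooth_piN.
rewrite (curvatureE nab fX fY sZ Wx) (curvatureE nab fZ fY sX Wx).
by apply: H; case: fX => _ + _; apply.
Qed.

Lemma curvTraceOnFP b : curvTraceOnF nab b <-> forall i x v w, img i x -> inF w ->
  b i x v w = d%:R^-1 * \tr (curvMx nab i x v w).
Proof.
split=> [H i x v w ix Fw|H i W X Y fX fY FY x Wx].
  rewrite (H i _ _ _ (isField_cst i v) (isField_cst i w) (fun=> fun=> Fw) x ix).
  congr (_ * _); rewrite -endoTr_mulmx; apply: eq_bigr => k _.
  by rewrite curvature_cst//; exact: smooth_cst.
rewrite (H i x (X x) (Y x)); [|by case: fX => _ + _; apply|exact: FY].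
congr (_ * _); rewrite -endoTr_mulmx; apply: eq_bigr => k _.
by rewrite (curvatureE nab fX fY (smooth_cst W _) Wx).
Qed.

Lemma polarization (A B : 'M[R]_d) (u v w : 'cV[R]_d) (x y s t r : R) :
  (A + B) *m (u + v) = (x + y) *: (u + v) + (s + t + (t + r)) *: w ->
  A *m u = x *: u + s *: w -> B *m v = y *: v + r *: w ->
  A *m v + B *m u = x *: v + y *: u + (2 * t) *: w.
Proof.
rewrite mulmxDr !mulmxDl => E Eu Ev; move: E; rewrite Eu Ev.
move: (A *m v) (B *m u) => X Y /matrixP E; apply/matrixP => k l.
by have := E k l; rewrite !(mxDE, mxZE); lra.
Qed.

(** The formula is expanded at v + z and its values at v and at z are subtracted; conversely Z = X,
    followed by division by 2. *)
Lemma curvatureForm2_polar xi ze : tensor2 xi -> tensor2 ze -> symmetric2 ze ->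
  curvatureForm2 nab xi ze <-> curvatureForm2Polar nab xi ze.
Proof.
move=> [_ xl _ _] [zr zl _ _] zs; split=> [/curvatureForm2P H|/curvatureForm2PolarP H].
  apply/curvatureForm2PolarP => i x v w z ix.
  have [_ OD _ _] := linear_facts (curvMx_linearl nab w ix).
  have [_ xD _ _] := linear_facts (xl i x ix w).
  have [_ zD _ _] := linear_facts (zl i x ix (v + z)).
  have [_ zDv _ _] := linear_facts (zr i x ix v).
  have [_ zDz _ _] := linear_facts (zr i x ix z).
  have E := H i x (v + z) w ix.
  rewrite OD xD zD zDv zDz (zs i x ix z v) linearD in E.
  exact: polarization E (H i x v w ix) (H i x z w ix).
apply/curvatureForm2P => i x v w ix; have E := H i x v w v ix.
have n2 : (2 : R) != 0 by rewrite pnatr_eq0.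
apply: (scalerI n2); rewrite scaler_nat mulr2n E.
move: (xi i x v w) (ze i x v v) => ? ?.
by apply/matrixP => r s; rewrite !(mxDE, mxNE, mxZE); ring.
Qed.

End PointwiseForms.

(** * Coordinate changes *)

Section CoordinateChange.
Variables (R : realType) (p d : nat) (M : foliatedManifold R p d).
Implicit Types (i j : chartIdx M) (x v w : vec R p d) (u : 'cV[R]_d).

Lemma overlap_img i j x : overlap i j x -> img i x.
Proof. by case=> m [im _] <-; exists m. Qed.

Lemma trans_overlap i j x : overlap i j x -> overlap j i (trans i j x).
Proof. by case=> m [im jm] <-; exists m; rewrite /trans /= ?chartK. Qed.

Lemma trans_img i j x : overlap i j x -> img j (trans i j x).
Proof. by move=> /trans_overlap/overlap_img. Qed.

Lemma transK i j x : overlap i j x -> trans j i (trans i j x) = x.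
Proof. by case=> m [im jm] <-; rewrite /trans /= chartK// chartK. Qed.

Lemma open_overlap i j : open (overlap i j).
Proof.
rewrite openE => x ox; have ix := overlap_img ox; rewrite /interior.
have dj : nbhs (chartI i x) (dom j).
  apply: open_nbhs_nbhs; split; first exact: dom_open.
  by case: ox => m [im jm] <-; rewrite chartK.
have nx : nbhs x (img i) by apply: open_nbhs_nbhs; split=> //; exact: img_openP.
apply: filterS (filterI nx (chartI_cont ix dj)) => y [[m im <-]] /=.
by rewrite chartK// => jm; exists m.
Qed.

Arguments open_overlap : clear implicits.

Lemma transT_linear i j x : overlap i j x -> linear (transT i j x).
Proof.
move=> ox k u v; rewrite /transT.
by rewrite (smooth_linear (open_overlap i j) ox (trans_smooth i j)).
Qed.

Lemma trans_is_derive i j x v : overlap i j x ->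
  is_derive x v (trans i j) (transT i j x v).
Proof. by move=> ox; exact: smooth_is_derive (trans_smooth i j) ox. Qed.

Lemma is_derive_trans (V : normedModType R) i j (f : vec R p d -> V) x v : overlap i j x ->
  smooth (img j) f ->
  is_derive x v (fun y => f (trans i j y)) ('D_(transT i j x v) f (trans i j x)).
Proof.
move=> ox fs; apply: (total_derivative_comp (trans_is_derive v ox)).
exact: smooth_total_derivative (@img_openP R p d M j) (trans_img ox) fs.
Qed.

Lemma transT_inF i j x v : overlap i j x -> inF v -> inF (transT i j x v).
Proof. by move=> ox; exact: trans_foliated. Qed.

(** Coordinate changes preserve F, so the choice of the representative of a class in N F does not
    matter. *)
Lemma transN_piN i j x v : overlap i j x ->
  transN i j x (dsubmx v) = dsubmx (transT i j x v).
Proof.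
move=> ox; rewrite /transN -/(embN p (dsubmx v)).
have [_ TD _ TN] := linear_facts (transT_linear ox).
have := transT_inF ox (inF_sub_embN v); rewrite TD TN /inF linearB /= => /subr0_eq E.
exact: esym E.
Qed.

Lemma transTK i j x v : overlap i j x ->
  transT j i (trans i j x) (transT i j x v) = v.
Proof.
move=> ox; have oj := trans_overlap ox.
have H : is_derive x v (trans j i \o trans i j)
    (transT j i (trans i j x) (transT i j x v)).
  apply: (total_derivative_comp (trans_is_derive v ox)).
  exact: smooth_total_derivative (open_overlap j i) oj (trans_smooth j i).
have H' : is_derive x v (fun y => y)
    (transT j i (trans i j x) (transT i j x v)).
  by apply: near_eq_smooth_derive (open_overlap i j) ox _ H => y; exact: transK.
by case: H' => _ <-; rewrite derive_id.
Qed.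

Lemma transNK i j x u : overlap i j x ->
  transN j i (trans i j x) (transN i j x u) = u.
Proof.
move=> ox; rewrite [transN i j x u]/transN transN_piN; last exact: trans_overlap.
by rewrite transTK// embNK.
Qed.

Lemma transN_linear i j x : overlap i j x -> linear (transN i j x).
Proof.
move=> ox k u v; rewrite /transN -!/(embN p _) embN_linear (transT_linear ox).
by rewrite dsubmx_linear.
Qed.

Lemma smooth_transN i j u : smooth (overlap i j) (fun x => transN i j x u).
Proof.
apply: (smooth_lin (L := @dsubmx R p d 1) (open_overlap i j)); first exact: dsubmx_linear.
exact: smooth_derive (trans_smooth i j).
Qed.

(** The matrix of [transN]; with it the derivatives of the gauge law are matrix identities. *)
Definition transMx i j x : 'M[R]_d := \sum_k transN i j x (delta_mx k 0) *m delta_mx 0 k.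

Lemma transMxE i j x u : overlap i j x -> transMx i j x *m u = transN i j x u.
Proof.
move=> ox; rewrite {2}[u]delta_sum (linear_sum_coords _ _ (transN_linear ox)).
rewrite /transMx mulmx_suml; apply: eq_bigr => k _.
rewrite -mulmxA -rowE; apply/matrixP => r s; rewrite ord1 !mxE big_ord1 !mxE.
by rewrite mulrC.
Qed.

Lemma smooth_transMx i j : smooth (overlap i j) (transMx i j).
Proof.
apply: (smooth_bigsum (open_overlap i j)) => k.
apply: (smooth_mulmx (open_overlap i j)); first exact: smooth_transN.
exact: (smooth_cst _ (delta_mx 0 k)).
Qed.

End CoordinateChange.
Arguments open_overlap {R p d M} i j.
Arguments smooth_transMx {R p d M} i j.

Section Gauge.
Variables (R : realType) (p d : nat) (M : foliatedManifold R p d).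
Variable nab : connection M.
Implicit Types (i j : chartIdx M) (x v w : vec R p d) (u : 'cV[R]_d).

Lemma sub_cancel (V : zmodType) (a b A B C D : V) :
  a = A + C -> b = B + D -> A = B -> a - b = C - D.
Proof. by move=> -> -> ->; zmod. Qed.

(** The inhomogeneous terms of the gauge law are transversal parts of second derivatives of the
    coordinate change; these are symmetric and cancel. *)
Lemma torVec_gauge i j x v w : overlap i j x ->
  transN i j x (torVec nab i x v w) =
  torVec nab j (trans i j x) (transT i j x v) (transT i j x w).
Proof.
move=> ox.
have D a b : 'D_a (fun y => transN i j y (dsubmx b)) x =
    dsubmx ('D_a (fun y => 'D_b (trans i j) y) x).
  have H : is_derive x a (fun y => dsubmx ('D_b (trans i j) y))
      (dsubmx ('D_a (fun y => 'D_b (trans i j) y) x) : 'cV[R]_d).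
    apply: is_derive_piN; apply: smooth_is_derive ox.
    exact: smooth_derive (trans_smooth i j).
  have H' : is_derive x a (fun y => transN i j y (dsubmx b))
      (dsubmx ('D_a (fun y => 'D_b (trans i j) y) x)).
    apply: near_eq_smooth_derive (open_overlap i j) ox _ H => y oy.
    by rewrite transN_piN.
  by case: H'.
have [_ ND _ NN] := linear_facts (transN_linear ox).
have NB a b : transN i j x (a - b) = transN i j x a - transN i j x b by rewrite ND NN.
have E a b : transN i j x (conn nab i x a *m dsubmx b) =
    dsubmx ('D_a (fun y => 'D_b (trans i j) y) x)
    + conn nab j (trans i j x) (transT i j x a) *m dsubmx (transT i j x b).
  by rewrite -D -transN_piN//; exact: conn_gauge.
have S := smooth_schwarz v w (open_overlap i j) ox (trans_smooth i j).
apply: etrans (NB _ _) _; apply: sub_cancel (E v w) (E w v) _.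
exact: (f_equal (@dsubmx R p d 1) (esym S)).
Qed.

Lemma mulmx_ext (A B : 'M[R]_d) : (forall c : 'cV_d, A *m c = B *m c) -> A = B.
Proof. by move=> H; apply/subr0_eq/mulmx_eq0 => c; rewrite mulmxBl H subrr. Qed.

Lemma mulmx_addl_act (A B C : 'M[R]_d) (c : 'cV[R]_d) :
  (A + B *m C) *m c = A *m c + B *m (C *m c).
Proof. by rewrite mulmxDl mulmxA. Qed.

Lemma gauge_algebra (G A B C D A' B' C' D' Gv Gw Gvw Gwv K K' : 'M[R]_d) :
  G *m A = Gv + A' *m G -> G *m B = Gw + B' *m G ->
  Gw *m A + G *m C = Gvw + ((C' + K) *m G + A' *m Gw) ->
  Gv *m B + G *m D = Gwv + ((D' + K') *m G + B' *m Gv) -> Gvw = Gwv -> K = K' ->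
  G *m (D - C + (A *m B - B *m A)) = (D' - C' + (A' *m B' - B' *m A')) *m G.
Proof.
move=> EA EB EC ED EG EK; rewrite -{}EG -{}EK in ED.
have {}EC : G *m C = Gvw + ((C' + K) *m G + A' *m Gw) - Gw *m A by rewrite -EC; zmod.
have {}ED : G *m D = Gvw + ((D' + K) *m G + B' *m Gv) - Gv *m B by rewrite -ED; zmod.
have {}EA : Gv = G *m A - A' *m G by rewrite EA; zmod.
have {}EB : Gw = G *m B - B' *m G by rewrite EB; zmod.
rewrite !(mulmxDr, mulmxN, mulmxDl, mulNmx) EC ED EA EB.
by rewrite !(mulmxDr, mulmxN, mulmxDl, mulNmx) -!mulmxA; zmod.
Qed.

(** The gauge law G A = dG + A' G is differentiated once more; the second derivatives of G and of
    the coordinate change are symmetric and drop out. *)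
Lemma curvMx_gauge i j x v w u : overlap i j x ->
  transN i j x (curvMx nab i x v w *m u) =
  curvMx nab j (trans i j x) (transT i j x v) (transT i j x w) *m transN i j x u.
Proof.
move=> ox; rewrite -!transMxE// !mulmxA; congr (_ *m _).
have oO := open_overlap i j; have ix := overlap_img ox; have jx := trans_img ox.
pose G := transMx i j; pose A a y := conn nab i y a.
pose A' a y := conn nab j (trans i j y) (transT i j y a).
have gauge a y : overlap i j y -> G y *m A a y = 'D_a G y + A' a y *m G y.
  move=> oy; apply: mulmx_ext => c.
  have [_ E] : is_derive y a (fun y => transN i j y c) ('D_a G y *m c).
    apply: (near_eq_smooth_derive oO oy (f := fun y => G y *m c)) => [z oz|].
      exact: transMxE.
    apply: (is_derive_lin (L := fun X : 'M[R]_d => X *m c)); first exact: mulmx_linearl.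
    exact: smooth_is_derive (smooth_transMx i j) oy.
  have := conn_gauge nab oy a c; rewrite E -!transMxE// => H.
  exact: etrans (esym (mulmxA _ _ _)) (etrans H (esym (mulmx_addl_act _ _ _ _))).
have dG a : is_derive x a G ('D_a G x) by exact: smooth_is_derive (smooth_transMx i j) ox.
have dDG a b : is_derive x a (fun y => 'D_b G y) ('D_a (fun y => 'D_b G y) x).
  by apply: smooth_is_derive ox; exact: smooth_derive (smooth_transMx i j).
have dA a b : is_derive x a (A b) ('D_a (A b) x) by exact: conn_is_derive.
pose T := transT i j x.
have dA' a b : is_derive x a (A' b)
    ('D_(T a) (fun y => conn nab j y (T b)) (trans i j x)
     + conn nab j (trans i j x) ('D_a (fun y => 'D_b (trans i j) y) x)).
  have H c : is_derive x a (fun y => conn nab j (trans i j y) c)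
      ('D_(T a) (fun y => conn nab j y c) (trans i j x)).
    by apply: is_derive_trans ox _; exact: conn_smooth.
  have [_ <-] := H (T b).
  apply: (is_derive_param (U := overlap i j) (l := fun y => conn nab j (trans i j y))
    (Y := fun y => transT i j y b)) => //.
  - by move=> y oy; exact: conn_linear (trans_img oy).
  - by apply: smooth_is_derive ox; exact: smooth_derive (trans_smooth i j).
have key a b : 'D_a G x *m A b x + G x *m 'D_a (A b) x =
    'D_a (fun y => 'D_b G y) x +
    (('D_(T a) (fun y => conn nab j y (T b)) (trans i j x)
     + conn nab j (trans i j x) ('D_a (fun y => 'D_b (trans i j) y) x)) *m G x
     + A' b x *m 'D_a G x).
  have H1 := is_derive_mulmx (dG a) (dA a b).
  have H2 := is_derive_add (dDG a b) (is_derive_mulmx (dA' a b) (dG a)).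
  have H3 : is_derive x a (fun y => G y *m A b y) ('D_a (fun y => 'D_b G y) x +
    (('D_(T a) (fun y => conn nab j y (T b)) (trans i j x)
     + conn nab j (trans i j x) ('D_a (fun y => 'D_b (trans i j) y) x)) *m G x
     + A' b x *m 'D_a G x)).
    by apply: near_eq_smooth_derive oO ox _ H2 => y oy; rewrite gauge.
  by case: H3 => _ <-; case: H1.
have S1 := smooth_schwarz v w oO ox (smooth_transMx i j).
have S2 := f_equal (conn nab j (trans i j x)) (smooth_schwarz v w oO ox (trans_smooth i j)).
exact: gauge_algebra (gauge v x ox) (gauge w x ox) (key w v) (key v w) S1 S2.
Qed.

End Gauge.

(** * The tensors as traces of the torsion and the curvature *)

Section TraceFormulas.
Variables (R : realType) (p d : nat) (E : 'M[R]_(p + d, d)).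
Hypotheses (E1 : dsubmx E = 1%:M) (d3 : (3 <= d)%N).
Local Notation vect := (vec R p d).
Local Notation ev k := (delta_mx k 0 : 'cV[R]_d).
Local Notation bilinear b := (@bilinear R (p + d) R^o b).
Local Notation D := (d%:R : R).
Implicit Types (v w z : vect) (u : 'cV[R]_d).

Lemma dsubmx_section u : dsubmx (E *m u) = u.
Proof. by rewrite -mul_dsub_mx E1 mul1mx. Qed.

Lemma linear_section (f : vect -> R^o) v : linear f -> (forall w, inF w -> f w = 0) ->
  f (E *m dsubmx v) = f v.
Proof.
move=> fl f0; have [_ fD _ fN] := linear_facts fl.
apply/esym/subr0_eq; rewrite -fN -fD; apply: f0.
by rewrite /inF linearB /= dsubmx_section subrr.
Qed.

Lemma sum_coord (f : vect -> R^o) u : linear f ->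
  \sum_k f (E *m ev k) * u k 0 = f (E *m u).
Proof.
move=> fl; rewrite {2}[u]delta_sum mulmx_sumr.
under [in RHS]eq_bigr do rewrite -scalemxAr.
rewrite (linear_sum_coords (fun k => u k 0) (fun k => E *m ev k) fl).
by apply: eq_bigr => k _; rewrite mulrC.
Qed.

Lemma sum_diag (c : R) : \sum_(k < d) c * (ev k) k 0 = D * c.
Proof.
under eq_bigr do rewrite mxE !eqxx mulr1.
by rewrite sumr_const card_ord mulr_natl.
Qed.

Lemma mxtrace_section (A : 'M[R]_d) : \tr A = \sum_k (A *m dsubmx (E *m ev k)) k 0.
Proof. by apply: eq_bigr => k _; rewrite dsubmx_section colE_delta. Qed.

Let d_neq0 : D != 0. Proof. by rewrite pnatr_eq0; lia. Qed.
Let d1_neq0 : D - 1 != 0.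
Proof. by rewrite subr_eq0 pnatr_eq1; lia. Qed.
Let d2_gt0 : 0 < D - 2.
Proof. by rewrite subr_gt0 ltr_nat. Qed.

Lemma torsion_trace (T : vect -> vect -> 'cV[R]_d) (a : vect -> R^o) v :
  linear a -> (forall w, inF w -> a w = 0) ->
  (forall v w, T v w = a v *: dsubmx w - a w *: dsubmx v) ->
  a v = (D - 1)^-1 * \sum_k T v (E *m ev k) k 0.
Proof.
move=> al a0 H; apply: (mulfI d1_neq0); rewrite mulVKf//.
under eq_bigr do rewrite H mxDE mxNE !mxZE dsubmx_section.
by rewrite sumrB sum_diag sum_coord// linear_section// mulrBl mul1r.
Qed.

Variable Om : vect -> vect -> 'M[R]_d.

Definition ricci w u := \sum_k (Om (E *m ev k) w *m u) k 0.

Section Form3.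

(* On transversal arguments, [ricciPart v w = (1 - d + 1 / d) b v w - b w v / d]; this is
   solved for [b] by means of the transposed equation. *)
Definition ricciPart v w :=
  ricci (E *m dsubmx v) (dsubmx w) - D^-1 * \tr (Om (E *m dsubmx w) (E *m dsubmx v)).

Definition beta3 v w : R := let P := 1 - D + D^-1 in
  (P * ricciPart v w + D^-1 * ricciPart w v) / ((1 - D) * (1 - D + 2 * D^-1)).

Definition gamma3 v w : R := D^-1 * (\tr (Om v w) - beta3 v w + beta3 w v).

Variables b c : vect -> vect -> R^o.
Hypotheses (bb : bilinear b) (cb : bilinear c).
Hypothesis b0 : forall v w, inF v \/ inF w -> b v w = 0.
Hypothesis OmE : forall v w z,
  Om v w *m dsubmx z = b v z *: dsubmx w - b w z *: dsubmx v + c v w *: dsubmx z.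

Lemma form3_mxtrace v w : \tr (Om v w) = b v w - b w v + D * c v w.
Proof.
rewrite mxtrace_section; under eq_bigr do
  rewrite OmE !mxDE mxNE !mxZE dsubmx_section.
rewrite big_split /= sumrB sum_diag !sum_coord; try exact: bb.2.
by rewrite !linear_section//; try exact: bb.2; move=> z Fz; apply: b0; right.
Qed.

Lemma form3_ricci w z : ricci w (dsubmx z) = (1 - D) * b w z + c (E *m dsubmx z) w.
Proof.
rewrite /ricci; under eq_bigr do rewrite OmE !mxDE mxNE !mxZE dsubmx_section.
rewrite big_split /= sumrB sum_diag.
rewrite (sum_coord _ (bb.1 z)) (sum_coord _ (cb.1 w)).
rewrite (linear_section _ (bb.1 z)); first by rewrite mulrBl mul1r.
by move=> v Fv; apply: b0; left.
Qed.

Lemma beta3E v w : b v w = beta3 v w.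
Proof.
have bl v' w' : b (E *m dsubmx v') w' = b v' w'.
  by apply: (linear_section _ (bb.1 w')) => z Fz; apply: b0; left.
have br v' w' : b v' (E *m dsubmx w') = b v' w'.
  by apply: (linear_section _ (bb.2 v')) => z Fz; apply: b0; right.
have H v' w' : ricciPart v' w' = (1 - D + D^-1) * b v' w' - D^-1 * b w' v'.
  rewrite /ricciPart form3_mxtrace form3_ricci !bl !br.
  by move: (c _ _) (b _ _) (b _ _) => ? ? ?; field.
rewrite /beta3 !H; move: (b v w) (b w v) => x y; field.
have h := d2_gt0; rewrite d_neq0 /=.
(* This is D times the factor 1 - D + 2 / D of the determinant P^2 - D^-2 of the system for [b v w]
   and [b w v]. It vanishes for D = 2. *)
have -> : (1 - D) * D + 2 = - ((D - 2) * (D + 1)) by ring.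
have h1 : D + 1 != 0 by apply: lt0r_neq0; lra.
have h2 : D - 2 != 0 by exact: lt0r_neq0.
by rewrite oppr_eq0 mulf_neq0// -[1 - D]opprB oppr_eq0.
Qed.

Lemma gamma3E v w : c v w = gamma3 v w.
Proof.
rewrite /gamma3 -!beta3E form3_mxtrace.
by move: (c v w) (b v w) (b w v) => ? ? ?; field.
Qed.

End Form3.

Section Form2.

(* Contracting the polarized formula over z, and over w, gives two linear equations for the
   transversal parts of xi and zeta; the first one then determines xi. *)
Definition zeta2 v w : R :=
  - (ricci (E *m dsubmx w) (dsubmx v) + ricci (E *m dsubmx v) (dsubmx w)) / (2 * D - 2).

Definition xi2 v w : R :=
  D^-1 * (\tr (Om v w) + ricci w (dsubmx v) - 2 * zeta2 v w
    - (\tr (Om (E *m dsubmx v) w) + ricci w (dsubmx v) - 2 * zeta2 v w) / (D + 1)).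

Variables xi ze : vect -> vect -> R^o.
Hypotheses (xb : bilinear xi) (zb : bilinear ze).
Hypothesis z0 : forall v w, inF v \/ inF w -> ze v w = 0.
Hypothesis zs : forall v w, ze v w = ze w v.
Hypothesis OmC : forall v w, Om v w = - Om w v.
Hypothesis OmE : forall v w z, Om v w *m dsubmx z + Om z w *m dsubmx v =
  xi v w *: dsubmx z + xi z w *: dsubmx v + (2 * ze v z) *: dsubmx w.

Let zr v w : ze v (E *m dsubmx w) = ze v w.
Proof. by apply: (linear_section _ (zb.2 v)) => z Fz; apply: z0; right. Qed.

Lemma form2_trace1 v w : \tr (Om v w) + ricci w (dsubmx v) =
  D * xi v w + xi (E *m dsubmx v) w + 2 * ze v w.
Proof.
rewrite mxtrace_section /ricci -big_split /=; under eq_bigr do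
  rewrite -mxDE OmE !mxDE !mxZE dsubmx_section -mulrA.
rewrite !big_split /= sum_diag -mulr_sumr (sum_coord _ (xb.1 w)).
by rewrite (sum_coord _ (zb.2 v)) zr.
Qed.

Lemma form2_trace2 v z : - (ricci v (dsubmx z) + ricci z (dsubmx v)) =
  xi v (E *m dsubmx z) + xi z (E *m dsubmx v) + 2 * D * ze v z.
Proof.
rewrite /ricci -big_split /= -sumrN; under eq_bigr => k _.
  rewrite OmC mulNmx [Om _ z]OmC mulNmx -mxDE -mxNE.
  rewrite -opprD opprK OmE !mxDE !mxZE dsubmx_section. over.
rewrite !big_split /= sum_diag (sum_coord _ (xb.2 v)) (sum_coord _ (xb.2 z)).
by rewrite mulrCA mulrA.
Qed.

Lemma zeta2E v w : ze v w = zeta2 v w.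
Proof.
have h := d2_gt0; rewrite /zeta2.
have zl v' w' : ze (E *m dsubmx v') w' = ze v' w' by rewrite zs zr zs.
have A1 := form2_trace1 (E *m dsubmx v) (E *m dsubmx w).
have A2 := form2_trace1 (E *m dsubmx w) (E *m dsubmx v).
have B := form2_trace2 (E *m dsubmx v) (E *m dsubmx w).
rewrite !dsubmx_section !zl !zr (zs w v) in A1 A2 B.
have T : \tr (Om (E *m dsubmx w) (E *m dsubmx v)) = - \tr (Om (E *m dsubmx v) (E *m dsubmx w)).
  by rewrite OmC linearN.
rewrite T in A2; move: A1 A2 B {T}.
move: (\tr _) (ricci _ _) (ricci _ _) (xi _ _) (xi _ _) (ze v w) => t r1 r2 x y z A1 A2 B.
have h2 : 2 * D - 2 != 0 by apply: lt0r_neq0; lra.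
have h3 : D + 2 != 0 by apply: lt0r_neq0; lra.
(* Eliminating x + y gives (D + 2) s = - 2 (D + 2) (D - 1) z for s = r1 + r2; the common factor D +
   2 is cancelled. *)
apply: (mulIf h2); rewrite divfK//; apply: (mulfI h3).
have S : x + y = - (r1 + r2) - 2 * D * z by move: B; lra.
have A : r1 + r2 = (D + 1) * (x + y) + 4 * z.
  have -> : r1 + r2 = (t + r2) + (- t + r1) by ring.
  by rewrite A1 A2; ring.
rewrite S in A; move: A; rewrite [r2 + r1]addrC; move: (r1 + r2) => s /eqP; rewrite -subr_eq0 => /eqP A.
by apply/eqP; rewrite -subr_eq0; apply/eqP; rewrite -[RHS]A; ring.
Qed.

(** For a first argument in the complement, the contraction [form2_trace1] determines xi with the
    coefficient D + 1; this value then determines xi for an arbitrary first argument. *)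
Lemma xi2E v w : xi v w = xi2 v w.
Proof.
have h := d2_gt0; have h1 : D + 1 != 0 by apply: lt0r_neq0; lra.
have zl : ze (E *m dsubmx v) w = ze v w by rewrite zs zr zs.
have A1 := form2_trace1 v w; have A2 := form2_trace1 (E *m dsubmx v) w.
rewrite dsubmx_section zl in A2.
rewrite /xi2 A1 A2 zeta2E; move: (xi _ _) (xi _ _) (zeta2 _ _) => x y z; field.
by rewrite d_neq0 h1.
Qed.

End Form2.
End TraceFormulas.

Section TraceDependence.
Variables (R : realType) (p d : nat) (E : 'M[R]_(p + d, d)).
Variables Om Om' : vec R p d -> vec R p d -> 'M[R]_d.
Hypothesis same_tr : forall v w, \tr (Om v w) = \tr (Om' v w).
Hypothesis same_ricci : forall w u, ricci E Om w u = ricci E Om' w u.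

Lemma beta3_ext v w : beta3 E Om v w = beta3 E Om' v w.
Proof. by rewrite /beta3 /ricciPart !same_ricci !same_tr. Qed.

Lemma gamma3_ext v w : gamma3 E Om v w = gamma3 E Om' v w.
Proof. by rewrite /gamma3 !beta3_ext same_tr. Qed.

Lemma zeta2_ext v w : zeta2 E Om v w = zeta2 E Om' v w.
Proof. by rewrite /zeta2 !same_ricci. Qed.

Lemma xi2_ext v w : xi2 E Om v w = xi2 E Om' v w.
Proof. by rewrite /xi2 zeta2_ext !same_ricci !same_tr. Qed.

End TraceDependence.

(** * Existence of the coefficients at a point *)

Section PointwiseExistence.
Variables (R : realType) (p d : nat) (M : foliatedManifold R p d).
Variable nab : connection M.
Hypotheses (d_even : ~~ odd d) (d4 : (4 <= d)%N) (suit : stronglySuitable nab).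
Implicit Types (i j : chartIdx M) (x v w z : vec R p d).
Local Notation D := (d%:R : R).
Local Notation Om i x := (curvMx nab i x).

Definition coordSection : 'M[R]_(p + d, d) := col_mx 0 1%:M.
Local Notation E0 := coordSection.

Lemma coordSectionP : dsubmx E0 = 1%:M. Proof. exact: col_mxKd. Qed.

Let d3 : (3 <= d)%N. Proof. exact: ltnW. Qed.
Let adap : adapted nab. Proof. by case: suit. Qed.

(** The candidates are the trace formulas for the coordinate complement of each chart, which are
    visibly smooth. That they satisfy the required identities follows by comparison with the
    coefficients found algebraically at each point. *)
Definition alphaOf i x v : R^o := (D - 1)^-1 * \sum_k torVec nab i x v (E0 *m delta_mx k 0) k 0.
Definition betaOf i x v w : R^o := beta3 E0 (Om i x) v w.
Definition gammaOf i x v w : R^o := gamma3 E0 (Om i x) v w.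
Definition xiOf i x v w : R^o := xi2 E0 (Om i x) v w.
Definition zetaOf i x v w : R^o := zeta2 E0 (Om i x) v w.

Lemma alphaOf_spec i x : img i x -> torCond (torN nab i x) ->
  [/\ linear (alphaOf i x), forall v, inF v -> alphaOf i x v = 0
    & forall v w, torVec nab i x v w =
        alphaOf i x v *: dsubmx w - alphaOf i x w *: dsubmx v].
Proof.
move=> ix Tc; have bT := torN_bilinear nab ix.
pose a v : R^o := d.-1%:R^-1 * \sum_k torN nab i x (dsubmx v) (delta_mx k 0) k 0.
have al : linear a.
  move=> k v w; rewrite /a linearP /=.
  under eq_bigr do rewrite (bT.1 _ k) mxDE mxZE.
  rewrite big_split /= -mulr_sumr mulrDr /GRing.scale /=.
  by congr (_ + _); exact: mulrCA.
have a0 v : inF v -> a v = 0.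
  move=> Fv; rewrite /a Fv big1 ?mulr0// => k _.
  by have [-> _ _ _] := linear_facts (bT.1 (delta_mx k 0)); rewrite mx0E.
have TE v w : torVec nab i x v w = a v *: dsubmx w - a w *: dsubmx v.
  rewrite torVec_embN//.
  exact: (torCond_form d_even d4 bT (torNC nab i x) Tc (dsubmx v) (dsubmx w)).
suff -> : alphaOf i x = a by [].
by apply/funext => v; rewrite (torsion_trace coordSectionP d3 v al a0 TE).
Qed.

(** By [leafScalar] the curvature differs from that of the transversal parts by a scalar matrix; the
    normalized trace extracts this scalar. *)
Definition leafTrace i x v w : R^o :=
  D^-1 * (\tr (Om i x v w) - \tr (curvN nab i x (dsubmx v) (dsubmx w))).

Lemma bilinear_dsubmx (V : normedModType R) (B : 'cV[R]_d -> 'cV[R]_d -> V) :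
  bilinear B -> bilinear (fun v w : vec R p d => B (dsubmx v) (dsubmx w)).
Proof. by move=> [Bl Br]; split=> [w|v] k a b; rewrite linearP /= (Bl, Br). Qed.

Lemma curvMx_bilinear i x : img i x -> bilinear (Om i x).
Proof. by move=> ix; split=> [w|v]; [exact: curvMx_linearl|exact: curvMx_linearr]. Qed.

Lemma leafTrace_bilinear i x : img i x -> bilinear (leafTrace i x).
Proof.
move=> ix; have bO := curvMx_bilinear ix.
have bC := bilinear_dsubmx (curvN_bilinear nab ix).
have H (a b a' b' : 'M[R]_d) k : D^-1 * (\tr (k *: a + b) - \tr (k *: a' + b')) =
    k * (D^-1 * (\tr a - \tr a')) + D^-1 * (\tr b - \tr b').
  by rewrite !mxtraceD !mxtraceZ; ring.
split=> [w|v] k a b; rewrite /leafTrace.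
  by rewrite (bO.1 w) (bC.1 w); exact: H.
by rewrite (bO.2 v) (bC.2 v); exact: H.
Qed.

Lemma leaf_sum (A B C X Y : 'M[R]_d) : A = X + B -> B = - Y + C -> A = C + (X - Y).
Proof. by move=> -> ->; zmod. Qed.

Lemma leaf_polar (A B F G : 'M[R]_d) (k l : R) (u v w : 'cV[R]_d) :
  A = F + k%:M -> B = G + l%:M -> F *m u + G *m v = w ->
  A *m u + B *m v = w + (k *: u + l *: v).
Proof. by move=> -> -> <-; rewrite !mulmxDl !mul_scalar_mx; zmod. Qed.

Lemma curvMx_transversal i x v w : img i x ->
  Om i x v w = curvN nab i x (dsubmx v) (dsubmx w) + (leafTrace i x v w)%:M.
Proof.
move=> ix; have [l E] : exists l : R,
    Om i x v w = curvN nab i x (dsubmx v) (dsubmx w) + l%:M.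
  have [_ Dl _ _] := linear_facts (curvMx_linearl nab w ix).
  have [_ Dr _ _] := linear_facts (curvMx_linearr nab (embN p (dsubmx v)) ix).
  have leafS := leafScalar_suitable d_even suit (i := i).
  have [l1 H1] := leafS x _ w ix (inF_sub_embN v).
  have [l2 H2] := leafS x _ (embN p (dsubmx v)) ix (inF_sub_embN w).
  have E1 := Dl (v - embN p (dsubmx v)) (embN p (dsubmx v)); rewrite subrK H1 in E1.
  have E2 := Dr (w - embN p (dsubmx w)) (embN p (dsubmx w)).
  rewrite subrK (curvMxC nab i x _ (w - _)) H2 in E2.
  exists (l1 - l2); have -> : (l1 - l2)%:M = l1%:M - l2%:M :> 'M[R]_d by rewrite raddfB.
  exact: leaf_sum E1 E2.
suff -> : leafTrace i x v w = l by [].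
have d0 : D != 0 by rewrite pnatr_eq0; lia.
rewrite /leafTrace E linearD /= mxtrace_scalar.
by move: (\tr _) => t; rewrite -[l *+ d]mulr_natr; field.
Qed.

Lemma leafTrace_leaf i x v w : img i x -> inF w ->
  leafTrace i x v w = D^-1 * \tr (Om i x v w).
Proof.
move=> ix Fw; rewrite /leafTrace Fw.
have [-> _ _ _] := linear_facts ((curvN_bilinear nab ix).2 (dsubmx v)).
by rewrite linear0 subr0.
Qed.

Lemma leafTrace_alt i x v : leafTrace i x v v = 0.
Proof.
have tr0 (A : 'M[R]_d) : A = - A -> \tr A = 0.
  by move=> /(f_equal mxtrace); rewrite linearN /=; lra.
by rewrite /leafTrace (tr0 _ (curvMxC nab i x v v)) (tr0 _ (curvNC nab i x _ _)) subrr mulr0.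
Qed.

Lemma mxform_bilinear (B : 'M[R]_d) : bilinear (fun a b => mxform B a b : R^o).
Proof. by split=> [b|a]; [exact: mxform_linearl|exact: mxform_linearr]. Qed.

Lemma mxform0 (B : 'M[R]_d) a b : a = 0 \/ b = 0 -> mxform B a b = 0.
Proof.
by case=> ->; rewrite /mxform ?mulmx0 ?trmx0 ?mul0mx mx0E.
Qed.

Lemma betaOf_spec i x : (6 <= d)%N -> img i x -> curvCond (curvN nab i x) ->
  [/\ bilinear (betaOf i x) /\ bilinear (gammaOf i x),
      forall v w, inF v \/ inF w -> betaOf i x v w = 0,
      forall v, gammaOf i x v v = 0,
      forall v w, inF w -> gammaOf i x v w = D^-1 * \tr (Om i x v w)
    & forall v w z, Om i x v w *m dsubmx z = betaOf i x v z *: dsubmx w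
        - betaOf i x w z *: dsubmx v + gammaOf i x v w *: dsubmx z].
Proof.
move=> d6 ix Fc; have bF := curvN_bilinear nab ix.
have [Be [Ga H]] := curvCond_form3 bF (curvNC nab i x) d_even d4 Fc d6.
pose b v w : R^o := mxform Be (dsubmx v) (dsubmx w).
(* The leaf contribution is scalar, so gamma absorbs it. *)
pose c v w : R^o := mxform Ga (dsubmx v) (dsubmx w) + leafTrace i x v w.
have bb : bilinear b by exact: bilinear_dsubmx (mxform_bilinear Be).
have cb : bilinear c.
  have [g1 g2] := bilinear_dsubmx (mxform_bilinear Ga).
  have [l1 l2] := leafTrace_bilinear ix.
  split=> [w|v] k u u'; rewrite /c.
    by rewrite (g1 w) (l1 w) scalerDr addrACA.
  by rewrite (g2 v) (l2 v) scalerDr addrACA.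
have b0 v w : inF v \/ inF w -> b v w = 0 by exact: mxform0.
have OE v w z : Om i x v w *m dsubmx z =
    b v z *: dsubmx w - b w z *: dsubmx v + c v w *: dsubmx z.
  by rewrite curvMx_transversal// mulmxDl H mul_scalar_mx scalerDl addrA.
have -> : betaOf i x = b.
  apply/funext => v; apply/funext => w.
  exact: esym (beta3E coordSectionP d3 bb cb b0 OE v w).
have -> : gammaOf i x = c.
  apply/funext => v; apply/funext => w.
  exact: esym (gamma3E coordSectionP d3 bb cb b0 OE v w).
split=> //.
(* At equal arguments the curvature vanishes and the two beta terms cancel, so gamma times the
   identity is zero. *)
- move=> v; rewrite /c leafTrace_alt addr0; apply/eqP/negPn/negP => g0.
  have := H (dsubmx v) (dsubmx v).
  have -> : curvN nab i x (dsubmx v) (dsubmx v) = 0.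
    apply/matrixP => r s; have := f_equal (fun X : 'M[R]_d => X r s)
      (curvNC nab i x (dsubmx v) (dsubmx v)).
    by rewrite mxNE mx0E; lra.
  move: g0; move: (mxform Ga _ _) => g g0 H0.
  pose k : 'I_d := Ordinal (leq_trans (isT : (0 < 4)%N) d4).
  have := f_equal (fun X : 'cV[R]_d => X k 0) (H0 (delta_mx k 0)).
  rewrite mul0mx subrr add0r mx0E mxZE mxE !eqxx mulr1 => /esym/eqP.
  by rewrite (negbTE g0).
- by move=> v w Fw; rewrite /c leafTrace_leaf// mxform0 ?add0r//; right.
Qed.

Lemma xiOf_spec i x : img i x -> curvCond (curvN nab i x) ->
  [/\ bilinear (xiOf i x) /\ bilinear (zetaOf i x),
      forall v w, inF v \/ inF w -> zetaOf i x v w = 0,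
      forall v w, zetaOf i x v w = zetaOf i x w v,
      forall v w, inF w -> xiOf i x v w = D^-1 * \tr (Om i x v w)
    & forall v w z, Om i x v w *m dsubmx z + Om i x z w *m dsubmx v =
        xiOf i x v w *: dsubmx z + xiOf i x z w *: dsubmx v
        + (2 * zetaOf i x v z) *: dsubmx w].
Proof.
move=> ix Fc; have bF := curvN_bilinear nab ix.
have [X H] := curvCond_form2 bF (curvNC nab i x) d_even d4 Fc.
(* The leaf scalar goes into xi, and zeta is minus the symmetric part of X. *)
pose c v w : R^o := mxform X (dsubmx v) (dsubmx w) + leafTrace i x v w.
pose b v w : R^o := - 2^-1 * (mxform X (dsubmx v) (dsubmx w) + mxform X (dsubmx w) (dsubmx v)).
have [g1 g2] := bilinear_dsubmx (mxform_bilinear X).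
have cb : bilinear c.
  have [l1 l2] := leafTrace_bilinear ix.
  split=> [w|v] k u u'; rewrite /c.
    by rewrite (g1 w) (l1 w) scalerDr addrACA.
  by rewrite (g2 v) (l2 v) scalerDr addrACA.
have bb : bilinear b.
  split=> [w|v] k u u'; rewrite /b.
    by rewrite (g1 w) (g2 w) /GRing.scale /=; ring.
  by rewrite (g1 v) (g2 v) /GRing.scale /=; ring.
have bs v w : b v w = b w v by rewrite /b addrC.
have b0 v w : inF v \/ inF w -> b v w = 0.
  by move=> F0; rewrite /b !mxform0 ?addr0 ?mulr0//; case: F0; [right|left].
have OE v w z : Om i x v w *m dsubmx z + Om i x z w *m dsubmx v =
    c v w *: dsubmx z + c z w *: dsubmx v + (2 * b v z) *: dsubmx w.
  apply: etrans (leaf_polar (curvMx_transversal v w ix) (curvMx_transversal z w ix)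
    (H (dsubmx v) (dsubmx w) (dsubmx z))) _; rewrite /c /b.
  move: (mxform X _ _) (mxform X _ _) (mxform X _ _) (mxform X _ _) => x1 x2 x3 x4.
  move: (leafTrace _ _ _ _) (leafTrace _ _ _ _) => l1 l2.
  by apply/matrixP => r s; rewrite !(mxDE, mxNE, mxZE); field.
have -> : zetaOf i x = b.
  apply/funext => v; apply/funext => w.
  exact: esym (zeta2E coordSectionP d3 cb bb b0 bs (curvMxC nab i x) OE v w).
have -> : xiOf i x = c.
  apply/funext => v; apply/funext => w.
  exact: esym (xi2E coordSectionP d3 cb bb b0 bs (curvMxC nab i x) OE v w).
split=> // v w Fw.
by rewrite /c leafTrace_leaf// mxform0 ?add0r//; right.
Qed.

End PointwiseExistence.

(** * Smoothness of the trace formulas *)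

Section Smoothness.
Variables (R : realType) (p d : nat) (M : foliatedManifold R p d).
Variable nab : connection M.
Implicit Types (i : chartIdx M) (v w : vec R p d).
Local Notation D := (d%:R : R).

Section Scalars.
Variables (V : normedModType R) (U : set V) (oU : open U).
Implicit Types f g : V -> R^o.

Lemma smooth_mulr (c : R) f : smooth U f -> smooth U (fun x => c * f x : R^o).
Proof.
apply: (smooth_lin (L := fun r : R^o => c * r : R^o) oU) => k u v.
by rewrite /GRing.scale /= mulrDr mulrCA.
Qed.

Lemma smooth_mull (c : R) f : smooth U f -> smooth U (fun x => f x * c : R^o).
Proof.
move=> fs; apply: (smooth_ext oU _ (smooth_mulr c fs)) => x _; exact: mulrC.
Qed.

Lemma smooth_sub_fun f g : smooth U f -> smooth U g -> smooth U (fun x => f x - g x : R^o).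
Proof. by move=> fs gs; apply: (smooth_add oU fs); exact: smooth_opp. Qed.

Lemma smooth_coord (f : V -> 'cV[R]_d) k : smooth U f -> smooth U (fun x => f x k 0 : R^o).
Proof.
apply: (smooth_lin (L := fun c : 'cV[R]_d => c k 0 : R^o) oU) => a u v.
by rewrite mxDE mxZE.
Qed.

Lemma smooth_mxtrace (f : V -> 'M[R]_d) : smooth U f -> smooth U (fun x => \tr (f x) : R^o).
Proof.
apply: (smooth_lin (L := fun c : 'M[R]_d => \tr c : R^o) oU) => a u v.
by rewrite mxtraceD mxtraceZ.
Qed.

End Scalars.

Lemma smooth_curvMx i v w : smooth (img i) (fun x => curvMx nab i x v w).
Proof.
have oU := @img_openP R p d M i.
have s u := conn_smooth nab i u.
apply: (smooth_add oU).
  apply: (smooth_add oU); first exact: smooth_derive (s w).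
  by apply: (smooth_opp oU); exact: smooth_derive (s v).
apply: (smooth_add oU); first exact: smooth_mulmx oU (s v) (s w).
by apply: (smooth_opp oU); exact: smooth_mulmx oU (s w) (s v).
Qed.

Lemma smooth_torVec i v w : smooth (img i) (fun x => torVec nab i x v w).
Proof.
have oU := @img_openP R p d M i.
have s u (u' : vec R p d) : smooth (img i) (fun x => conn nab i x u *m dsubmx u').
  exact: smooth_mulmx oU (conn_smooth nab i u) (smooth_cst _ (dsubmx u')).
exact: smooth_add oU (s v w) (smooth_opp oU (s w v)).
Qed.

Lemma smooth_ricci i w (u : 'cV[R]_d) :
  smooth (img i) (fun x => ricci (coordSection R p d) (curvMx nab i x) w u : R^o).
Proof.
have oU := @img_openP R p d M i.
apply: (smooth_bigsum oU) => k; apply: (smooth_coord oU).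
by apply: (smooth_mulmx oU) (smooth_cst _ u); exact: smooth_curvMx.
Qed.

Lemma smooth_curvTrace i v w : smooth (img i) (fun x => \tr (curvMx nab i x v w) : R^o).
Proof. by apply: (smooth_mxtrace (@img_openP R p d M i)); exact: smooth_curvMx. Qed.

Lemma smooth_alphaOf i v : smooth (img i) (fun x => alphaOf nab i x v).
Proof.
have oU := @img_openP R p d M i.
apply: (smooth_mulr oU); apply: (smooth_bigsum oU) => k; apply: (smooth_coord oU).
exact: smooth_torVec.
Qed.

Lemma smooth_betaOf i v w : smooth (img i) (fun x => betaOf nab i x v w).
Proof.
have oU := @img_openP R p d M i.
have H v' w' : smooth (img i) (fun x =>
    ricciPart (coordSection R p d) (curvMx nab i x) v' w' : R^o).
  apply: (smooth_sub_fun oU); first exact: smooth_ricci.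
  by apply: (smooth_mulr oU); exact: smooth_curvTrace.
by apply: (smooth_mull oU); apply: (smooth_add oU); apply: (smooth_mulr oU).
Qed.

Lemma smooth_gammaOf i v w : smooth (img i) (fun x => gammaOf nab i x v w).
Proof.
have oU := @img_openP R p d M i.
apply: (smooth_mulr oU); apply: (smooth_add oU); last exact: smooth_betaOf.
by apply: (smooth_sub_fun oU); [exact: smooth_curvTrace|exact: smooth_betaOf].
Qed.

Lemma smooth_zetaOf i v w : smooth (img i) (fun x => zetaOf nab i x v w).
Proof.
have oU := @img_openP R p d M i.
by apply: (smooth_mull oU); apply: (smooth_opp oU); apply: (smooth_add oU); exact: smooth_ricci.
Qed.

Lemma smooth_xiOf i v w : smooth (img i) (fun x => xiOf nab i x v w).
Proof.
have oU := @img_openP R p d M i.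
have H v' : smooth (img i) (fun x => \tr (curvMx nab i x v' w)
    + ricci (coordSection R p d) (curvMx nab i x) w (dsubmx v)
    - 2 * zeta2 (coordSection R p d) (curvMx nab i x) v w : R^o).
  apply: (smooth_sub_fun oU); last by apply: (smooth_mulr oU); exact: smooth_zetaOf.
  by apply: (smooth_add oU); [exact: smooth_curvTrace|exact: smooth_ricci].
apply: (smooth_mulr oU); apply: (smooth_sub_fun oU); first exact: H.
by apply: (smooth_mull oU); exact: H.
Qed.

End Smoothness.

(** * Invariance under coordinate changes and existence of the tensors *)

Section GaugeInvariance.
Variables (R : realType) (p d : nat) (M : foliatedManifold R p d).
Variable nab : connection M.
Hypotheses (d_even : ~~ odd d) (d4 : (4 <= d)%N) (suit : stronglySuitable nab).
Implicit Types (i j : chartIdx M) (x v w z : vec R p d).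
Local Notation D := (d%:R : R).

Let d3 : (3 <= d)%N. Proof. exact: ltnW. Qed.

Lemma transN_inj i j x : overlap i j x -> injective (transN i j x).
Proof. by move=> ox; apply: (can_inj (g := transN j i (trans i j x))) => u; exact: transNK. Qed.

Lemma bilinear_trans (V : normedModType R) (B : vec R p d -> vec R p d -> V) i j x :
  overlap i j x -> bilinear B ->
  bilinear (fun v w => B (transT i j x v) (transT i j x w)).
Proof.
move=> ox [Bl Br]; have Tl := transT_linear ox.
by split=> [w|v] k a b; rewrite Tl (Bl, Br).
Qed.

Hypothesis torC : forall i x, img i x -> torCond (torN nab i x).

(** The coordinate complements of two charts do not correspond to each other, so the traces are not
    compared directly. Transported from chart j, the coefficient satisfies the torsion identity of
    chart i, where the trace formula leaves no choice. *)
Lemma alphaOf_trans i j x v : overlap i j x ->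
  alphaOf nab j (trans i j x) (transT i j x v) = alphaOf nab i x v.
Proof.
move=> ox; have jx := trans_img ox.
have [al a0 aE] := alphaOf_spec d_even d4 suit jx (torC jx).
have Tl := transT_linear ox.
have [_ ND NZ NN] := linear_facts (transN_linear ox).
apply: (torsion_trace (coordSectionP R p d) d3 (T := torVec nab i x)
  (a := fun v => alphaOf nab j (trans i j x) (transT i j x v))) => [k u u'|w Fw|u w].
- by rewrite Tl al.
- by apply: a0; exact: transT_inF.
- apply: (transN_inj ox); rewrite torVec_gauge// aE ND NN !NZ.
  by rewrite (transN_piN w ox) (transN_piN u ox).
Qed.

Hypothesis curvC : forall i x, img i x -> curvCond (curvN nab i x).

Lemma betaOf_trans i j x v w : (6 <= d)%N -> overlap i j x ->
  betaOf nab j (trans i j x) (transT i j x v) (transT i j x w) = betaOf nab i x v w /\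
  gammaOf nab j (trans i j x) (transT i j x v) (transT i j x w) = gammaOf nab i x v w.
Proof.
move=> d6 ox; have jx := trans_img ox.
have [[bb cb] b0 _ _ OE] := betaOf_spec d_even d4 suit d6 jx (curvC jx).
have [_ ND NZ NN] := linear_facts (transN_linear ox).
have bb' := bilinear_trans ox bb; have cb' := bilinear_trans ox cb.
have b0' u u' : inF u \/ inF u' ->
    betaOf nab j (trans i j x) (transT i j x u) (transT i j x u') = 0.
  by move=> h; apply: b0; case: h => h; [left|right]; exact: transT_inF.
have OE' u u' z : curvMx nab i x u u' *m dsubmx z =
    betaOf nab j (trans i j x) (transT i j x u) (transT i j x z) *: dsubmx u'
    - betaOf nab j (trans i j x) (transT i j x u') (transT i j x z) *: dsubmx u
    + gammaOf nab j (trans i j x) (transT i j x u) (transT i j x u') *: dsubmx z.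
  apply: (transN_inj ox); rewrite curvMx_gauge// !ND NN !NZ !transN_piN//.
split; first exact: (beta3E (coordSectionP R p d) d3 bb' cb' b0' OE').
exact: (gamma3E (coordSectionP R p d) d3 bb' cb' b0' OE').
Qed.

Lemma xiOf_trans i j x v w : overlap i j x ->
  xiOf nab j (trans i j x) (transT i j x v) (transT i j x w) = xiOf nab i x v w /\
  zetaOf nab j (trans i j x) (transT i j x v) (transT i j x w) = zetaOf nab i x v w.
Proof.
move=> ox; have jx := trans_img ox.
have [[cb bb] b0 bs _ OE] := xiOf_spec d_even d4 suit jx (curvC jx).
have [_ ND NZ NN] := linear_facts (transN_linear ox).
have bb' := bilinear_trans ox bb; have cb' := bilinear_trans ox cb.
have b0' u u' : inF u \/ inF u' ->
    zetaOf nab j (trans i j x) (transT i j x u) (transT i j x u') = 0.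
  by move=> h; apply: b0; case: h => h; [left|right]; exact: transT_inF.
have OE' u u' z : curvMx nab i x u u' *m dsubmx z + curvMx nab i x z u' *m dsubmx u =
    xiOf nab j (trans i j x) (transT i j x u) (transT i j x u') *: dsubmx z
    + xiOf nab j (trans i j x) (transT i j x z) (transT i j x u') *: dsubmx u
    + (2 * zetaOf nab j (trans i j x) (transT i j x u) (transT i j x z)) *: dsubmx u'.
  apply: (transN_inj ox); rewrite ND (curvMx_gauge nab u u' (dsubmx z) ox).
  by rewrite (curvMx_gauge nab z u' (dsubmx u) ox) !ND !NZ !transN_piN.
have bs' u u' : zetaOf nab j (trans i j x) (transT i j x u) (transT i j x u') =
    zetaOf nab j (trans i j x) (transT i j x u') (transT i j x u) by exact: bs.
split.
  exact: (xi2E (coordSectionP R p d) d3 cb' bb' b0' bs' (curvMxC nab i x) OE').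
exact: (zeta2E (coordSectionP R p d) d3 cb' bb' b0' bs' (curvMxC nab i x) OE').
Qed.

Lemma tensor1_alphaOf : tensor1 (alphaOf nab).
Proof.
split=> [i x ix|i v|i j x ox v]; last exact: alphaOf_trans.
  by have [al _ _] := alphaOf_spec d_even d4 suit ix (torC ix).
exact: smooth_alphaOf.
Qed.

Lemma exists_dataRankGe6 : (6 <= d)%N -> exists a b c, dataRankGe6 nab a b c.
Proof.
move=> d6; exists (alphaOf nab), (betaOf nab), (gammaOf nab).
have sp i x ix := betaOf_spec d_even d4 suit d6 ix (@curvC i x ix).
split.
- split; first exact: tensor1_alphaOf.
  by move=> i x ix; have [_ a0 _] := alphaOf_spec d_even d4 suit ix (torC ix).
- split; last by move=> i x ix; have [_ b0 _ _ _] := sp i x ix.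
  split=> [i x ix v|i x ix w|i v w|i j x ox v w].
  + by have [[[_ h] _] _ _ _ _] := sp i x ix; exact: h.
  + by have [[[h _] _] _ _ _ _] := sp i x ix; exact: h.
  + exact: smooth_betaOf.
  + by have [] := betaOf_trans v w d6 ox.
- split.
  + split=> [i x ix v|i x ix w|i v w|i j x ox v w].
    * by have [[_ [_ h]] _ _ _ _] := sp i x ix; exact: h.
    * by have [[_ [h _]] _ _ _ _] := sp i x ix; exact: h.
    * exact: smooth_gammaOf.
    * by have [] := betaOf_trans v w d6 ox.
  + by move=> i x ix; have [_ _ h _ _] := sp i x ix.
  + apply/curvTraceOnFP => i x v w ix Fw.
    by have [_ _ _ h _] := sp i x ix; exact: h.
- apply/torsionFormP => i x v w ix.
  by have [_ _ h] := alphaOf_spec d_even d4 suit ix (torC ix); exact: h.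
- apply/curvatureForm3P => i x v w z ix.
  by have [_ _ _ _ h] := sp i x ix; exact: h.
Qed.

Lemma exists_dataRank4 : exists a xi ze, dataRank4 nab a xi ze.
Proof.
exists (alphaOf nab), (xiOf nab), (zetaOf nab).
have sp i x ix := xiOf_spec d_even d4 suit ix (@curvC i x ix).
have txi : tensor2 (xiOf nab).
  split=> [i x ix v|i x ix w|i v w|i j x ox v w].
  + by have [[[_ h] _] _ _ _ _] := sp i x ix; exact: h.
  + by have [[[h _] _] _ _ _ _] := sp i x ix; exact: h.
  + exact: smooth_xiOf.
  + by have [] := xiOf_trans v w ox.
have tze : tensor2 (zetaOf nab).
  split=> [i x ix v|i x ix w|i v w|i j x ox v w].
  + by have [[_ [_ h]] _ _ _ _] := sp i x ix; exact: h.
  + by have [[_ [h _]] _ _ _ _] := sp i x ix; exact: h.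
  + exact: smooth_zetaOf.
  + by have [] := xiOf_trans v w ox.
have zs : symmetric2 (zetaOf nab).
  by move=> i x ix v w; have [_ _ h _ _] := sp i x ix; exact: h.
split.
- split.
  + split; first exact: tensor1_alphaOf.
    by move=> i x ix; have [_ a0 _] := alphaOf_spec d_even d4 suit ix (torC ix).
  + split=> //; apply/curvTraceOnFP => i x v w ix Fw.
    by have [_ _ _ h _] := sp i x ix; exact: h.
  + by split=> // i x ix v w; have [_ h _ _ _] := sp i x ix; exact: h.
- apply/torsionFormP => i x v w ix.
  by have [_ _ h] := alphaOf_spec d_even d4 suit ix (torC ix); exact: h.
- apply/(curvatureForm2_polar nab txi tze zs)/curvatureForm2PolarP => i x v w z ix.
  by have [_ _ _ _ h] := sp i x ix; exact: h.
Qed.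

End GaugeInvariance.

(** * From the stated forms back to the pointwise conditions *)

Section Converse.
Variables (R : realType) (p d : nat) (M : foliatedManifold R p d).
Variable nab : connection M.
Implicit Types (i : chartIdx M) (x v w z : vec R p d).
Implicit Types (a : chartIdx M -> vec R p d -> vec R p d -> R^o)
  (b c xi ze : chartIdx M -> vec R p d -> vec R p d -> vec R p d -> R^o).

Lemma torsionForm_torCond a i x : torsionForm nab a -> img i x -> torCond (torN nab i x).
Proof.
move=> /torsionFormP H ix; apply: (form_torCond (al := fun u => a i x (embN p u))) => u v.
by rewrite /torN H// !embNK.
Qed.

Lemma curvatureForm3_curvCond b c i x : curvatureForm3 nab b c -> img i x ->
  curvCond (curvN nab i x).
Proof.
move=> /curvatureForm3P H ix.
suff E (u v w : 'cV[R]_d) : curvN nab i x u v *m w =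
    b i x (embN p u) (embN p w) *: v - b i x (embN p v) (embN p w) *: u
    + c i x (embN p u) (embN p v) *: w by exact: form3_curvCond E.
by have := H i x (embN p u) (embN p v) (embN p w) ix; rewrite !embNK.
Qed.

End Converse.

Lemma curvatureForm2_curvCond (R : realType) p (M : foliatedManifold R p 4)
    (nab : connection M) xi ze (i : chartIdx M) x :
  curvatureForm2Polar nab xi ze -> symmetric2 ze -> img i x -> curvCond (curvN nab i x).
Proof.
move=> /curvatureForm2PolarP H zs ix.
suff E (u v w : 'cV[R]_4) : curvN nab i x u v *m w + curvN nab i x w v *m u =
    xi i x (embN p u) (embN p v) *: w + xi i x (embN p w) (embN p v) *: u
    + (2 * ze i x (embN p u) (embN p w)) *: v.
  apply: (form2_curvCond (curvN_bilinear nab ix) (curvNC nab i x) _ E) => u v.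
  exact: zs.
by have := H i x (embN p u) (embN p v) (embN p w) ix; rewrite !embNK.
Qed.

(** * Determination of the coefficients by traces with respect to a complement *)

Section Traces.
Variables (R : realType) (p d : nat) (M : foliatedManifold R p d).
Variables (nab nab' : connection M) (E : complement M).
Hypothesis d3 : (3 <= d)%N.
Variables (i : chartIdx M) (x : vec R p d).
Hypotheses (ix : img i x) (same : sameTraces nab nab' E i x).
Implicit Types (v w z : vec R p d).

Let Ei := compl E i x.
Let E1 : dsubmx Ei = 1%:M. Proof. exact: compl_section. Qed.

Lemma torTraceE (nb : connection M) v :
  torTrace nb E i x v = \sum_k torVec nb i x v (Ei *m delta_mx k 0) k 0.
Proof. by apply: eq_bigr => k _; rewrite torsion_cst. Qed.

Lemma curvTraceE (nb : connection M) v w : curvTrace nb i x v w = \tr (curvMx nb i x v w).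
Proof.
rewrite -endoTr_mulmx; apply: eq_bigr => k _.
by rewrite curvature_cst//; exact: smooth_cst.
Qed.

Lemma ricciTraceE (nb : connection M) w u :
  ricciTrace nb E i x w u = ricci Ei (curvMx nb i x) w u.
Proof.
by apply: eq_bigr => k _; rewrite curvature_cst//; exact: smooth_cst.
Qed.

Let sameTr v w : \tr (curvMx nab i x v w) = \tr (curvMx nab' i x v w).
Proof. by have [_ h _] := same; rewrite -!curvTraceE h. Qed.

Let sameRicci w u : ricci Ei (curvMx nab i x) w u = ricci Ei (curvMx nab' i x) w u.
Proof. by have [_ _ h] := same; rewrite -!ricciTraceE h. Qed.

Lemma torsion_coefficient_trace (nb : connection M) a v : tensor1 a -> vanishF1 a ->
  torsionForm nb a -> a i x v = (d%:R - 1)^-1 * torTrace nb E i x v.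
Proof.
move=> [al _ _] a0 /torsionFormP H; rewrite torTraceE.
by apply: (torsion_trace E1 d3 v (al i x ix) (a0 i x ix)) => v' w'; exact: H.
Qed.

Lemma tensor2_bilinear b : tensor2 b -> bilinear (b i x).
Proof. by move=> [br bl _ _]; split; [exact: bl|exact: br]. Qed.

(** The trace formulas hold for every complement E, not only for the coordinate one, so equal traces
    give equal coefficients. *)
Lemma dataRankGe6_unique a b c a' b' c' :
  dataRankGe6 nab a b c -> dataRankGe6 nab' a' b' c' ->
  forall v w, [/\ a i x v = a' i x v, b i x v w = b' i x v w & c i x v w = c' i x v w].
Proof.
move=> [[ta a0] [tb b0] [tc _ _] fT /curvatureForm3P fR].
move=> [[ta' a0'] [tb' b0'] [tc' _ _] fT' /curvatureForm3P fR'] v w.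
have OE v' w' z' := fR i x v' w' z' ix; have OE' v' w' z' := fR' i x v' w' z' ix.
have bE := beta3E E1 d3 (tensor2_bilinear tb) (tensor2_bilinear tc) (b0 i x ix) OE.
have cE := gamma3E E1 d3 (tensor2_bilinear tb) (tensor2_bilinear tc) (b0 i x ix) OE.
have bE' := beta3E E1 d3 (tensor2_bilinear tb') (tensor2_bilinear tc') (b0' i x ix) OE'.
have cE' := gamma3E E1 d3 (tensor2_bilinear tb') (tensor2_bilinear tc') (b0' i x ix) OE'.
split.
- rewrite (torsion_coefficient_trace v ta a0 fT) (torsion_coefficient_trace v ta' a0' fT').
  by have [-> _ _] := same.
- by rewrite bE bE'; exact: beta3_ext.
- by rewrite cE cE'; exact: gamma3_ext.
Qed.

Lemma dataRank4_unique a xi ze a' xi' ze' :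
  dataRank4 nab a xi ze -> dataRank4 nab' a' xi' ze' ->
  forall v w, [/\ a i x v = a' i x v, xi i x v w = xi' i x v w & ze i x v w = ze' i x v w].
Proof.
move=> [[[ta a0] [tx _] [tz z0 zs]] fT fR] [[[ta' a0'] [tx' _] [tz' z0' zs']] fT' fR'] v w.
have /curvatureForm2PolarP H := (curvatureForm2_polar nab tx tz zs).1 fR.
have /curvatureForm2PolarP H' := (curvatureForm2_polar nab' tx' tz' zs').1 fR'.
have OE v' w' z' := H i x v' w' z' ix; have OE' v' w' z' := H' i x v' w' z' ix.
have xE := xi2E E1 d3 (tensor2_bilinear tx) (tensor2_bilinear tz) (z0 i x ix) (zs i x ix)
  (curvMxC nab i x) OE.
have zE := zeta2E E1 d3 (tensor2_bilinear tx) (tensor2_bilinear tz) (z0 i x ix) (zs i x ix)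
  (curvMxC nab i x) OE.
have xE' := xi2E E1 d3 (tensor2_bilinear tx') (tensor2_bilinear tz') (z0' i x ix) (zs' i x ix)
  (curvMxC nab' i x) OE'.
have zE' := zeta2E E1 d3 (tensor2_bilinear tx') (tensor2_bilinear tz') (z0' i x ix) (zs' i x ix)
  (curvMxC nab' i x) OE'.
split.
- rewrite (torsion_coefficient_trace v ta a0 fT) (torsion_coefficient_trace v ta' a0' fT').
  by have [-> _ _] := same.
- by rewrite xE xE'; exact: xi2_ext.
- by rewrite zE zE'; exact: zeta2_ext.
Qed.

End Traces.

Theorem theorem5p1 (R : realType) (p q : nat) (q_ge1 : (1 <= q)%N)
    (M : foliatedManifold R p (2 * q)) (nab : connection M)
    (suitable : stronglySuitable nab) :
  [/\ ~ integrable_acs nab (@I2 R p (2 * q)),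
      integrable_acs nab (@I1 R p (2 * q)) <->
        [\/ (3 <= q)%N /\ exists alpha beta gamma, dataRankGe6 nab alpha beta gamma,
            q = 1%N
          | q = 2%N /\ exists alpha xi zeta, dataRank4 nab alpha xi zeta],
      (forall alpha xi zeta, q = 2%N -> tensorsRank4 nab alpha xi zeta ->
        curvatureForm2 nab xi zeta <-> curvatureForm2Polar nab xi zeta),
      (forall (E : complement M) (nab' : connection M),
        (3 <= q)%N -> stronglySuitable nab' ->
        forall alpha beta gamma alpha' beta' gamma',
        dataRankGe6 nab alpha beta gamma -> dataRankGe6 nab' alpha' beta' gamma' ->
        forall i x, img i x -> sameTraces nab nab' E i x ->
        forall v w, [/\ alpha i x v = alpha' i x v,
                        beta i x v w = beta' i x v w
                      & gamma i x v w = gamma' i x v w])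
    & (forall (E : complement M) (nab' : connection M),
        q = 2%N -> stronglySuitable nab' ->
        forall alpha xi zeta alpha' xi' zeta',
        dataRank4 nab alpha xi zeta -> dataRank4 nab' alpha' xi' zeta' ->
        forall i x, img i x -> sameTraces nab nab' E i x ->
        forall v w, [/\ alpha i x v = alpha' i x v,
                        xi i x v w = xi' i x v w
                      & zeta i x v w = zeta' i x v w])].
Proof.
have d_even : ~~ odd (2 * q) by rewrite mul2n odd_double.
split.
- by apply: (integrable_I2_false d_even suitable); lia.
- rewrite (integrable_I1P d_even suitable); split=> [H|].
    have torC i x ix := (H i x ix).1; have curvC i x ix := (H i x ix).2.
    have [q1|q2|q3] : [\/ q = 1%N, q = 2%N | (3 <= q)%N].
      by case: q q_ge1 {M nab suitable d_even H torC curvC} => [|[|[|q]]] // _;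
        [apply: Or31|apply: Or32|apply: Or33].
    + exact: Or32.
    + apply: Or33; split=> //.
      by apply: (exists_dataRank4 d_even _ suitable torC curvC); lia.
    + apply: Or31; split=> //.
      by apply: (exists_dataRankGe6 d_even _ suitable torC curvC); lia.
  case=> [[q3 [a [b [c [_ _ _ fT fR]]]]]|q1|[q2 [a [xi [ze [[_ [tx _] [tz _ zs]] fT fR]]]]]] i x ix.
  + by split; [exact: torsionForm_torCond fT ix|exact: curvatureForm3_curvCond fR ix].
  + subst q; split.
      exact: altern_dim2_torCond (torN_bilinear nab ix) (torNC nab i x).
    exact: altern_dim2_curvCond (curvN_bilinear nab ix) (curvNC nab i x).
  + split; first exact: torsionForm_torCond fT ix.
    have fP := (curvatureForm2_polar nab tx tz zs).1 fR.
    by subst q; exact: curvatureForm2_curvCond fP zs ix.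
- move=> a xi ze _ [_ [tx _] [tz _ zs]]; exact: curvatureForm2_polar.
- move=> E nab' q3 _ a b c a' b' c' D D' i x ix same.
  by apply: (dataRankGe6_unique _ ix same D D'); lia.
- move=> E nab' q2 _ a xi ze a' xi' ze' D D' i x ix same.
  by apply: (dataRank4_unique _ ix same D D'); lia.
Qed.
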